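(* There is an absolute constant $\lambda_0>0$ such that the following holds for every $\lambda>\lambda_0$. Let $m_\star$ be the global minimizer of $\mathcal{F}_{\mathrm{TAP}}$ (which with probability approaching $1$ is unique up to sign). Then there exist constants $C,\mu,\eta_0>0$ and $\alpha\in(0,1)$, depending only on $\lambda$, such that with probability approaching $1$ as $n\to\infty$, the following all occur. (a) (Convergence of AMP) Let $m^k$ be the $k$-th iterate of AMP from the spectral initialization. For some choice of sign $\pm$ and every $k\ge1$, $$\mathcal{F}_{\mathrm{TAP}}(m^k)-\mathcal{F}_{\mathrm{TAP}}(\pm m_\star)<C\alpha^k,\qquad \|m^k-(\pm m_\star)\|_2<C\alpha^k\sqrt n.$$ (b) (Convergence of NGD) Fix any step size $\eta\in(0,\eta_0)$, and let $m^k$ be the $k$-th iterate of NGD with step size $\eta$ from the spectral initialization. For some choice of sign $\pm$ and every $k\ge1$, $$\mathcal{F}_{\mathrm{TAP}}(m^k)-\mathcal{F}_{\mathrm{TAP}}(\pm m_\star)<C(1-\mu\eta)^k,\qquad \|m^k-(\pm m_\star)\|_2<C(1-\mu\eta)^k\sqrt n.$$ In particular, for both algorithms, $\lim_{k\to\infty}m^k\in\{+m_\star,-m_\star\}$.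
   Context: $\mathbb{Z}_2$-synchronization model: $x\in\{-1,+1\}^n$ has i.i.d. coordinates uniform on $\{-1,+1\}$, and one observes $Y=\frac{\lambda}{n}xx^\top+W$, where $W\sim\mathrm{GOE}(n)$ is independent of $x$: $W$ is symmetric, with independent entries $W_{ii}\sim\mathcal{N}(0,2/n)$ and $W_{ij}\sim\mathcal{N}(0,1/n)$ for $i<j$. For $m\in(-1,1)^n$, let $Q(m)=\|m\|_2^2/n$. The TAP free energy is $$\mathcal{F}_{\mathrm{TAP}}(m)=-\frac{\lambda}{2n}\langle m,Ym\rangle-\frac1n\sum_{i=1}^n\mathsf{h}(m_i)-\frac{\lambda^2}{4}[1-Q(m)]^2,$$ where $\mathsf{h}(u)=-\frac{1+u}{2}\log\frac{1+u}{2}-\frac{1-u}{2}\log\frac{1-u}{2}$. It satisfies $\mathcal{F}_{\mathrm{TAP}}(m)=\mathcal{F}_{\mathrm{TAP}}(-m)$. For $\lambda$ larger than an absolute constant, with probability approaching $1$ the global minimizers of $\mathcal{F}_{\mathrm{TAP}}$ over $(-1,1)^n$ are exactly $\pm m_\star$ for some $m_\star$. AMP: from given $h^0,m^{-1}\in\mathbb{R}^n$, iterate $m^k=\tanh(h^k)$, $h^{k+1}=\lambda Ym^k-\lambda^2[1-Q(m^k)]m^{k-1}$ for $k\ge0$ ($\tanh$ entrywise). Spectral initialization: $h^0$ is a principal eigenvector of $Y$ (eigenvector for the largest eigenvalue), scaled so that $\|h^0\|_2=\sqrt{n\lambda^2(\lambda^2-1)}$, and $m^{-1}=\lambda h^0$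 (the latter is used only by AMP). NGD (natural gradient descent) with step size $\eta>0$: $m^k=\tanh(h^k)$, $h^{k+1}=h^k-\eta n\cdot\nabla\mathcal{F}_{\mathrm{TAP}}(m^k)=(1-\eta)h^k+\eta\big(\lambda Ym^k-\lambda^2[1-Q(m^k)]m^k\big)$ for $k\ge 0$. *)

(* Defs.v *)
From HB Require Import structures.
From mathcomp Require Export all_boot all_order all_algebra.
From mathcomp Require Export all_classical all_reals all_analysis.
From mathcomp Require Import ring lra.
Export numFieldNormedType.Exports.

Set Implicit Arguments.
Unset Strict Implicit.
Unset Printing Implicit Defensive.

Import Order.TTheory GRing.Theory Num.Theory.

Local Open Scope classical_set_scope.
Local Open Scope ring_scope.

Section Independence.
Context {R : realType} {d : measure_display} {T : measurableType d}.
Variable P : probability T R.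

Definition mutually_independent (I : finType) (X : I -> {RV P >-> R}) : Prop :=
  forall (J : {set I}) (B : I -> set R), (forall i, measurable (B i)) ->
    P (\bigcap_(i in [set` J]) (X i @^-1` B i)) =
    (\prod_(i in J) P (X i @^-1` B i))%E.

Definition sigma_generated (I : Type) (X : I -> {RV P >-> R}) : set (set T) :=
  <<s \bigcup_i preimage_set_system setT (X i) measurable >>.

Definition independent (I J : Type)
    (X : I -> {RV P >-> R}) (Y : J -> {RV P >-> R}) : Prop :=
  forall A B, sigma_generated X A -> sigma_generated Y B ->
    P (A `&` B) = (P A * P B)%E.

End Independence.

Section Model.
Context {R : realType} {d : measure_display} {T : measurableType d}.
Variables (P : probability T R) (n : nat).

Definition uniform_sign (X : {RV P >-> R}) : Prop :=
  P (X @^-1` [set 1]) = (2^-1)%:E /\ P (X @^-1` [set -1]) = (2^-1)%:E.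

(* [normal_prob] takes the standard deviation as its second argument. *)
Definition normal_rv (X : {RV P >-> R}) (mean var : R) : Prop :=
  forall A, measurable A ->
    distribution P X A = normal_prob mean (Num.sqrt var) A.

Definition upper_index := {p : 'I_n * 'I_n | (p.1 <= p.2)%N}.

Definition is_GOE (W : 'I_n -> 'I_n -> {RV P >-> R}) : Prop :=
  [/\ forall (i j : 'I_n) w, W i j w = W j i w,
      forall i, normal_rv (W i i) 0 (2 / n%:R),
      forall i j : 'I_n, (i < j)%N -> normal_rv (W i j) 0 (1 / n%:R) &
      mutually_independent
        (fun p : upper_index => W (val p).1 (val p).2)].

Definition Z2_synchronization (x : 'I_n -> {RV P >-> R})
    (W : 'I_n -> 'I_n -> {RV P >-> R}) : Prop :=
  [/\ forall i, uniform_sign (x i),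
      mutually_independent x,
      is_GOE W &
      independent x (fun p : 'I_n * 'I_n => W p.1 p.2)].

Definition observation (lambda : R) (x : 'I_n -> {RV P >-> R})
    (W : 'I_n -> 'I_n -> {RV P >-> R}) (w : T) : 'M[R]_n :=
  let xw : 'cV[R]_n := \col_i x i w in
  (lambda / n%:R) *: (xw *m xw^T) + \matrix_(i, j) W i j w.

End Model.

(* The events are not assumed measurable (they involve uncountable
   quantifiers), hence the inner approximation by measurable events. *)
Definition with_probability_to_1 {R : realType} {d : nat -> measure_display}
    {T : forall n, measurableType (d n)} (P : forall n, probability (T n) R)
    (E : forall n, set (T n)) : Prop :=
  exists A : forall n, set (T n),
    [/\ forall n, measurable (A n),
        forall n, A n `<=` E n &
        (fun n => P n (A n)) @ \oo --> 1%E].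

Section TAP.
Context {R : realType}.
Variable n : nat.
Implicit Types (m h : 'cV[R]_n) (Y : 'M[R]_n) (lambda eta u : R).

Definition dot m h : R := \sum_i m i ord0 * h i ord0.

(* The library norm [`|m|] of a matrix is the sup norm. *)
Definition l2norm m : R := Num.sqrt (dot m m).

Definition overlap m : R := l2norm m ^+ 2 / n%:R.

Definition binary_entropy u : R :=
  - ((1 + u) / 2) * ln ((1 + u) / 2) - ((1 - u) / 2) * ln ((1 - u) / 2).

Definition F_TAP lambda Y m : R :=
  - (lambda / (2 * n%:R)) * dot m (Y *m m)
  - n%:R^-1 * (\sum_i binary_entropy (m i ord0))
  - lambda ^+ 2 / 4 * (1 - overlap m) ^+ 2.

Definition open_cube : set 'cV[R]_n := [set m | forall i, -1 < m i ord0 < 1].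

Definition global_minimizer (f : 'cV[R]_n -> R) (D : set 'cV[R]_n) m : Prop :=
  D m /\ forall m', D m' -> f m <= f m'.

Definition gradient (f : 'cV[R]_n -> R) m : 'cV[R]_n :=
  \col_i 'D_(delta_mx i ord0) f m.

Definition tanh u : R := (expR u - expR (- u)) / (expR u + expR (- u)).

Definition tanhv h : 'cV[R]_n := map_mx tanh h.

Definition principal_eigenvector Y h : Prop :=
  h != 0 /\ exists a : R,
    Y *m h = a *: h /\ forall b, eigenvalue Y b -> b <= a.

Definition spectral_init lambda Y h : Prop :=
  principal_eigenvector Y h /\
  l2norm h = Num.sqrt (n%:R * lambda ^+ 2 * (lambda ^+ 2 - 1)).

(* [amp_state lambda Y h0 mprev k] is the pair (h^k, m^(k-1)), where
   [mprev] is m^(-1). *)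
Fixpoint amp_state lambda Y (h0 mprev : 'cV[R]_n) (k : nat) :
    'cV[R]_n * 'cV[R]_n :=
  if k is k'.+1 then
    let: (h, m') := amp_state lambda Y h0 mprev k' in
    let m := tanhv h in
    (lambda *: (Y *m m) - (lambda ^+ 2 * (1 - overlap m)) *: m', m)
  else (h0, mprev).

Definition amp lambda Y (h0 mprev : 'cV[R]_n) (k : nat) : 'cV[R]_n :=
  tanhv (amp_state lambda Y h0 mprev k).1.

Fixpoint ngd_state lambda Y eta (h0 : 'cV[R]_n) (k : nat) : 'cV[R]_n :=
  if k is k'.+1 then
    let h := ngd_state lambda Y eta h0 k' in
    h - (eta * n%:R) *: gradient (F_TAP lambda Y) (tanhv h)
  else h0.

Definition ngd lambda Y eta (h0 : 'cV[R]_n) (k : nat) : 'cV[R]_n :=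
  tanhv (ngd_state lambda Y eta h0 k).

Definition converges_at_rate lambda Y (mstar : 'cV[R]_n) (C r : R)
    (m : nat -> 'cV[R]_n) : Prop :=
  exists2 s, s = mstar \/ s = - mstar &
    forall k, (1 <= k)%N ->
      F_TAP lambda Y (m k) - F_TAP lambda Y s < C * r ^+ k /\
      l2norm (m k - s) < C * r ^+ k * Num.sqrt n%:R.

End TAP.

(* [observation] is symmetric, and for symmetric [Y] the
   gradient step of [ngd_state] is the usual closed-form NGD recursion. *)

Lemma observation_sym (R : realType) (d : measure_display)
    (T : measurableType d) (P : probability T R) (n : nat) (lambda : R)
    (x : 'I_n -> {RV P >-> R}) (W : 'I_n -> 'I_n -> {RV P >-> R}) (w : T) :
  is_GOE W ->
  (observation lambda x W w)^T = observation lambda x W w.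
Proof.
case=> Wsym _ _ _; rewrite /observation linearD linearZ/= trmx_mul trmxK.
by congr (_ + _); apply/matrixP => i j; rewrite !mxE Wsym.
Qed.

Lemma is_derive_line (R : realType) (n : nat) (f : 'cV[R]_n -> R)
    (m v : 'cV[R]_n) (df : R) :
  is_derive (0 : R) 1 (fun t : R => f (t *: v + m)) df -> is_derive m v f df.
Proof.
set g := fun t : R => f (t *: v + m).
have E : (fun h : R => h^-1 *: ((g \o shift 0) (h *: 1) - g 0)) =
         (fun h : R => h^-1 *: ((f \o shift m) (h *: v) - f m)).
  by apply/funext => h; rewrite /g/= addr0 scale0r add0r; congr (_ *: (f (_ *: _ + _) - _)); exact: mulr1.
move=> [dg eg]; split.
  by rewrite /derivable -E.
by rewrite /derive -E.
Qed.

Lemma is_derive_entropy (R : realType) (u : R) : -1 < u < 1 ->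
  is_derive u 1 binary_entropy (- (ln ((1 + u) / 2) - ln ((1 - u) / 2)) / 2).
Proof.
move=> /andP[u1 u2].
have p1 : 0 < (1 + u) / 2 by lra.
have p2 : 0 < (1 - u) / 2 by lra.
have D1 : is_derive u 1 (fun u : R => (1 + u) / 2) (1/2).
  have -> : (fun u : R => (1 + u) / 2) = (2^-1) *: (cst 1 + id).
    by apply/funext => x; rewrite /= [RHS]mulrC.
  by apply: is_derive_eq; rewrite add0r; exact: mulrC.
have D2 : is_derive u 1 (fun u : R => (1 - u) / 2) (- (1/2)).
  have -> : (fun u : R => (1 - u) / 2) = (2^-1) *: (cst 1 - id).
    by apply/funext => x; rewrite /= [RHS]mulrC.
  by apply: is_derive_eq; rewrite sub0r /GRing.scale /=; lra.
have L1 : is_derive u 1 (fun u : R => ln ((1 + u) / 2)) (((1 + u) / 2)^-1 * (1 / 2)).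
  exact: (@is_derive1_comp _ (@ln R) (fun u : R => (1 + u) / 2) _ _ _ (is_derive1_ln p1) D1).
have L2 : is_derive u 1 (fun u : R => ln ((1 - u) / 2)) (((1 - u) / 2)^-1 * - (1 / 2)).
  exact: (@is_derive1_comp _ (@ln R) (fun u : R => (1 - u) / 2) _ _ _ (is_derive1_ln p2) D2).
have := is_deriveB (is_deriveM (is_deriveN D1) L1) (is_deriveM D2 L2).
move=> H; apply: (is_derive_eq (f := binary_entropy) H).
rewrite /GRing.scale /=.
have e1 : (1 + u) / 2 != 0 by lra.
have e2 : (1 - u) / 2 != 0 by lra.
rewrite !fctE.
set l1 := ln _; set l2 := ln _.
field.
have ->: (1 - u != 0) by lra.
by have ->: (1 + u != 0) by lra.
Qed.

Lemma tanh_in (R : realType) (u : R) : -1 < tanh u < 1.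
Proof.
have := expR_gt0 u; have := expR_gt0 (- u).
rewrite /tanh => a b; apply/andP; split.
- by rewrite ltr_pdivlMr ?addr_gt0//; lra.
- by rewrite ltr_pdivrMr ?addr_gt0//; lra.
Qed.

Lemma atanh_tanh (R : realType) (u : R) :
  (ln ((1 + tanh u) / 2) - ln ((1 - tanh u) / 2)) / 2 = u.
Proof.
have a := expR_gt0 u; have b := expR_gt0 (- u).
have c : 0 < expR u + expR (-u) by rewrite addr_gt0.
have -> : (1 + tanh u) / 2 = expR u / (expR u + expR (-u)).
  by rewrite /tanh; field; rewrite lt0r_neq0.
have -> : (1 - tanh u) / 2 = expR (-u) / (expR u + expR (-u)).
  by rewrite /tanh; field; rewrite lt0r_neq0.
rewrite !ln_div ?posrE// !expRK; lra.
Qed.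

Section Gradient.
Context {R : realType} {n : nat}.
Implicit Types (a b m : 'cV[R]_n).

Lemma dotE a b : dot a b = (a^T *m b) ord0 ord0.
Proof. by rewrite /dot !mxE; apply: eq_bigr => i _; rewrite mxE. Qed.

Lemma dotC a b : dot a b = dot b a.
Proof. by apply: eq_bigr => i _; rewrite mulrC. Qed.

Lemma dotDl a b c : dot (a + b) c = dot a c + dot b c.
Proof. by rewrite -big_split; apply: eq_bigr => i _; rewrite mxE mulrDl. Qed.

Lemma dotZl (k : R) a c : dot (k *: a) c = k * dot a c.
Proof. by rewrite big_distrr; apply: eq_bigr => i _; rewrite mxE -mulrA. Qed.

Lemma dotDr a b c : dot c (a + b) = dot c a + dot c b.
Proof. by rewrite dotC dotDl !(dotC c). Qed.

Lemma dotZr (k : R) a c : dot c (k *: a) = k * dot c a.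
Proof. by rewrite dotC dotZl dotC. Qed.

Lemma dot_delta i a : dot (delta_mx i ord0) a = a i ord0.
Proof.
rewrite /dot (bigD1 i)//= mxE !eqxx mul1r big1 ?addr0// => j /negPf ji.
by rewrite mxE ji mul0r.
Qed.

Lemma dot_sym (Y : 'M[R]_n) a b : Y^T = Y -> dot a (Y *m b) = dot b (Y *m a).
Proof.
move=> YT; rewrite (dotC b) !dotE trmx_mul YT mulmxA.
by [].
Qed.

Lemma overlapE m : overlap m = dot m m / n%:R.
Proof.
by rewrite /overlap /l2norm sqr_sqrtr// sumr_ge0// => i _; exact: sqr_ge0.
Qed.

Lemma F_TAP_line lambda (Y : 'M[R]_n) m i (t : R) : Y^T = Y ->
  F_TAP lambda Y (t *: delta_mx i ord0 + m) =
  - (lambda / (2 * n%:R)) *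
     (t * t * Y i i + 2 * t * (Y *m m) i ord0 + dot m (Y *m m))
  - n%:R^-1 * (binary_entropy (t + m i ord0) +
               \sum_(j | j != i) binary_entropy (m j ord0))
  - lambda ^+ 2 / 4 * (1 - (t * t + 2 * t * m i ord0 + dot m m) / n%:R) ^+ 2.
Proof.
move=> YT; rewrite /F_TAP; congr (_ * _ - _ * _ - _ * (1 - _)^+2).
- rewrite mulmxDr -scalemxAr !(dotDl, dotDr, dotZl, dotZr).
  rewrite (dot_sym _ _ YT) !dot_delta.
  have -> : (Y *m (delta_mx i ord0 : 'cV_n)) i ord0 = Y i i.
    by rewrite -colE mxE.
  have -> : dot m (Y *m delta_mx i ord0) = (Y *m m) i ord0.
    by rewrite (dot_sym _ _ YT) dot_delta.
  ring.
- rewrite (bigD1 i)//=; congr (binary_entropy _ + _).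
    by rewrite !mxE !eqxx mulr1.
  by apply: eq_bigr => j /negPf ji; rewrite !mxE ji mulr0 add0r.
- rewrite overlapE !(dotDl, dotDr, dotZl, dotZr) (dotC m) !dot_delta mxE !eqxx.
  by congr (_ / _) => /=; ring.
Qed.

Lemma gradient_F_TAP lambda (Y : 'M[R]_n) m : Y^T = Y -> open_cube m ->
  n%:R *: gradient (F_TAP lambda Y) m =
  \col_i ((ln ((1 + m i ord0) / 2) - ln ((1 - m i ord0) / 2)) / 2)
  - (lambda *: (Y *m m) - (lambda ^+ 2 * (1 - overlap m)) *: m).
Proof.
move=> YT mc; apply/matrixP => i j; rewrite ord1 !mxE.
have n0 : n%:R != 0 :> R by rewrite pnatr_eq0; case: (n) i => [[]|].
set at_i := (_ / 2 in RHS).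
set ymi := (\sum_j _ in RHS).
suff H : is_derive m (delta_mx i ord0) (F_TAP lambda Y)
    (n%:R^-1 * (at_i - (lambda * ymi - lambda ^+ 2 * (1 - overlap m) * m i ord0))).
  by rewrite derive_val mulrA divff// mul1r.
refine (is_derive_line _).
have FE := funext (fun t => F_TAP_line lambda m i t YT).
rewrite FE {FE}.
have -> : ymi = (Y *m m) i ord0 by rewrite mxE.
rewrite overlapE.
have De : is_derive (0 : R) 1 (fun t => binary_entropy (t + m i ord0)) (- at_i).
  have Ds : is_derive (0 : R) 1 (shift (m i ord0)) 1 by exact: is_derive_shift.
  have Dh : is_derive (shift (m i ord0) 0) 1 binary_entropy (- at_i).
    by rewrite /= add0r /at_i -mulNr; exact: is_derive_entropy.
  by have := is_derive1_comp Dh Ds; rewrite mulr1.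
have Did : is_derive (0 : R) 1 (@id R) 1 by exact: is_derive_id.
have Dc (k : R) : is_derive (0 : R) 1 (cst k) 0 by exact: is_derive_cst.
have Dq (k1 k2 : R) : is_derive (0 : R) 1 (fun t => t * t * k1 + 2 * t * k2) (2 * k2).
  have := is_deriveD (is_deriveM (is_deriveM Did Did) (Dc k1))
    (is_deriveM (is_deriveM (Dc 2) Did) (Dc k2)).
  move=> H; apply: (is_derive_eq H); rewrite !fctE /GRing.scale /=; ring.
have D1 := is_deriveM (Dc (- (lambda / (2 * n%:R))))
  (is_deriveD (Dq (Y i i) ((Y *m m) i ord0)) (Dc (dot m (Y *m m)))).
have D2 := is_deriveM (Dc (n%:R^-1))
  (is_deriveD De (Dc (\sum_(j0 | j0 != i) binary_entropy (m j0 ord0)))).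
have D3' : is_derive (0 : R) 1
    (fun t => 1 - (t * t + 2 * t * m i ord0 + dot m m) / n%:R)
    (- (2 * m i ord0 / n%:R)).
  have := is_deriveB (Dc 1)
    (is_deriveM (is_deriveD (Dq 1 (m i ord0)) (Dc (dot m m))) (Dc n%:R^-1)).
  rewrite (_ : _ - _ = fun t => 1 - (t * t + 2 * t * m i ord0 + dot m m) / n%:R).
    by move=> H; apply: (is_derive_eq H); rewrite !fctE /GRing.scale /=; ring.
  by apply/funext => t; rewrite !fctE mulr1.
have D3 := is_deriveM (Dc (lambda ^+ 2 / 4)) (is_deriveX 2 D3').
have := is_deriveB (is_deriveB D1 D2) D3.
move=> H; apply: (is_derive_eq H).
rewrite !fctE /GRing.scale /=.
field.
by [].
Qed.

Lemma ngd_stateS lambda (Y : 'M[R]_n) eta h0 k : Y^T = Y ->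
  let h := ngd_state lambda Y eta h0 k in
  let m := ngd lambda Y eta h0 k in
  ngd_state lambda Y eta h0 k.+1 =
  (1 - eta) *: h
  + eta *: (lambda *: (Y *m m) - (lambda ^+ 2 * (1 - overlap m)) *: m).
Proof.
move=> YT h m /=; rewrite -/h -[tanhv h]/m -scalerA gradient_F_TAP//; last first.
  move=> i; rewrite mxE; exact: tanh_in.
set X := lambda *: _ - _.
rewrite (_ : \col_i _ = h); last first.
  apply/matrixP => i j; rewrite (ord1 j) mxE.
  have -> : m i ord0 = tanh (h i ord0) by rewrite mxE.
  by rewrite atanh_tanh.
by apply/matrixP => i j; move: (h) X => g X; rewrite !mxE; ring.
Qed.
End Gradient.

(* Main.v *)
Require Import Defs.
From mathcomp Require Import measurable_realfun zify ring lra.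

(** Write Y = (lambda / n) x x^T + M, let G be the map sending (m, m') to
    lambda Y m - lambda^2 (1 - Q(m)) m', and work in the fields h, with
    m = tanh(h).  A critical point of the energy is a fixed point
    h = G(tanh h, tanh h); AMP iterates G with m' the previous magnetization,
    and a step of NGD averages h with G(tanh h, tanh h).

    When lambda is large the signal saturates tanh: up to sign, x_i h_i is of
    order lambda^2 outside a set of about n / lambda^4 coordinates.  There the
    slope of tanh is about exp(- lambda^2), so that differences of fields act
    on G only through the few remaining coordinates.  The operator norm of M
    is of order 1, but its restriction to any n / lambda^3 coordinates has
    norm below 1 / (16 lambda), because the entropy of the choice of these
    coordinates is small.  Hence G is a contraction by a constant factor, in
    the norm that damps each coordinate by the square root of a slope of tanh
    ([damped_le], [field_contraction]).  The square root is what makes this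
    work: it turns the derivative of G into a symmetrically damped matrix
    [D^(1/2) (lambda Y) D^(1/2)], which the norms of small blocks control.

    All of this needs only three deterministic properties of M, collected in
    [regular_noise]: a bounded norm, small norms of small blocks, and few large
    coordinates of M x.  Under them,
    - a global minimizer m exists, since near the boundary of the cube the
      entropy outweighs the rest of the energy ([clip_le]), and it is a fixed
      point ([minimizer_stationary]);
    - comparison with the energy of a multiple of x gives
      1 - <x, m> / n = O(1 / lambda), up to the sign of m
      ([minimizer_correlated]), and the fixed point equation improves this
      until its field is saturated ([fixed_point_aligned]);
    - two saturated fixed points coincide by contraction
      ([fixed_point_unique]), which gives uniqueness up to sign;
    - the principal eigenvector is a multiple of x + M x / lambda up to a small
      error ([spectral_decomposed]), saturation persists along both
      algorithms, and contraction gives the rates ([ngd_rate], [amp_rate]).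
    The energy gap follows from the distance because the fields stay bounded
    ([F_gap]).

    The properties of M hold with probability 1 - exp(- c n): a bilinear form
    is maximized over integer points ([rounding]), each of which is controlled
    by a Gaussian tail ([GOE_form_tail]), and a weighted union bound sums over
    the lattice ([block_norm_event]).  For the coordinates of M x one
    conditions on the value of x, which is independent of the noise
    ([rare_large_coordinates_event]). *)

Set Implicit Arguments.
Unset Strict Implicit.
Unset Printing Implicit Defensive.

Import Order.TTheory GRing.Theory Num.Theory.

Local Open Scope classical_set_scope.
Local Open Scope ring_scope.

(** * Euclidean inner product and norm *)

Section Euclidean.
Context {R : realType} {n : nat}.
Implicit Types (u v w : 'cV[R]_n) (c : R).

Lemma dotNl u v : dot (- u) v = - dot u v.
Proof. by rewrite -scaleN1r dotZl mulN1r. Qed.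

Lemma dotNr u v : dot u (- v) = - dot u v.
Proof. by rewrite dotC dotNl dotC. Qed.

Lemma dotBl u v w : dot (u - v) w = dot u w - dot v w.
Proof. by rewrite dotDl dotNl. Qed.

Lemma dotBr u v w : dot u (v - w) = dot u v - dot u w.
Proof. by rewrite dotDr dotNr. Qed.

Lemma dot_sqrD u v : dot (u + v) (u + v) = dot u u + 2 * dot u v + dot v v.
Proof. by rewrite dotDl !dotDr (dotC v u); ring. Qed.

Lemma dot_sqrB u v : dot (u - v) (u - v) = dot u u - 2 * dot u v + dot v v.
Proof. by rewrite dotBl !dotBr (dotC v u); ring. Qed.

Lemma dot_ge0 u : 0 <= dot u u.
Proof. by apply: sumr_ge0 => i _; exact: sqr_ge0. Qed.

Lemma dot_eq0 u : (dot u u == 0) = (u == 0).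
Proof.
apply/eqP/eqP => [/psumr_eq0P H|->]; last by rewrite -(scale0r 0) dotZl mul0r.
apply/matrixP => i j; rewrite ord1 mxE; apply/eqP; rewrite -sqrf_eq0 expr2.
by rewrite H// => k _; exact: sqr_ge0.
Qed.

Lemma dot0l v : dot 0 v = 0.
Proof. by rewrite -(scale0r 0) dotZl mul0r. Qed.

Lemma dot0r v : dot v 0 = 0.
Proof. by rewrite dotC dot0l. Qed.

Lemma l2norm_ge0 u : 0 <= l2norm u.
Proof. exact: sqrtr_ge0. Qed.

Lemma sqr_l2norm u : l2norm u ^+ 2 = dot u u.
Proof. by rewrite sqr_sqrtr// dot_ge0. Qed.

Lemma l2norm_eq0 u : (l2norm u == 0) = (u == 0).
Proof. by rewrite -sqrf_eq0 sqr_l2norm dot_eq0. Qed.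

Lemma l2norm0 : l2norm (0 : 'cV[R]_n) = 0.
Proof. by apply/eqP; rewrite l2norm_eq0. Qed.

Lemma l2norm_le u c : 0 <= c -> dot u u <= c ^+ 2 -> l2norm u <= c.
Proof. by move=> c0 H; rewrite -(@ler_pXn2r _ 2) ?nnegrE ?l2norm_ge0// sqr_l2norm. Qed.

(** Cauchy-Schwarz, from the square of q u - p v with p, q the two norms. *)
Lemma dot_le_l2norm u v : dot u v <= l2norm u * l2norm v.
Proof.
have [->|u0] := eqVneq u 0; first by rewrite dot0l l2norm0 mul0r.
have [->|v0] := eqVneq v 0; first by rewrite dot0r l2norm0 mulr0.
set p := l2norm u; set q := l2norm v.
have pq : 0 < p * q by rewrite mulr_gt0// lt0r l2norm_eq0 ?u0 ?v0 l2norm_ge0.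
have := dot_ge0 (q *: u - p *: v).
rewrite dotBl !dotBr !dotZl !dotZr -(sqr_l2norm u) -(sqr_l2norm v) -/p -/q (dotC v u).
have -> : q * (q * p ^+ 2) - q * (p * dot u v) -
    (p * (q * dot u v) - p * (p * q ^+ 2)) = 2 * ((p * q) * (p * q - dot u v)).
  by ring.
by rewrite pmulr_rge0// pmulr_rge0// subr_ge0.
Qed.

Lemma l2normN u : l2norm (- u) = l2norm u.
Proof. by rewrite /l2norm dotNl dotNr opprK. Qed.

Lemma normr_dot_le u v : `|dot u v| <= l2norm u * l2norm v.
Proof.
rewrite ler_norml dot_le_l2norm andbT lerNl -dotNl.
by rewrite (le_trans (dot_le_l2norm _ _))// l2normN.
Qed.

Lemma dot_sqr_le u v : dot u v ^+ 2 <= dot u u * dot v v.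
Proof.
rewrite -(sqr_l2norm u) -(sqr_l2norm v) -exprMn -real_normK ?num_real//.
by rewrite ler_pXn2r ?nnegrE ?mulr_ge0 ?l2norm_ge0// normr_dot_le.
Qed.

Lemma l2normZ c u : l2norm (c *: u) = `|c| * l2norm u.
Proof. by rewrite /l2norm dotZl dotZr mulrA -expr2 sqrtrM ?sqr_ge0// sqrtr_sqr. Qed.

Lemma l2normD u v : l2norm (u + v) <= l2norm u + l2norm v.
Proof.
apply: l2norm_le; first by rewrite addr_ge0// l2norm_ge0.
rewrite dotDl !dotDr -(sqr_l2norm u) -(sqr_l2norm v) (dotC v u).
have := dot_le_l2norm u v; set p := l2norm u; set q := l2norm v; nra.
Qed.

Lemma l2normB u v : l2norm (u - v) <= l2norm u + l2norm v.
Proof. by rewrite (le_trans (l2normD _ _))// l2normN. Qed.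

Lemma l2norm_dual u c : 0 <= c -> (forall v, dot v u <= c * l2norm v) -> l2norm u <= c.
Proof.
move=> c0 H; have [->|u0] := eqVneq u 0; first by rewrite l2norm0.
have p : 0 < l2norm u by rewrite lt0r l2norm_eq0 u0 l2norm_ge0.
by have := H u; rewrite -sqr_l2norm expr2 ler_pM2r.
Qed.

End Euclidean.

(** * Change of measure and products of independent variables *)

Section DensityFactor.
Import HBNNSimple.
Local Open Scope ereal_scope.
Context {R : realType} {d : measure_display} {T : measurableType d}.
Variables (m : {measure set T -> \bar R}) (nu : {measure set R -> \bar R}).

(** Change of variables under a density: the hypothesis is the conclusion for
    indicator functions, and simple approximation extends it. It serves twice,
    for the Gaussian law (G a density) and for independence (G the product of
    the other factors, c its mean). *)
Lemma ge0_integral_density (X : T -> R) (G : T -> R) (c : R) :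
  measurable_fun setT X -> measurable_fun setT G -> (forall w, (0 <= G w)%R) -> (0 <= c)%R ->
  (forall B, measurable B ->
     \int[m]_w ((G w)%:E * (\1_(X @^-1` B) w)%:E) = c%:E * nu B) ->
  forall f : R -> R, measurable_fun setT f -> (forall y, (0 <= f y)%R) ->
  \int[m]_w ((G w)%:E * (f (X w))%:E) = c%:E * \int[nu]_y (f y)%:E.
Proof.
move=> mX0 mG G0 c0 HB f mf f0.
have mG' : measurable_fun setT (fun w => (G w)%:E) by exact/measurable_EFinP.
have G0' w : 0 <= (G w)%:E by rewrite lee_fin.
have mX B : measurable B -> measurable (X @^-1` B).
  by move=> mB; rewrite -[X in measurable X]setTI; exact: mX0.
(* Simple functions, by linearity. *)
have Hnn (h : {nnsfun R >-> R}) :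
    \int[m]_w ((G w)%:E * (h (X w))%:E) = c%:E * \int[nu]_y (h y)%:E.
  have mh y : measurable (h @^-1` [set y]).
    by rewrite -[X in measurable X]setTI; exact: measurable_funPT.
  have E x : (h x)%:E =
      \sum_(y \in range h) (y * \1_(h @^-1` [set y]) x)%:E.
    by rewrite fimfunE -fsumEFin.
  have p0 y w : 0 <= (y * \1_(X @^-1` (h @^-1` [set y])) w)%:E.
    exact: (nnfun_muleindic_ge0 h y (X w)).
  have mi y : measurable_fun setT
      (fun w => (y * \1_(X @^-1` (h @^-1` [set y])) w)%:E).
    apply/measurable_EFinP; apply: measurable_funM => //.
    by apply: measurable_indic; exact: mX.
  have mi' y : measurable_fun setT
      (fun x : R => (y * \1_(h @^-1` [set y]) x)%:E : \bar R).
    by apply/measurable_EFinP; apply: measurable_funM.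
  have p0' y x : 0 <= (y * \1_(h @^-1` [set y]) x)%:E.
    exact: (nnfun_muleindic_ge0 h y x).
  under [in LHS]eq_integral => w _.
    rewrite E ge0_mule_fsumr; last by move=> y; exact: p0.
    over.
  rewrite ge0_integral_fsum//; last 2 first.
  - by move=> y; apply: emeasurable_funM.
  - by move=> y w _; apply: mule_ge0.
  under [in RHS]eq_integral => w _ do rewrite E.
  rewrite ge0_integral_fsum// ge0_mule_fsumr; last by move=> y; exact: integral_ge0.
  apply: eq_fsbigr => y _.
  (* A negative value is not taken by h, and both sides vanish. *)
  have [y0|y0] := leP 0%R y; last first.
    have e0 x : (\1_(h @^-1` [set y]) x = 0 :> R)%R.
      rewrite indicE memNset//= => hy.
      by have : (0 <= h x)%R by []; rewrite hy leNgt y0.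
    under eq_integral => w _ do rewrite (e0 (X w)) mulr0 mule0.
    under [in RHS]eq_integral do rewrite e0 mulr0.
    by rewrite !integral0 mule0.
  under eq_integral do rewrite EFinM muleCA.
  under [in RHS]eq_integral do rewrite EFinM.
  have mI : measurable_fun setT
      (fun w => (\1_(X @^-1` (h @^-1` [set y])) w)%:E : \bar R).
    by apply/measurable_EFinP; apply: measurable_indic; exact: mX.
  rewrite !ge0_integralZl ?lee_fin//.
  - rewrite integral_indic// setIT muleCA; congr (_ * _); exact: HB.
  - by apply: emeasurable_funM.
  - by move=> w _; apply: mule_ge0.
  - exact/measurable_EFinP/measurable_indic.
have mf' : measurable_fun setT (EFin \o f) by exact/measurable_EFinP.
pose f_ := nnsfun_approx measurableT mf'.
have f_cvg y : (f_ n y)%:E @[n --> \oo] --> (f y)%:E.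
  by apply: (@cvg_nnsfun_approx _ _ _ _ measurableT _ mf') => // ? _; rewrite lee_fin.
have f_nd y a b : (a <= b)%N -> ((f_ a y)%:E <= (f_ b y)%:E).
  by move=> ab; rewrite lee_fin; exact/lefP/nd_nnsfun_approx.
have mfX n : measurable_fun setT (fun w => (f_ n (X w))%:E).
  by apply/measurable_EFinP; apply: measurableT_comp.
have L : \int[m]_w ((G w)%:E * (f (X w))%:E) =
    limn (fun n => \int[m]_w ((G w)%:E * (f_ n (X w))%:E)).
  rewrite -monotone_convergence//=.
  - apply: eq_integral => w _; apply/esym/cvg_lim => //.
    by apply: cvgeZl => //; exact: f_cvg.
  - by move=> n; apply: emeasurable_funM.
  - by move=> n w _; rewrite mule_ge0// lee_fin.
  - by move=> w _ a b ab; rewrite lee_wpmul2l// f_nd.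
have mfy n : measurable_fun setT (fun y : R => (f_ n y)%:E : \bar R).
  exact/measurable_EFinP.
have r : \int[nu]_y (f y)%:E = limn (fun n => \int[nu]_y (f_ n y)%:E).
  rewrite -monotone_convergence//=.
  - by apply: eq_integral => y _; apply/esym/cvg_lim => //; exact: f_cvg.
  - by move=> n w _; rewrite lee_fin.
  - by move=> w _ a b ab; exact: f_nd.
rewrite L r -limeMl//.
  by congr (limn _); apply/funext => n /=; rewrite Hnn.
by apply/ereal_nondecreasing_is_cvgn => a b ab; apply: ge0_le_integral => //;
  [move=> w _; rewrite lee_fin|move=> w _; exact: f_nd].
Qed.

End DensityFactor.

Section ProductExpectation.
Local Open Scope ereal_scope.
Context {R : realType} {d : measure_display} {T : measurableType d}.
Variable P : probability T R.

(** Independence is a product rule for events. Factors are replaced by general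
    functions one at a time, by induction on the list of indices whose factor
    need not be an indicator; the density lemma does one replacement. *)
Lemma integral_prod_independent (I : finType) (X : I -> {RV P >-> R}) :
  mutually_independent X -> forall (f : I -> R -> R) (a : I -> R),
  (forall i, measurable_fun setT (f i)) -> (forall i y, (0 <= f i y)%R) ->
  (forall i, \int[P]_w (f i (X i w))%:E = (a i)%:E) ->
  \int[P]_w (\prod_i f i (X i w))%:E = (\prod_i a i)%:E.
Proof.
move=> indX.
have mX i B : measurable B -> measurable (X i @^-1` B).
  by move=> mB; rewrite -[X in measurable X]setTI; exact: measurable_funPT.
suff H : forall (s : seq I) (f : I -> R -> R) (a : I -> R),
    (forall i, measurable_fun setT (f i)) -> (forall i y, (0 <= f i y)%R) ->
    (forall i, \int[P]_w (f i (X i w))%:E = (a i)%:E) ->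
    (forall i, i \notin s -> exists2 B, measurable B & f i = \1_B) ->
    \int[P]_w (\prod_i f i (X i w))%:E = (\prod_i a i)%:E.
  move=> f a mf f0 fa; apply: (H (enum I)) => // i.
  by rewrite mem_enum.
elim=> [|i s IH] f a mf f0 fa fB.
  have /choice[B HB] : forall i, exists B, measurable B /\ f i = \1_B.
    by move=> i; have [//|B ? ?] := fB i; exists B.
  have aE i : (a i)%:E = P (X i @^-1` B i).
    rewrite -fa (HB i).2 -[X in P X]setIT -integral_indic//.
    by apply: mX; exact: (HB i).1.
  (* The product of indicators is the indicator of the intersection. *)
  have -> : (fun w => (\prod_i f i (X i w))%:E) =
      (fun w => (\1_(\bigcap_(i in [set` [set: I]%SET]) (X i @^-1` B i)) w)%:E).
    apply/funext => w; congr (_%:E); rewrite indicE.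
    case: (boolP (w \in _)) => [|] /= Hw.
      rewrite big1// => i _; rewrite (HB i).2 indicE mem_set//.
      by move: Hw; rewrite inE; apply; rewrite /= inE.
    have [i Hi] : exists i, ~ B i (X i w).
      apply/existsNP => H; move/negP : Hw; apply; rewrite inE => i _; exact: H.
    by rewrite (bigD1 i)//= (HB i).2 indicE memNset// mul0r.
  rewrite integral_indic ?setIT//; last first.
    by apply: fin_bigcap_measurable => // i _; apply: mX; exact: (HB i).1.
  etransitivity; first by apply: (indX [set: I]%SET B) => i; exact: (HB i).1.
  transitivity (\prod_i P (X i @^-1` B i)); last first.
    by rewrite -prodEFin; apply: eq_bigr => i _; exact: esym (aE i).
  by apply: eq_bigl => i; rewrite finset.in_setT.
pose G w : R := (\prod_(j | j != i) f j (X j w))%R.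
pose c : R := (\prod_(j | j != i) a j)%R.
have a0 j : (0 <= a j)%R.
  by rewrite -lee_fin -fa; apply: integral_ge0 => w _; rewrite lee_fin.
have mG : measurable_fun setT G.
  have -> : G = (fun w => \prod_(j <- index_enum I) (if j != i then f j (X j w) else 1))%R.
    by apply/funext => w; exact: big_mkcond.
  apply: measurable_prod => j _; case: (j != i) => //.
  by apply: measurableT_comp.
under eq_integral => w _ do rewrite (bigD1 i)//= mulrC EFinM -/(G w).
rewrite (@ge0_integral_density _ _ _ P (distribution P (X i)) (X i) G c) => //.
- rewrite ge0_integral_distribution ?fa//; last 2 first.
  + exact/measurable_EFinP.
  + by move=> y; rewrite lee_fin.
  by rewrite -EFinM (bigD1 i)//= mulrC.
- by move=> w; apply: prodr_ge0.
- exact: prodr_ge0.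
move=> B mB.
pose f' j := if j == i then \1_B else f j.
pose a' j := if j == i then fine (P (X i @^-1` B)) else a j.
have fP : P (X i @^-1` B) = (fine (P (X i @^-1` B)))%:E.
  by rewrite fineK// fin_num_measure//; exact: mX.
have a'E : (\prod_j a' j = fine (P (X i @^-1` B)) * c)%R.
  rewrite (bigD1 i)//= /a' eqxx; congr (_ * _)%R.
  by apply: eq_bigr => j /negPf ->.
have f'E w : (\prod_j f' j (X j w) = G w * \1_(X i @^-1` B) w)%R.
  rewrite (bigD1 i)//= /f' eqxx mulrC; congr (_ * _)%R.
  by apply: eq_bigr => j /negPf ->.
have := IH f' a'.
rewrite a'E mulrC EFinM -fP => <-.
- by apply: eq_integral => w _; rewrite f'E EFinM.
- by move=> j; rewrite /f'; case: ifP => // _; exact: measurable_indic.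
- by move=> j y; rewrite /f'; case: ifP => // _; rewrite indicE.
- move=> j; rewrite /f' /a'; case: ifP => [/eqP -> |//].
  by rewrite -fP -[X in P X]setIT -integral_indic//; exact: mX.
- move=> j js; rewrite /f'; case: ifPn => [_|ji]; first by exists B.
  by apply: fB; rewrite inE negb_or ji.
Qed.

End ProductExpectation.

(** * Gaussian tails *)

Lemma measurable_ge (R : realType) (d : measure_display)
    (T : measurableType d) (f : T -> R) (c : R) :
  measurable_fun setT f -> measurable [set w | c <= f w].
Proof.
move=> mf; have := mf measurableT `[c, +oo[%classic (measurable_itv _).
rewrite setTI; congr measurable; apply/seteqP.
by split => w /=; rewrite in_itv/= andbT.
Qed.

Section GaussianTail.
Local Open Scope ereal_scope.
Context {R : realType} {d : measure_display} {T : measurableType d}.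
Variable P : probability T R.

(** Completing the square: the exponential tilt of a Gaussian density is a
    constant times a shifted Gaussian density. *)
Lemma normal_mgf (X : {RV P >-> R}) (v c : R) : (0 < v)%R -> normal_rv X 0 v ->
  \int[P]_w (expR (c * X w))%:E = (expR (c ^+ 2 * v / 2))%:E.
Proof.
move=> v0 HX.
set s := Num.sqrt v.
have s0 : (s != 0)%R by rewrite gt_eqF// sqrtr_gt0.
have s2 : (s ^+ 2 = v)%R by rewrite sqr_sqrtr// ltW.
have me : measurable_fun setT (fun y : R => expR (c * y)).
  by apply: measurableT_comp => //; exact: measurable_funM.
have -> : \int[P]_w (expR (c * X w))%:E =
    \int[distribution P X]_y (expR (c * y))%:E.
  rewrite ge0_integral_distribution//; exact/measurable_EFinP.
have H : forall B, measurable B ->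
    \int[@lebesgue_measure R]_y ((normal_pdf 0 s y)%:E * (\1_B y)%:E) =
    1%:E * distribution P X B.
  move=> B mB; rewrite mul1e HX// /normal_prob -/s [RHS]integral_mkcond.
  apply: eq_integral => y _; rewrite patchE indicE.
  by case: ifP => _; rewrite ?mule1 ?mule0.
have := @ge0_integral_density _ _ _ (@lebesgue_measure R) (distribution P X)
  idfun (normal_pdf 0 s) 1 (@measurable_id _ _ _).
move=> /(_ (measurable_normal_pdf _ _)) /(_ (normal_pdf_ge0 _ _)).
move=> /(_ ler01 H _ me) /(_ (fun=> expR_ge0 _)).
rewrite mul1e => <-.
have E y : ((normal_pdf 0 s y)%:E * (expR (c * y))%:E =
    (expR (c ^+ 2 * v / 2))%:E * (normal_pdf (c * v) s y)%:E).
  rewrite -!EFinM !normal_pdfE// /normal_fun; congr (_%:E).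
  rewrite -[LHS]mulrA -expRD [RHS]mulrCA -expRD; congr (_ * expR _)%R; rewrite s2.
  by rewrite -[(v *+ 2)%R]mulr_natl; field; rewrite gt_eqF.
under eq_integral do rewrite E.
rewrite ge0_integralZl ?lee_fin ?expR_ge0//.
- by rewrite integral_normal_pdf mule1.
- by apply/measurable_EFinP; exact: measurable_normal_pdf.
- by move=> y _; rewrite lee_fin normal_pdf_ge0.
Qed.

(** Chernoff bound, with the optimal parameter t / V. *)
Lemma gaussian_combination_tail (I : finType) (X : I -> {RV P >-> R})
    (v c : I -> R) (V t : R) :
  mutually_independent X -> (forall i, (0 < v i)%R) ->
  (forall i, normal_rv (X i) 0 (v i)) ->
  (\sum_i c i ^+ 2 * v i <= V)%R -> (0 < V)%R -> (0 < t)%R ->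
  P [set w | (t <= \sum_i c i * X i w)%R] <= (expR (- (t ^+ 2 / (2 * V))))%:E.
Proof.
move=> indX v0 HX HV V0 t0.
set S := fun w => (\sum_i c i * X i w)%R.
pose r : R := (t / V)%R.
have mS : measurable_fun setT S.
  by apply: measurable_sum => i; apply: measurable_funM.
have mA : measurable [set w | (t <= S w)%R] by exact: measurable_ge.
have E : \int[P]_w (expR (r * S w))%:E =
    (\prod_i expR ((r * c i) ^+ 2 * v i / 2))%:E.
  rewrite -(@integral_prod_independent _ _ _ P I X indX
    (fun i y => expR ((r * c i) * y)))//.
  - apply: eq_integral => w _; congr (_%:E); rewrite -expR_sum; congr expR.
    by rewrite /S mulr_sumr; apply: eq_bigr => i _; rewrite mulrA.
  - by move=> i; apply: measurableT_comp => //; exact: measurable_funM.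
  - by move=> i; rewrite (@normal_mgf _ (v i)).
(* Markov's inequality for exp (r S). *)
have B : (expR (r * t))%:E * P [set w | (t <= S w)%R] <=
    (expR (r ^+ 2 * V / 2))%:E.
  apply: (@le_trans _ _ (\int[P]_w (expR (r * S w))%:E)); last first.
    rewrite E lee_fin -expR_sum ler_expR -!mulr_suml ler_wpM2r// ?invr_ge0//.
    under eq_bigr do rewrite exprMn -mulrA.
    by rewrite -mulr_sumr ler_wpM2l// sqr_ge0.
  rewrite -[X in P X]setIT -integral_indic//.
  rewrite -ge0_integralZl ?lee_fin ?expR_ge0//; last first.
    by apply/measurable_EFinP; exact: measurable_indic.
  apply: ge0_le_integral => //.
  - apply/measurable_EFinP; apply: measurable_funM => //.
  - apply/measurable_EFinP; apply: measurableT_comp => //.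
    exact: measurable_funM.
  - move=> w _; rewrite indicE -EFinM lee_fin.
    case: (boolP (w \in _)) => [|_]; last by rewrite mulr0 expR_ge0.
    rewrite inE /= mulr1 ler_expR => tS.
    by rewrite ler_wpM2l// divr_ge0// ltW.
have e0 : (0 < expR (r * t))%R by exact: expR_gt0.
rewrite -(@lee_pmul2l _ (expR (r * t))%:E)// (le_trans B)// -EFinM lee_fin -expRD.
rewrite ler_expR /r le_eqVlt; apply/orP; left; apply/eqP.
by field; rewrite gt_eqF.
Qed.

End GaussianTail.

Section SymmetricSums.
Context {R : realType} {n : nat}.

(** The weight of an entry on or above the diagonal in a sum over all entries
    of a symmetric matrix. *)
Definition symmetrized (F : 'I_n * 'I_n -> R) (p : 'I_n * 'I_n) : R :=
  if p.1 == p.2 then F p else F p + F (p.2, p.1).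

Lemma sum_upper_index (F : 'I_n * 'I_n -> R) :
  \sum_(p : upper_index n) symmetrized F (val p) = \sum_p F p.
Proof.
pose A := [pred p : 'I_n * 'I_n | (p.1 <= p.2)%N].
transitivity (\sum_(p in A) symmetrized F p).
  by rewrite (big_sub A).
rewrite [RHS](bigID A)/=.
have -> : \sum_(p : 'I_n * 'I_n | ~~ (p.1 <= p.2)%N) F p =
    \sum_(p | A p) (if p.1 == p.2 then 0 else F (p.2, p.1)).
  (* Below the diagonal, exchange the two indices. *)
  rewrite (reindex_inj (h := fun p : 'I_n * 'I_n => (p.2, p.1))); last first.
    by move=> [a b] [c e] [-> ->].
  rewrite [RHS](bigID (fun p : 'I_n * 'I_n => p.1 == p.2))/= [X in _ = X + _]big1 ?add0r; last first.
    by move=> p /andP[_ ->].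
  apply: eq_big => [p|p] /=.
    by rewrite -ltnNge ltn_neqAle andbC.
  by rewrite -ltnNge => /ltn_eqF ne; rewrite -(inj_eq val_inj) ne.
rewrite -big_split; apply: eq_bigr => p _; rewrite /symmetrized.
by case: ifP => //= _; rewrite addr0.
Qed.

End SymmetricSums.

Section GOE.
Context {R : realType} {d : measure_display} {T : measurableType d}.
Variables (P : probability T R) (n : nat).

Definition matrix_at (W : 'I_n -> 'I_n -> {RV P >-> R}) (w : T) : 'M[R]_n :=
  \matrix_(i, j) W i j w.

Lemma dot_matrix_at (W : 'I_n -> 'I_n -> {RV P >-> R}) (u v : 'cV[R]_n) w :
  dot u (matrix_at W w *m v) =
  \sum_(p : 'I_n * 'I_n) u p.1 ord0 * v p.2 ord0 * W p.1 p.2 w.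
Proof.
rewrite -(pair_bigA _ (fun i j => u i ord0 * v j ord0 * W i j w))/=.
apply: eq_bigr => i _; rewrite !mxE mulr_sumr; apply: eq_bigr => j _.
by rewrite mxE mulrAC mulrA.
Qed.

(** The form is a combination of the independent entries with p.1 <= p.2;
    its variance is (|u|^2 |v|^2 + <u, v>^2) / n, hence at most 2 |u|^2
    |v|^2 / n. *)
Lemma GOE_form_tail (W : 'I_n -> 'I_n -> {RV P >-> R}) (u v : 'cV[R]_n) (V t : R) :
  is_GOE W -> (0 < n)%N -> 2 / n%:R * (dot u u * dot v v) <= V -> 0 < V -> 0 < t ->
  (P [set w | (t <= dot u (matrix_at W w *m v))%R] <= (expR (- (t ^+ 2 / (2 * V))))%:E)%E.
Proof.
move=> [Wsym Wdiag Woff Wind] n0 HV V0 t0.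
have n0' : 0 < n%:R :> R by rewrite ltr0n.
pose c p : R := symmetrized (fun p => u p.1 ord0 * v p.2 ord0) p.
pose va (p : 'I_n * 'I_n) : R := if p.1 == p.2 then 2 / n%:R else 1 / n%:R.
have -> : [set w | (t <= dot u (matrix_at W w *m v))%R] =
    [set w | t <= \sum_(p : upper_index n) c (val p) * W (val p).1 (val p).2 w].
  apply/seteqP; suff E w : dot u (matrix_at W w *m v) =
      \sum_(p : upper_index n) c (val p) * W (val p).1 (val p).2 w.
    by split => w /=; rewrite E.
  rewrite dot_matrix_at -sum_upper_index; apply: eq_bigr => p _.
  rewrite /c /symmetrized; case: ifP => //= _.
  by rewrite mulrDl (Wsym (val p).2).
apply: (gaussian_combination_tail (v := fun p => va (val p))) => //.
- by move=> p; rewrite /va; case: ifP => _; rewrite divr_gt0.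
- move=> [[i j] ij] /=; rewrite /va/=; case: ifPn => [/eqP <-|ne]; first exact: Wdiag.
  by apply: Woff; rewrite ltn_neqAle ij andbT.
apply: le_trans HV.
rewrite /dot big_distrlr/= pair_bigA/= mulr_sumr -sum_upper_index.
apply: ler_sum => -[[i j] ij] _ /=; rewrite /c /va /symmetrized/=.
case: ifP => [_|_]; first by rewrite le_eqVlt; apply/orP; left; apply/eqP; ring.
set a := u i _; set b := v j _; set e := u j _; set f := v i _.
rewrite -subr_ge0 [leRHS](_ : _ = n%:R^-1 * (a * b - e * f) ^+ 2); last by ring.
by rewrite mulr_ge0 ?sqr_ge0// invr_ge0 ltW.
Qed.

Lemma measurable_form (W : 'I_n -> 'I_n -> {RV P >-> R}) (u v : 'cV[R]_n) :
  measurable_fun setT (fun w => dot u (matrix_at W w *m v)).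
Proof.
under eq_fun do rewrite dot_matrix_at.
by apply: measurable_sum => p; apply: measurable_funM.
Qed.

End GOE.

(** * Rounding to the integer lattice *)

Section Lattice.
Context {R : realType} (n N : nat).

(** The integer points of the cube [-N, N]^n, stored with a shift by N so that
    the coordinates are ordinals. *)
Definition lattice := {ffun 'I_n -> 'I_(N.*2.+1)}.

Definition lattice_vec (z : lattice) : 'cV[R]_n := \col_i ((z i)%:R - N%:R).

(** A theta series. The last term of the bound makes the induction on N
    close. *)
Lemma sum_gaussian_weights_le (q : R) : 0 <= q -> q <= 2^-1 ->
  \sum_(k < N.*2.+1) q ^+ (`|k%:Z - N%:Z| ^ 2)%N <= 1 + 4 * q - 4 * q ^+ N.+1.
Proof.
move=> q0 q1; elim: N => [|M IH].
  rewrite big_ord_recl big_ord0 (_ : (_ ^ 2)%N = 0%N)// expr0 expr1; lra.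
rewrite doubleS big_ord_recl big_ord_recr/=.
have -> : \sum_(i < M.*2.+1) q ^+ (`|(bump 0 i)%:Z - M.+1%:Z| ^ 2) =
    \sum_(k < M.*2.+1) q ^+ (`|k%:Z - M%:Z| ^ 2).
  apply: eq_bigr => i _; congr (_ ^+ (`|_| ^ 2)).
  by rewrite /bump /= add1n -addn1 -[M.+1]addn1 !PoszD; ring.
rewrite subn0.
have -> : (`|(bump 0 M.*2.+1)%:Z - M.+1%:Z| = M.+1)%N by rewrite /bump/=; lia.
have H : q ^+ (M.+1 ^ 2) <= q ^+ M.+1.
  by apply: ler_wiXn2l => //; [lra | rewrite -mulnn leq_pmulr].
have H2 : q ^+ M.+2 <= 2^-1 * q ^+ M.+1 by rewrite exprS ler_wpM2r// exprn_ge0.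
lra.
Qed.

(** The number of lattice points of squared norm at most k is at most exp(s k)
    times this sum, so that it replaces a covering bound in the union bounds
    below. *)
Lemma sum_lattice_le (s : R) : 0 <= s -> expR (- s) <= 2^-1 ->
  \sum_(z : lattice) expR (- (s * dot (lattice_vec z) (lattice_vec z))) <=
  expR (4 * n%:R * expR (- s)).
Proof.
move=> s0 s1; set q := expR (- s).
have q0 : 0 < q by exact: expR_gt0.
have E (z : lattice) : expR (- (s * dot (lattice_vec z) (lattice_vec z))) =
    \prod_i q ^+ (`|(z i)%:Z - N%:Z| ^ 2)%N.
  rewrite /dot mulr_sumr -sumrN expR_sum; apply: eq_bigr => i _.
  rewrite /q -expRM_natl natrX natr_absz intr_norm rmorphB/= real_normK ?num_real//.
  by rewrite mxE -mulNr mulrC -expr2.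
under eq_bigr do rewrite E.
rewrite -(bigA_distr_bigA (fun _ (k : 'I_(N.*2.+1)) => q ^+ (`|k%:Z - N%:Z| ^ 2)%N)).
rewrite prodr_const card_ord -mulrA mulrCA expRM_natl lerXn2r ?nnegrE ?expR_ge0//.
  by apply: sumr_ge0 => k _; rewrite exprn_ge0// ltW.
apply: le_trans (sum_gaussian_weights_le (ltW q0) s1) _.
apply: le_trans (expR_ge1Dx _).
by rewrite lerBlDr lerDl mulr_ge0// exprn_ge0// ltW.
Qed.

Lemma lattice_vecP (v : 'cV[R]_n) : (forall i, v i ord0 \is a Num.int) ->
  dot v v <= N%:R ^+ 2 -> exists z, lattice_vec z = v.
Proof.
move=> vint vN.
have vb i : `|v i ord0| <= N%:R.
  rewrite -(@ler_pXn2r _ 2) ?nnegrE// real_normK ?num_real//.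
  apply: le_trans vN; rewrite /dot (bigD1 i)//= expr2 lerDl.
  by apply: sumr_ge0 => j _; exact: sqr_ge0.
have H i : exists k : 'I_(N.*2.+1), k%:R - N%:R = v i ord0.
  have /intrP[m Hm] := vint i.
  have := vb i; rewrite Hm -intr_norm -[N%:R]/(N%:Z%:~R) ler_int => mb.
  have kb : (`|(m + N%:Z)%R|%N < N.*2.+1)%N by lia.
  exists (Ordinal kb) => /=.
  by rewrite natr_absz ger0_norm; [rewrite rmorphD/= addrK|lia].
have /choice[z Hz] := H; exists [ffun i => z i].
by apply/matrixP => i j; rewrite ord1 mxE ffunE.
Qed.

End Lattice.

Section Rounding.
Context {R : realType} {n : nat}.

(** A linear form on a product of intervals is maximized at a vertex; here the
    intervals are those between consecutive integers. *)
Lemma rounding (u w : 'cV[R]_n) : exists z : 'cV[R]_n,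
  [/\ forall i, z i ord0 \is a Num.int, forall i, u i ord0 = 0 -> z i ord0 = 0,
      forall i, `|z i ord0 - u i ord0| <= 1 & dot u w <= dot z w].
Proof.
pose z : 'cV[R]_n := \col_i (if 0 <= w i ord0 then Num.ceil (u i ord0)
                             else Num.floor (u i ord0))%:~R.
exists z; split.
- by move=> i; rewrite mxE; exact: intr_int.
- by move=> i ui; rewrite mxE ui; case: ifP; rewrite ?ceil0 ?floor0.
- move=> i; rewrite mxE.
  have := ceil_ge (u i ord0); have := ceilB1_lt (u i ord0).
  have := floor_le (u i ord0); have := floorD1_gt (u i ord0).
  rewrite rmorphD rmorphB/= => a b c e.
  by case: ifP => _; rewrite ler_norml; apply/andP; split; lra.
- apply: ler_sum => i _; rewrite mxE; case: ifP => wi.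
    by rewrite ler_wpM2r// ceil_ge.
  by rewrite ler_wnM2r ?floor_le//; lra.
Qed.

Definition supported (S : {set 'I_n}) (u : 'cV[R]_n) :=
  forall i, i \notin S -> u i ord0 = 0.

(** Rounding changes at most #|S| coordinates, each by at most 1, which is
    harmless when the squared norm is of order #|S|. *)
Lemma rounding_norm (S : {set 'I_n}) (u z : 'cV[R]_n) (k : R) :
  supported S u -> supported S z -> #|S|%:R <= k -> dot u u <= k ->
  (forall i, `|z i ord0 - u i ord0| <= 1) -> dot z z <= 4 * k.
Proof.
move=> uS zS Sk uk zu.
have H : dot z z <= 2 * dot u u + 2 * #|S|%:R.
  rewrite -sum1_card natr_sum !mulr_sumr [X in _ + X]big_mkcond/= -big_split.
  apply: ler_sum => i _ /=; case: (boolP (i \in S)) => iS.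
    have := zu i; rewrite ler_norml => /andP[a b].
    have := sqr_ge0 (z i ord0 - 2 * u i ord0).
    have : (z i ord0 - u i ord0) ^+ 2 <= 1 by nra.
    lra.
  by rewrite uS// zS//; lra.
by apply: le_trans H _; lra.
Qed.

(** Round one vector with the other fixed, then the other: integer points
    suffice to bound the norm of a block. The scale is chosen so that the
    vectors have squared norm k = delta n, the bound on the size of the
    support. *)
Lemma bilinear_rounding (M : 'M[R]_n) (S : {set 'I_n}) (delta tau : R) (N : nat) :
  0 < delta * n%:R -> 4 * (delta * n%:R) <= N%:R ^+ 2 ->
  (forall z z' : lattice n N, let v : 'cV[R]_n := lattice_vec z in
     let v' := lattice_vec z' in
     dot v v <= 4 * (delta * n%:R) -> dot v' v' <= 4 * (delta * n%:R) ->
     dot v (M *m v') <= tau * (delta * n%:R)) ->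
  #|S|%:R <= delta * n%:R ->
  forall u v, supported S u -> supported S v ->
  dot u (M *m v) <= tau * (l2norm u * l2norm v).
Proof.
move=> k0 kN H Sk.
set k := delta * n%:R in k0 kN H Sk *.
have unit u v : supported S u -> supported S v -> dot u u <= k -> dot v v <= k ->
    dot u (M *m v) <= tau * k.
  move=> uS vS uk vk.
  have [z [zint z0 zu zH]] := rounding u (M *m v).
  have [z' [z'int z'0 z'u z'H]] := rounding v (M^T *m z).
  have zS : supported S z by move=> i iS; rewrite z0// uS.
  have z'S : supported S z' by move=> i iS; rewrite z'0// vS.
  have zk := rounding_norm uS zS Sk uk zu.
  have z'k := rounding_norm vS z'S Sk vk z'u.
  have [y yE] := lattice_vecP zint (le_trans zk kN).
  have [y' y'E] := lattice_vecP z'int (le_trans z'k kN).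
  have := H y y'; rewrite /= yE y'E => /(_ zk z'k) H'.
  apply: le_trans zH (le_trans _ H').
  have tr a b : dot b (M^T *m a) = dot a (M *m b).
    by rewrite dotC !dotE trmx_mul trmxK mulmxA.
  by move: z'H; rewrite !tr.
move=> u v uS vS.
have [->|u0] := eqVneq u 0; first by rewrite dot0l l2norm0 mul0r mulr0.
have [->|v0] := eqVneq v 0; first by rewrite mulmx0 dot0r l2norm0 !mulr0.
have p0 : 0 < l2norm u by rewrite lt0r l2norm_eq0 u0 l2norm_ge0.
have q0 : 0 < l2norm v by rewrite lt0r l2norm_eq0 v0 l2norm_ge0.
pose r := Num.sqrt k.
have r2 : r ^+ 2 = k by rewrite sqr_sqrtr// ltW.
have r0 : 0 < r by rewrite sqrtr_gt0.
(* Both vectors are rescaled to squared norm k. *)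
have := unit ((r / l2norm u) *: u) ((r / l2norm v) *: v).
have sc (w : 'cV[R]_n) : 0 < l2norm w ->
    dot ((r / l2norm w) *: w) ((r / l2norm w) *: w) <= k.
  move=> w0; rewrite dotZl dotZr -sqr_l2norm -r2 le_eqVlt; apply/orP; left; apply/eqP.
  by field; rewrite gt_eqF.
move=> /(_ _ _ (sc _ p0) (sc _ q0)).
rewrite -scalemxAr dotZl dotZr => B.
have {}B : r / l2norm u * (r / l2norm v * dot u (M *m v)) <= tau * k.
  by apply: B => i iS; rewrite mxE ?uS ?vS// mulr0.
have e : r / l2norm u * (r / l2norm v * dot u (M *m v)) =
    dot u (M *m v) / (l2norm u * l2norm v) * k.
  by rewrite -r2; field; rewrite !gt_eqF.
by move: B; rewrite e ler_pM2r// ler_pdivrMr// mulr_gt0.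
Qed.

End Rounding.

(** * Norms of the small blocks of a GOE matrix *)

Section UnionBound.
Context {R : realType} {d : measure_display} {T : measurableType d}.
Variable P : probability T R.

Lemma union_bound (I : finType) (B : I -> set T) (b : I -> R) :
  (forall i, measurable (B i)) -> (forall i, (P (B i) <= (b i)%:E)%E) ->
  measurable [set w | exists i, B i w] /\
  (P [set w | exists i, B i w] <= (\sum_i b i)%:E)%E.
Proof.
move=> mB PB.
have -> : [set w | exists i, B i w] = \big[setU/set0]_(i <- enum I) B i.
  rewrite -bigcup_seq; apply/seteqP; split => w /=.
    by move=> [i Bi]; exists i => //=; rewrite mem_enum.
  by move=> [i _ Bi]; exists i.
have -> : \sum_i b i = \sum_(i <- enum I) b i by rewrite big_enum.
move: (enum I); elim => [|i s [m IH]].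
  by rewrite !big_nil measure0.
rewrite !big_cons; split; first exact: measurableU.
apply: (le_trans (measureU2 _ _ _)) => //.
rewrite EFinD; exact: leeD (PB i) IH.
Qed.

End UnionBound.

Section BlockEvent.
Context {R : realType} {d : measure_display} {T : measurableType d}.
Variables (P : probability T R) (n : nat).

(** Simultaneous control of all blocks of size delta n. Integer points of
    squared norm at most 4 k need no reference to their support, so that the
    choice of the block costs nothing more. In the exponent, 8 s delta + 8 exp
    (- s) is the entropy of the pairs of points and tau^2 / 64 the Gaussian
    gain. *)
Lemma block_norm_event (W : 'I_n -> 'I_n -> {RV P >-> R}) (delta tau s : R) :
  is_GOE W -> (0 < n)%N -> 0 < delta <= 1 -> 0 < tau -> 0 <= s ->
  expR (- s) <= 2^-1 ->
  exists B : set T, [/\ measurable B,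
    (P B <= (expR (n%:R * (8 * s * delta + 8 * expR (- s) - tau ^+ 2 / 64)))%:E)%E &
    forall w, ~ B w -> forall S : {set 'I_n}, #|S|%:R <= delta * n%:R ->
    forall u v : 'cV[R]_n, supported S u -> supported S v ->
    dot u (matrix_at W w *m v) <= tau * (l2norm u * l2norm v)].
Proof.
move=> HW n0 /andP[d0 d1] t0 s0 s1.
have n0' : 0 < n%:R :> R by rewrite ltr0n.
set k := delta * n%:R.
have k0 : 0 < k by rewrite mulr_gt0.
(* The points have squared norm at most 4 k <= 4 n, hence coordinates at most 2
   n. *)
pose L := lattice n n.*2.
pose vec (z : L) : 'cV[R]_n := lattice_vec z.
pose small (z : L) := dot (vec z) (vec z) <= 4 * k.
pose D (p : L * L) := if small p.1 && small p.2 then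
  [set w | tau * k <= dot (vec p.1) (matrix_at W w *m vec p.2)] else set0.
(* A weight at least 1 on the points concerned, and summable over the
   lattice. *)
pose wt (z : L) := expR (s * (4 * k)) * expR (- (s * dot (vec z) (vec z))).
pose e := expR (- (n%:R * (tau ^+ 2 / 64))).
have wt0 z : 0 <= wt z by rewrite mulr_ge0 ?expR_ge0.
have wt1 z : small z -> 1 <= wt z.
  move=> sz; rewrite /wt -expRD -[leLHS]expR0 ler_expR -mulrBr mulr_ge0// subr_ge0//.
have mD p : measurable (D p).
  rewrite /D; case: ifP => // _; apply: measurable_ge; exact: measurable_form.
have PD p : (P (D p) <= (wt p.1 * wt p.2 * e)%:E)%E.
  rewrite /D; case: ifPn => [/andP[s2 s3]|_]; last first.
    by rewrite measure0 lee_fin !mulr_ge0 ?expR_ge0.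
  apply: (@le_trans _ _ e%:E); last first.
    rewrite lee_fin ler_peMl ?expR_ge0//.
    by rewrite -[leLHS]mulr1 ler_pM// wt1.
  have := @GOE_form_tail _ _ _ P n W (vec p.1) (vec p.2) (32 * delta ^+ 2 * n%:R) (tau * k) HW n0.
  move=> H; apply: le_trans (H _ _ _) _.
  - apply: (@le_trans _ _ (2 / n%:R * ((4 * k) * (4 * k)))).
      by rewrite ler_wpM2l ?divr_ge0 ?(ltW n0')// ler_pM// dot_ge0.
    by rewrite le_eqVlt; apply/orP; left; apply/eqP; rewrite /k; field; rewrite gt_eqF.
  - by rewrite !mulr_gt0 ?exprn_gt0.
  - by rewrite mulr_gt0.
  - rewrite lee_fin ler_expR lerN2 le_eqVlt; apply/orP; left; apply/eqP.
    by rewrite /k; field; rewrite !gt_eqF.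
have [mB PB] := union_bound mD PD.
exists [set w | exists p, D p w]; split => //.
  apply: le_trans PB _; rewrite lee_fin.
  have -> : \sum_(p : L * L) wt p.1 * wt p.2 * e = (\sum_z wt z) ^+ 2 * e.
    by rewrite -mulr_suml expr2 big_distrlr/= pair_bigA.
  have S1 : \sum_z wt z <= expR (s * (4 * k) + 4 * n%:R * expR (- s)).
    rewrite -mulr_sumr expRD ler_wpM2l ?expR_ge0//.
    exact: sum_lattice_le.
  apply: (@le_trans _ _ (expR (s * (4 * k) + 4 * n%:R * expR (- s)) ^+ 2 * e)).
    by rewrite ler_wpM2r ?expR_ge0// lerXn2r// nnegrE ?expR_ge0// sumr_ge0.
  rewrite -expRM_natl -expRD ler_expR le_eqVlt; apply/orP; left; apply/eqP.
  by rewrite /k; ring.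
move=> w Bw S Sk u v uS vS.
apply: (bilinear_rounding (N := n.*2) (S := S) k0) => //.
  rewrite -/k; apply: (@le_trans _ _ (4 * n%:R)).
    by rewrite ler_wpM2l// /k ler_piMl// ltW.
  rewrite -natrX -natrM ler_nat -mul2n expnMn leq_mul// -mulnn leq_pmulr//.
move=> z z' /= zk z'k; rewrite leNgt; apply/negP => H.
apply: Bw; exists (z, z'); rewrite /D /small /vec /= zk z'k /=; exact: ltW.
Qed.

End BlockEvent.

(** * Coordinates of the noise applied to the spike *)

Section GeneratedSigma.
Context {R : realType} {d : measure_display} {T : measurableType d}.
Variable P : probability T R.

Lemma sigma_generated_le (I : finType) (X : I -> {RV P >-> R}) (c : I -> R) (t : R) :
  sigma_generated X [set w | t <= \sum_i c i * X i w].
Proof.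
pose G := \bigcup_i preimage_set_system setT (X i) measurable.
pose T' : measurableType _ := g_sigma_algebraType G.
have mX i : measurable_fun (setT : set T') (X i : T' -> R).
  move=> _ B mB; apply: sub_sigma_algebra; exists i => //.
  by exists B.
have mS : measurable_fun (setT : set T') (fun w : T' => \sum_i c i * X i w).
  by apply: measurable_sum => i; apply: measurable_funM.
exact: measurable_ge mS.
Qed.

Lemma sigma_generated_bigcap (I : finType) (X : I -> {RV P >-> R}) (c : I -> R) :
  sigma_generated X (\bigcap_(i in [set: I]) X i @^-1` [set c i]).
Proof.
pose G := \bigcup_i preimage_set_system setT (X i) measurable.
pose T' : measurableType _ := g_sigma_algebraType G.
suff : measurable (\bigcap_(i in [set: I]) X i @^-1` [set c i] : set T') by [].
apply: fin_bigcap_measurable => // i _; apply: sub_sigma_algebra; exists i => //.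
by exists [set c i] => //; rewrite setTI.
Qed.

Lemma sigma_generated_bigcup (J : finType) (I : finType) (X : I -> {RV P >-> R})
    (B : J -> set T) : (forall j, sigma_generated X (B j)) ->
  sigma_generated X [set w | exists j, B j w].
Proof.
pose G := \bigcup_i preimage_set_system setT (X i) measurable.
pose T' : measurableType _ := g_sigma_algebraType G.
move=> mB; suff : measurable ([set w | exists j, B j w] : set T') by [].
have -> : [set w | exists j, B j w] = \bigcup_(j in [set: J]) B j.
  by apply/seteqP; split => w /= [j]; [exists j|move=> _; exists j].
by apply: fin_bigcup_measurable => // j _; exact: mB.
Qed.

End GeneratedSigma.

Section SpikeEvent.
Context {R : realType} {d : measure_display} {T : measurableType d}.
Variables (P : probability T R) (n : nat).
Variables (x : 'I_n -> {RV P >-> R}) (W : 'I_n -> 'I_n -> {RV P >-> R}).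

Definition sign_vec (xi : {ffun 'I_n -> bool}) : 'cV[R]_n :=
  \col_i (-1) ^+ (xi i).

Definition spike_is (xi : {ffun 'I_n -> bool}) : set T :=
  \bigcap_(i in [set: 'I_n]) x i @^-1` [set (-1) ^+ (xi i)].

Lemma dot_sign_vec xi : dot (sign_vec xi) (sign_vec xi) = n%:R.
Proof.
rewrite /dot (eq_bigr (fun=> 1)); last first.
  by move=> i _; rewrite mxE -expr2 sqrr_sign.
by rewrite sumr_const card_ord.
Qed.

Lemma measurable_spike_is xi : measurable (spike_is xi).
Proof.
by apply: fin_bigcap_measurable => // i _.
Qed.

Lemma probability_spike_is xi : (forall i, uniform_sign (x i)) ->
  mutually_independent x -> P (spike_is xi) = ((2^-1) ^+ n)%:E.
Proof.
move=> Hx ind.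
have -> : spike_is xi = \bigcap_(i in [set` [set: 'I_n]%SET]) x i @^-1` [set (-1) ^+ (xi i)].
  by congr bigcap; apply/seteqP; split => i /=; rewrite finset.in_setT.
etransitivity; first exact: ind.
rewrite (eq_bigr (fun=> (2^-1)%:E)); last first.
  by move=> i _; have [H1 H2] := Hx i; case: (xi i).
rewrite (eq_bigl xpredT); last by move=> i; rewrite finset.in_setT.
by rewrite prodEFin prodr_const card_ord.
Qed.

(** Only the probabilities of the values 1 and -1 are prescribed, so that the
    coordinates are signs almost surely. *)
Lemma spike_is_sign : (forall i, uniform_sign (x i)) ->
  exists B : set T, [/\ measurable B, (P B <= 0)%E &
    forall w, ~ B w -> exists xi, spike_is xi w].
Proof.
move=> Hx.
have m1 i c : measurable (x i @^-1` [set c]).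
  by rewrite -[X in measurable X]setTI; exact: measurable_funPT.
pose B i := ~` (x i @^-1` [set 1] `|` x i @^-1` [set -1]).
have mB i : measurable (B i).
  by apply: measurableC; apply: measurableU.
have PB i : (P (B i) <= (0:R)%:E)%E.
  have PU1 : P (x i @^-1` [set 1] `|` x i @^-1` [set -1]) = 1%E.
    have [H1 H2] := Hx i; transitivity ((2^-1 : R)%:E + (2^-1 : R)%:E)%E.
      rewrite -[X in (X + _)%E]H1 -[X in (_ + X)%E]H2; apply: measureU => //.
      rewrite -subset0 => w [] /= ->; lra.
    by rewrite -EFinD; congr (_%:E); lra.
  rewrite /B probability_setC; last by apply: measurableU.
  by rewrite [X in (_ - X)%E](_ : _ = 1%E)// subee.
have [mU PU] := union_bound mB PB.
exists [set w | exists i, B i w]; split => //.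
  by apply: le_trans PU _; rewrite big1.
move=> w Bw; exists [ffun i => x i w == -1] => i _ /=.
rewrite ffunE; case: eqP => // ne; rewrite expr0.
by apply: contrapT => ne'; apply: Bw; exists i => -[].
Qed.

(** If M x has many large coordinates, then v = their signs is a point of
    {-1,0,1}^n with <v, M x> >= theta |v|^2. For fixed x = xi a union
    bound over v makes this unlikely; the spike takes each of its 2^n
    values with probability 2^-n independently of M, so that the sum over
    xi costs nothing. *)
Lemma rare_large_coordinates_event (theta delta : R) :
  Z2_synchronization x W -> (0 < n)%N -> 0 < delta -> 0 < theta ->
  let b := theta ^+ 2 / 8 in expR (- b) <= 2^-1 ->
  exists B : set T, [/\ measurable B,
    (P B <= (expR (n%:R * (4 * expR (- b) - b * delta)))%:E)%E &
    forall w, ~ B w -> forall xi, spike_is xi w ->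
    #|[set i | (theta <= `|(matrix_at W w *m sign_vec xi) i ord0|)%R]%SET|%:R <=
      delta * n%:R].
Proof.
move=> [Hx indx HW indxW] n0 d0 t0 b b1.
have n0' : 0 < n%:R :> R by rewrite ltr0n.
have b0 : 0 < b by rewrite divr_gt0// exprn_gt0.
set k := delta * n%:R.
have k0 : 0 < k by rewrite mulr_gt0.
pose L := lattice n 1.
pose vec (z : L) : 'cV[R]_n := lattice_vec z.
pose sq (z : L) := dot (vec z) (vec z).
pose D xi (z : L) := [set w | k <= sq z /\
  theta * sq z <= dot (vec z) (matrix_at W w *m sign_vec xi)].
pose wt (z : L) := expR (- (b * k)) * expR (- (b * sq z)).
have mD xi z : measurable (D xi z).
  have [kz|kz] := leP k (sq z); last first.
    suff -> : D xi z = set0 by [].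
    by rewrite -subset0 => w [/=]; rewrite leNgt kz.
  have -> : D xi z = [set w | theta * sq z <= dot (vec z) (matrix_at W w *m sign_vec xi)].
    by apply/seteqP; split => w /=; [case|split].
  by apply: measurable_ge; exact: measurable_form.
have PD xi z : (P (D xi z) <= (wt z)%:E)%E.
  have [kz|kz] := leP k (sq z); last first.
    suff -> : D xi z = set0 by rewrite measure0 lee_fin mulr_ge0 ?expR_ge0.
    by rewrite -subset0 => w [/=]; rewrite leNgt kz.
  have z0 : 0 < sq z by apply: lt_le_trans kz.
  have -> : D xi z = [set w | theta * sq z <= dot (vec z) (matrix_at W w *m sign_vec xi)].
    by apply/seteqP; split => w /=; [case|split].
  have := @GOE_form_tail _ _ _ P n W (vec z) (sign_vec xi) (2 * sq z) (theta * sq z) HW n0.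
  move=> H; apply: le_trans (H _ _ _) _.
  - rewrite dot_sign_vec -/(sq z) le_eqVlt; apply/orP; left; apply/eqP; field.
    by rewrite gt_eqF.
  - by rewrite mulr_gt0.
  - by rewrite mulr_gt0.
  - rewrite lee_fin /wt -expRD ler_expR -opprD lerN2 -mulrDr.
    (* Half of this exponent pays for the sum over the lattice, and the other
       half, by sq z >= k, is the gain. *)
    have -> : (theta * sq z) ^+ 2 / (2 * (2 * sq z)) = b * (2 * sq z).
      by rewrite /b; field; rewrite gt_eqF.
    by rewrite ler_wpM2l ?(ltW b0)//; lra.
pose U xi := [set w | exists z, D xi z w].
have PU xi : (P (U xi) <= (expR (n%:R * (4 * expR (- b) - b * delta)))%:E)%E.
  have [_ H] := union_bound (mD xi) (PD xi); apply: le_trans H _; rewrite lee_fin.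
  rewrite -mulr_sumr; apply: (@le_trans _ _ (expR (- (b * k)) * expR (4 * n%:R * expR (- b)))).
    by rewrite ler_wpM2l ?expR_ge0//; apply: sum_lattice_le => //; exact: ltW.
  by rewrite -expRD ler_expR le_eqVlt; apply/orP; left; apply/eqP; rewrite /k; ring.
have mU xi : measurable (U xi) by have [] := union_bound (mD xi) (PD xi).
(* The bad event for xi depends on the noise alone, so that it is independent
   of the spike. *)
have sU xi : sigma_generated (fun p : 'I_n * 'I_n => W p.1 p.2) (U xi).
  apply: sigma_generated_bigcup => z.
  have [kz|kz] := leP k (sq z); last first.
    have -> : D xi z = [set w | exists j : 'I_0, False].
      by apply/seteqP; split => w /=; [case; rewrite leNgt kz|case].
    by apply: (@sigma_generated_bigcup _ _ _ _ 'I_0 _ _ (fun=> set0)) => -[].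
  have -> : D xi z = [set w | theta * sq z <= \sum_(p : 'I_n * 'I_n)
      (vec z p.1 ord0 * sign_vec xi p.2 ord0) * W p.1 p.2 w].
    by apply/seteqP; split => w; rewrite /D /= dot_matrix_at; [case|split].
  exact: sigma_generated_le.
pose V xi := spike_is xi `&` U xi.
have mV xi : measurable (V xi) by apply: measurableI => //; exact: measurable_spike_is.
set q := expR (n%:R * (4 * expR (- b) - b * delta)).
have PV xi : (P (V xi) <= ((2^-1) ^+ n * q)%:E)%E.
  have E := probability_spike_is xi Hx indx.
  rewrite EFinM -E; apply: le_trans (_ : P (spike_is xi) * P (U xi) <= _)%E.
    rewrite le_eqVlt; apply/orP; left; apply/eqP.
    apply: (indxW (spike_is xi) (U xi)); last exact: sU.
    by rewrite /spike_is; exact: sigma_generated_bigcap.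
  by rewrite E lee_wpmul2l// lee_fin exprn_ge0// invr_ge0.
have [mVU PVU] := union_bound mV PV.
exists [set w | exists xi, V xi w]; split => //.
  apply: le_trans PVU _; rewrite lee_fin sumr_const card_ffun card_bool card_ord.
  by rewrite -[leLHS]mulr_natl mulrA natrX -exprMn divff ?expr1n ?mul1r ?pnatr_eq0.
move=> w Vw xi xiw; rewrite leNgt; apply/negP => Hk.
set S := [set i | _]%SET in Hk.
set h := matrix_at W w *m sign_vec xi in S Hk.
pose v : 'cV[R]_n := \col_i (if i \in S then Num.sg (h i ord0) else 0).
have hS i : i \in S -> theta <= `|h i ord0| by rewrite inE.
have vv : dot v v = #|S|%:R.
  rewrite -sum1_card natr_sum [RHS]big_mkcond/=; apply: eq_bigr => i _; rewrite mxE.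
  case: ifP => iS; last by rewrite mul0r.
  rewrite -expr2 sqr_sg; suff -> : h i ord0 != 0 by [].
  by rewrite -normr_gt0 (lt_le_trans t0)// hS.
have vh : theta * #|S|%:R <= dot v h.
  rewrite -sum1_card natr_sum mulr_sumr [leLHS]big_mkcond/=; apply: ler_sum => i _; rewrite mxE.
  case: ifP => iS; last by rewrite mul0r.
  by rewrite mulr1 -normrEsg hS.
have [z zE] : exists z : L, lattice_vec z = v.
  (* The ordinals 0, 1, 2 encode the coordinates -1, 0, 1. *)
  pose z : L := [ffun i => inord (if i \in S then (if h i ord0 < 0 then 0 else 2) else 1)].
  exists z; apply/matrixP => i j; rewrite ord1 [LHS]mxE [RHS]mxE ffunE inordK;
    last by case: ifP => //; case: ifP.
  case: ifP => iS; last by rewrite subrr.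
  have := hS i iS; have [hi|hi|->] := ltrgtP (h i ord0) 0.
  - by move=> _; rewrite ltr0_sg// sub0r.
  - by move=> _; rewrite gtr0_sg// -natrB.
  - by rewrite normr0 leNgt t0.
apply: Vw; exists xi; split => //; exists z.
by rewrite /D /sq /vec /= zE vv; split => //; exact: ltW.
Qed.

End SpikeEvent.

(** * The hyperbolic tangent *)

Section Tanh.
Context {R : realType}.
Implicit Types a b h l : R.

Lemma tanhN h : tanh (- h) = - tanh h.
Proof. by rewrite /tanh opprK -[RHS]mulNr opprB; congr (_ / _); exact: addrC. Qed.

Lemma tanh_normr_le1 h : `|tanh h| <= 1.
Proof. by have /andP[a b] := tanh_in h; rewrite ler_norml (ltW a) ltW. Qed.

Lemma one_sub_tanh_le h l : l <= h -> 1 - tanh h <= 2 * expR (- (2 * l)).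
Proof.
move=> lh; have p := expR_gt0 h; have q := expR_gt0 (- h).
have -> : 1 - tanh h = 2 * (expR (- h) / (expR h + expR (- h))).
  by rewrite /tanh; field; rewrite gt_eqF// addr_gt0.
rewrite ler_wpM2l// ler_pdivrMr ?addr_gt0//.
apply: (@le_trans _ _ (expR (- (2 * l)) * expR h)).
  by rewrite -expRD ler_expR; lra.
by rewrite ler_wpM2l ?expR_ge0//; lra.
Qed.

Lemma is_derive_tanh h : is_derive h 1 (@tanh R) (1 - tanh h ^+ 2).
Proof.
have p := expR_gt0 h; have q := expR_gt0 (- h).
have D1 : is_derive h 1 (@expR R) (expR h) by exact: is_derive_expR.
have D2 : is_derive h 1 (fun h : R => expR (- h)) (- expR (- h)).
  have H : is_derive (- h) 1 (@expR R) (expR (- h)) by exact: is_derive_expR.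
  have N : is_derive h 1 (fun h : R => - h) (- 1) by exact: is_deriveN.
  by have := is_derive1_comp H N; rewrite mulrN1.
have D := is_deriveB D1 D2; have E := is_deriveD D1 D2.
pose g h : R := expR h + expR (- h).
have nz : g h != 0 by rewrite gt_eqF// addr_gt0.
have V := is_deriveV nz (E : is_derive h 1 g _).
have H := is_deriveM D V.
apply: (is_derive_eq (f := @tanh R) H).
rewrite !fctE /g /tanh /GRing.scale /=; field.
by rewrite gt_eqF// addr_gt0.
Qed.

Lemma tanh_secant a b : a <= b -> exists2 c, a <= c <= b &
  tanh b - tanh a = (1 - tanh c ^+ 2) * (b - a).
Proof.
move=> ab.
have D (c : R) : is_derive c 1 (@tanh R) (1 - tanh c ^+ 2) by exact: is_derive_tanh.
have ct : {within `[a, b], continuous (@tanh R)}.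
  apply: derivable_within_continuous => c _.
  exact: (@ex_derive _ _ _ _ _ _ _ (D c)).
have [c] := MVT_segment ab (fun c _ => D c) ct.
rewrite in_itv/= => /andP[ca cb] H.
by exists c => //; apply/andP.
Qed.

Lemma tanh_lipschitz a b : a <= b -> 0 <= tanh b - tanh a <= b - a.
Proof.
move=> ab; have [c _ ->] := tanh_secant ab.
have := sqr_ge0 (tanh c).
have : tanh c ^+ 2 <= 1 by rewrite -real_normK ?num_real// exprn_ile1// tanh_normr_le1.
by move=> H1 H2; apply/andP; split; nra.
Qed.

Lemma tanh_slope_le l a b : 0 <= l -> l <= a -> a <= b ->
  tanh b - tanh a <= 4 * expR (- (2 * l)) * (b - a).
Proof.
move=> l0 la ab; have [c /andP[ac cb] ->] := tanh_secant ab.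
rewrite ler_wpM2r ?subr_ge0//.
have H := one_sub_tanh_le (le_trans la ac); have /andP[t1 t2] := tanh_in c.
have e := expR_ge0 (- (2 * l)); nra.
Qed.

End Tanh.

(** * Regular noise and saturated fields *)

Section Model.
Context {R : realType} {n : nat}.
Implicit Types (x m h e v : 'cV[R]_n) (M Y : 'M[R]_n) (lambda : R).

Definition spiked lambda x M : 'M[R]_n := (lambda / n%:R) *: (x *m x^T) + M.

(** The right-hand side of AMP at m^k = m, m^(k-1) = m'. On the diagonal m
    = m' its fixed points are the critical points of the energy, in terms
    of fields. *)
Definition tap_field lambda Y m m' : 'cV[R]_n :=
  lambda *: (Y *m m) - (lambda ^+ 2 * (1 - overlap m)) *: m'.

Definition corr x m : R := dot x m / n%:R.

Definition in_cube m := forall i, `|m i ord0| <= 1.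

Definition is_sign x := forall i, x i ord0 = 1 \/ x i ord0 = -1.

(** The only facts about the noise used by the deterministic part. The
    constants come from the exponents in the probability bounds; the last
    clause concerns the field that the spike creates through the noise. *)
Definition regular_noise lambda x M : Prop :=
  [/\ M^T = M,
      forall u v, dot u (M *m v) <= 36 * (l2norm u * l2norm v),
      forall S : {set 'I_n}, #|S|%:R <= 4 / lambda ^+ 3 * n%:R ->
        forall u v, supported S u -> supported S v ->
        dot u (M *m v) <= (16 * lambda)^-1 * (l2norm u * l2norm v) &
      #|[set i | lambda / 128 <= `|(M *m x) i ord0|]%SET|%:R <=
        (lambda ^+ 4)^-1 * n%:R].

(** Saturation of the field in the direction of the spike; lambda^2 / 16 is a
    fraction of the ideal value lambda^2. *)
Definition aligned lambda x (delta : R) h := exists S : {set 'I_n},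
  #|S|%:R <= delta * n%:R /\
  forall i, i \notin S -> lambda ^+ 2 / 16 <= x i ord0 * h i ord0.

(** The fields met along the algorithms. The part M x is kept apart because its
    coordinates are below a multiple of lambda except on a small set, whereas
    the rest is only small in norm. *)
Definition decomposed lambda x M (E : R) h := exists c b e,
  [/\ h = c *: x + b *: (M *m x) + e, lambda ^+ 2 / 8 <= c,
      `|b| <= 4 * lambda & dot e e <= E * n%:R].

Lemma spiked_mul lambda x M v :
  spiked lambda x M *m v = (lambda * corr x v) *: x + M *m v.
Proof.
rewrite /spiked mulmxDl -scalemxAl -mulmxA /corr; congr (_ + _).
have -> : x^T *m v = (dot x v)%:M by rewrite [LHS]mx11_scalar dotE.
by rewrite mul_mx_scalar scalerA mulrAC mulrA.
Qed.

Lemma tanhv_in_cube h : in_cube (tanhv h).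
Proof. by move=> i; rewrite mxE; exact: tanh_normr_le1. Qed.

Lemma in_cube_dot m : in_cube m -> dot m m <= n%:R.
Proof.
move=> mc; rewrite -[n in n%:R]card_ord -sum1_card natr_sum; apply: ler_sum => i _.
by rewrite -expr2 -real_normK ?num_real// exprn_ile1.
Qed.

Section Sign.
Variable x : 'cV[R]_n.
Hypothesis xs : is_sign x.

Lemma sign_sqr i : x i ord0 * x i ord0 = 1.
Proof. by case: (xs i) => ->; ring. Qed.

Lemma sign_dot : dot x x = n%:R.
Proof.
rewrite -[n in n%:R]card_ord -sum1_card natr_sum; apply: eq_bigr => i _.
exact: sign_sqr.
Qed.

Lemma sign_cube : in_cube x.
Proof. by move=> i; case: (xs i) => ->; rewrite ?normrN normr1. Qed.

Hypothesis n0 : (0 < n)%N.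

Let n0' : 0 < n%:R :> R. Proof. by rewrite ltr0n. Qed.

Lemma corrE m : corr x m * n%:R = dot x m.
Proof. by rewrite /corr divfK// gt_eqF. Qed.

Lemma dist_le_corr m (rho : R) : in_cube m -> 1 - corr x m <= rho ->
  dot (m - x) (m - x) <= 2 * rho * n%:R.
Proof.
move=> mc H; rewrite dotBl !dotBr sign_dot (dotC m x).
have {H} := ler_wpM2r (ltW n0') H; rewrite mulrBl mul1r corrE.
by have := in_cube_dot mc; lra.
Qed.

Lemma overlap_le_corr m (rho : R) : in_cube m -> 1 - corr x m <= rho ->
  0 <= 1 - overlap m <= 2 * rho.
Proof.
move=> mc H; have D := in_cube_dot mc.
have oE : overlap m * n%:R = dot m m by rewrite overlapE divfK// gt_eqF.
apply/andP; split.
  by rewrite -(@ler_pM2r _ n%:R)// mul0r mulrBl mul1r oE subr_ge0.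
rewrite -(@ler_pM2r _ n%:R)// mulrBl mul1r oE.
have {H} := ler_wpM2r (ltW n0') H; rewrite mulrBl mul1r corrE => H.
rewrite -mulrA; suff : n%:R - dot m m <= 2 * (n%:R - dot x m) by lra.
by have := dot_ge0 (m - x); rewrite dotBl !dotBr sign_dot (dotC m x); lra.
Qed.

(** Each coordinate off the exceptional set loses at most the distance of tanh
    to 1, and each other coordinate at most 2. *)
Lemma aligned_corr lambda (delta : R) h : aligned lambda x delta h ->
  1 - corr x (tanhv h) <= 2 * delta + 2 * expR (- (lambda ^+ 2 / 8)).
Proof.
move=> [S [Sd HS]]; rewrite -(@ler_pM2r _ n%:R)// mulrBl mul1r corrE.
set ep := expR _.
suff : n%:R - dot x (tanhv h) <= 2 * #|S|%:R + 2 * ep * n%:R by nra.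
have -> : (n%:R : R) = \sum_(i : 'I_n) 1 by rewrite sumr_const card_ord.
rewrite /dot -sumrB -sum1_card natr_sum !mulr_sumr [X in _ <= X + _]big_mkcond/=.
rewrite -big_split; apply: ler_sum => i _ /=; rewrite mxE !mulr1.
have ep0 : 0 < ep by exact: expR_gt0.
have /andP[t1 t2] := tanh_in (h i ord0).
case: (boolP (i \in S)) => [_|/HS].
  by case: (xs i) => ->; lra.
case: (xs i) => ->; rewrite ?mul1r ?mulN1r => H.
  have := one_sub_tanh_le H; rewrite (_ : 2 * (lambda ^+ 2 / 16) = lambda ^+ 2 / 8); last by field.
  by rewrite -/ep; lra.
rewrite -tanhN; have := one_sub_tanh_le H.
rewrite (_ : 2 * (lambda ^+ 2 / 16) = lambda ^+ 2 / 8); last by field.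
by rewrite -/ep; lra.
Qed.

Variables (lambda : R) (M : 'M[R]_n).
Hypothesis l0 : 0 < lambda.
Hypothesis HM : regular_noise lambda x M.

Lemma noise_sqr v : dot (M *m v) (M *m v) <= 36 ^+ 2 * dot v v.
Proof.
have [_ H _ _] := HM; rewrite -!sqr_l2norm -exprMn lerXn2r ?nnegrE ?mulr_ge0 ?l2norm_ge0//.
apply: l2norm_dual => [|u]; first by rewrite mulr_ge0 ?l2norm_ge0.
by apply: le_trans (H _ _) _; rewrite mulrA mulrAC.
Qed.

(** The signal has size at least lambda^2 / 8; the part along M x costs at
    most lambda^2 / 32 where M x is below lambda / 128, and Markov's
    inequality bounds the number of coordinates at which the error exceeds
    lambda^2 / 32. *)
Lemma decomposed_aligned (E : R) h : 0 <= E -> decomposed lambda x M E h ->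
  aligned lambda x ((1 + 1024 * E) / lambda ^+ 4) h.
Proof.
move=> E0 [c [b [e [-> cl bl eE]]]].
have [_ _ _ HT] := HM.
set T0 := [set i | _]%SET in HT.
pose T1 : {set 'I_n} := [set i | lambda ^+ 2 / 32 <= `|e i ord0|]%SET.
have l4 : 0 < lambda ^+ 4 by rewrite exprn_gt0.
exists (T0 :|: T1)%SET; split.
  have T1c : #|T1|%:R <= 1024 * E / lambda ^+ 4 * n%:R.
    rewrite mulrAC ler_pdivlMr// -mulrA.
    suff : #|T1|%:R * (lambda ^+ 4 / 1024) <= dot e e by lra.
    rewrite -sum1_card natr_sum mulr_suml [leLHS]big_mkcond/=; apply: ler_sum => i _.
    case: ifP => [|_]; last exact: sqr_ge0.
    rewrite inE => H; rewrite mul1r -expr2 -(real_normK (num_real (e i ord0))).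
    have -> : lambda ^+ 4 / 1024 = (lambda ^+ 2 / 32) ^+ 2 by field.
    by rewrite lerXn2r ?nnegrE ?divr_ge0 ?sqr_ge0.
  apply: (@le_trans _ _ (#|T0| + #|T1|)%:R); first by rewrite ler_nat leq_card_setU.
  by rewrite natrD mulrDl mul1r [leRHS]mulrDl lerD.
move=> i; rewrite !inE negb_or -!ltNge => /andP[H0 H1]; rewrite !mxE.
set y := \sum_j _; have yE : (M *m x) i ord0 = y by rewrite mxE.
rewrite yE in H0.
(* This is where the threshold lambda / 128 comes from. *)
have by_ : `|b * y| <= lambda ^+ 2 / 32.
  rewrite normrM; apply: (@le_trans _ _ (4 * lambda * (lambda / 128))).
    by rewrite ler_pM// ltW.
  by rewrite le_eqVlt; apply/orP; left; apply/eqP; field.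
move: by_ H1; rewrite ler_norml ltr_norml => /andP[B1 B2] /andP[E1 E2].
by case: (xs i) => ->; lra.
Qed.

(** The field of x itself is lambda^2 x + lambda M x. The error collects the
    deviation m - x, whose squared norm is at most 2 rho n, and the Onsager
    term, whose coefficient is at most 2 rho lambda^2. *)
Lemma tap_field_decomposed m m' (rho B : R) : in_cube m -> 1 - corr x m <= rho ->
  rho <= 1 / 2 -> 0 <= B -> dot m' m' <= B * n%:R ->
  decomposed lambda x M (2 * lambda ^+ 2 * 36 ^+ 2 * (2 * rho) +
    2 * lambda ^+ 4 * (4 * rho ^+ 2) * B)
    (tap_field lambda (spiked lambda x M) m m').
Proof.
move=> mc H rho2 B0 HB; have Hd := dist_le_corr mc H; have /andP[q0 q1] := overlap_le_corr mc H.
set o := 1 - overlap m in q0 q1 *.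
exists (lambda ^+ 2 * corr x m), lambda,
  (lambda *: (M *m (m - x)) - (lambda ^+ 2 * o) *: m'); split.
- rewrite /tap_field spiked_mul mulmxBr -/o.
  by move: (M *m m) (M *m x) => u v; apply/matrixP => i j; rewrite !mxE; ring.
- by rewrite ler_wpM2l ?sqr_ge0//; lra.
- by have l0' := l0; rewrite ger0_norm ?(ltW l0)//; lra.
- have := noise_sqr (m - x); set p := M *m (m - x) => Hp.
  have tr (a b : 'cV[R]_n) : dot (a - b) (a - b) <= 2 * dot a a + 2 * dot b b.
    by have := dot_ge0 (a + b); rewrite dot_sqrD dot_sqrB; lra.
  apply: le_trans (tr _ _) _; rewrite !dotZl !dotZr [leRHS]mulrDl.
  have l2 := sqr_ge0 lambda; apply: lerD.
    have -> : 2 * (lambda * (lambda * dot p p)) = 2 * lambda ^+ 2 * dot p p by ring.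
    rewrite [leRHS](_ : _ = 2 * lambda ^+ 2 * (36 ^+ 2 * (2 * rho * n%:R))); last by ring.
    rewrite ler_wpM2l ?mulr_ge0 ?(ltW l0)//; apply: le_trans Hp _.
    by rewrite ler_wpM2l ?sqr_ge0.
  have -> : 2 * (lambda ^+ 2 * o * (lambda ^+ 2 * o * dot m' m')) =
    2 * lambda ^+ 4 * (o ^+ 2 * dot m' m') by ring.
  rewrite [leRHS](_ : _ = 2 * lambda ^+ 4 * ((2 * rho) ^+ 2 * (B * n%:R))); last by ring.
  rewrite ler_wpM2l ?mulr_ge0 ?exprn_ge0 ?(ltW l0)//.
  apply: ler_pM; rewrite ?sqr_ge0 ?dot_ge0// lerXn2r// nnegrE//.
  exact: le_trans q1.
Qed.

(** NGD moves the field along a segment. *)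
Lemma decomposed_convex (E : R) h h' (eta : R) : 0 <= eta <= 1 ->
  decomposed lambda x M E h -> decomposed lambda x M E h' ->
  decomposed lambda x M E ((1 - eta) *: h + eta *: h').
Proof.
move=> /andP[t0 t1] [c [b [e [-> cl bl eE]]]] [c' [b' [e' [-> cl' bl' eE']]]].
exists ((1 - eta) * c + eta * c'), ((1 - eta) * b + eta * b'), ((1 - eta) *: e + eta *: e').
split.
- by apply/matrixP => i j; rewrite !mxE; ring.
- have u0 : 0 <= 1 - eta by rewrite subr_ge0.
  by have := ler_wpM2l u0 cl; have := ler_wpM2l t0 cl'; lra.
- apply: le_trans (ler_normD _ _) _; rewrite !normrM (ger0_norm t0).
  have u0 : 0 <= 1 - eta by rewrite subr_ge0.
  rewrite (ger0_norm u0).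
  rewrite [leRHS](_ : _ = (1 - eta) * (4 * lambda) + eta * (4 * lambda)); last by ring.
  by rewrite lerD// ler_wpM2l.
- have : dot ((1 - eta) *: e + eta *: e') ((1 - eta) *: e + eta *: e') <=
      (1 - eta) * dot e e + eta * dot e' e'.
    have := dot_ge0 (e - e'); rewrite dot_sqrB dot_sqrD !dotZl !dotZr.
    set a := dot e e; set f := dot e e'; set g := dot e' e' => H.
    rewrite -subr_ge0 [X in 0 <= X](_ : _ = (eta * (1 - eta)) * (a - 2 * f + g)); last by ring.
    by rewrite !mulr_ge0// subr_ge0.
  move=> H; apply: le_trans H _; have u0 : 0 <= 1 - eta by rewrite subr_ge0.
  by have := ler_wpM2l u0 eE; have := ler_wpM2l t0 eE'; lra.
Qed.

End Sign.
End Model.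

(** * The damped norm and the contraction of the field *)

Section Slope.
Context {R : realType}.
Implicit Types a b l : R.

(** Equal to 0 when a = b, where any value would do. *)
Definition tanh_slope a b : R := (tanh a - tanh b) / (a - b).

Lemma tanh_slopeE a b : tanh_slope a b * (a - b) = tanh a - tanh b.
Proof.
have [->|ab] := eqVneq a b; first by rewrite !subrr mulr0.
by rewrite /tanh_slope divfK// subr_eq0.
Qed.

Lemma tanh_slopeC a b : tanh_slope a b = tanh_slope b a.
Proof. by rewrite /tanh_slope -(opprB b a) -(opprB (tanh b)) invrN mulrNN. Qed.

Lemma tanh_slopeN a b : tanh_slope (- a) (- b) = tanh_slope a b.
Proof. by rewrite /tanh_slope !tanhN -!opprD invrN mulrNN. Qed.

Lemma tanh_slope_ge0_le1 a b : 0 <= tanh_slope a b <= 1.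
Proof.
wlog ab : a b / a <= b => [H|].
  by have [/H//|/ltW/H] := leP a b; rewrite tanh_slopeC.
rewrite tanh_slopeC /tanh_slope; have /andP[t0 t1] := tanh_lipschitz ab.
have [->|ne] := eqVneq a b; first by rewrite subrr mul0r ler01 lexx.
have lt : 0 < b - a by rewrite subr_gt0 lt_neqAle ne.
by rewrite divr_ge0 ?(ltW lt)//= ler_pdivrMr// mul1r.
Qed.

Lemma tanh_slope_far l a b : 0 <= l -> l <= a -> l <= b ->
  tanh_slope a b <= 4 * expR (- (2 * l)).
Proof.
move=> l0; wlog ab : a b / a <= b => [H la lb|la lb].
  have [/H|/ltW ba] := leP a b; first exact.
  by rewrite tanh_slopeC; exact: H.
rewrite tanh_slopeC /tanh_slope.
have [->|ne] := eqVneq a b; first by rewrite subrr mul0r mulr_ge0 ?expR_ge0.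
by rewrite ler_pdivrMr ?subr_gt0 ?lt_neqAle ?ne//; exact: tanh_slope_le.
Qed.

End Slope.

Section Damping.
Context {R : realType} {n : nat}.
Implicit Types (x m h e v r u w : 'cV[R]_n) (S : {set 'I_n}).
Variable lambda : R.

Definition hmul r u : 'cV[R]_n := \col_i (r i ord0 * u i ord0).

(** The square root of the bound on the slope of tanh at height lambda^2 /
    16. *)
Definition kappa : R := 2 * expR (- (lambda ^+ 2 / 16)).

(** A class that contains the square roots of the slopes of tanh between two
    aligned fields. *)
Definition damping r := (forall i, 0 <= r i ord0 <= 1) /\
  exists S, #|S|%:R <= 2 / lambda ^+ 3 * n%:R /\
    forall i, i \notin S -> r i ord0 <= kappa.

(** A bound on the seminorm sup_r |r v| over all dampings r. The supremum makes
    the same quantity usable for every pair of fields along a trajectory. *)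
Definition damped_le (A : R) v := forall r, damping r -> l2norm (hmul r v) <= A.

Lemma hmulD r u v : hmul r (u + v) = hmul r u + hmul r v.
Proof. by apply/matrixP => i j; rewrite !mxE mulrDr. Qed.

Lemma hmulZ r (c : R) u : hmul r (c *: u) = c *: hmul r u.
Proof. by apply/matrixP => i j; rewrite !mxE mulrCA. Qed.

Lemma hmulN r u : hmul r (- u) = - hmul r u.
Proof. by apply/matrixP => i j; rewrite !mxE mulrN. Qed.

Lemma dot_hmul r u v : dot (hmul r u) v = dot u (hmul r v).
Proof. by apply: eq_bigr => i _; rewrite !mxE mulrCA mulrA. Qed.

Lemma l2norm_mono u v (c : R) : 0 <= c ->
  (forall i, `|u i ord0| <= c * `|v i ord0|) -> l2norm u <= c * l2norm v.
Proof.
move=> c0 H; apply: l2norm_le; first by rewrite mulr_ge0 ?l2norm_ge0.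
rewrite exprMn sqr_l2norm mulr_sumr; apply: ler_sum => i _.
rewrite -!expr2 -(real_normK (num_real (u i ord0))) -(real_normK (num_real (v i ord0))).
by rewrite -exprMn lerXn2r ?nnegrE ?mulr_ge0.
Qed.

Lemma l2norm_hmul_le r u : (forall i, 0 <= r i ord0 <= 1) ->
  l2norm (hmul r u) <= l2norm u.
Proof.
move=> Hr; rewrite -[leRHS]mul1r; apply: l2norm_mono => // i.
have /andP[r0 r1] := Hr i.
by rewrite mxE normrM ger0_norm// ler_wpM2r.
Qed.

Lemma damped_le_l2norm v : damped_le (l2norm v) v.
Proof. by move=> r [Hr _]; exact: l2norm_hmul_le. Qed.

Lemma damped_leD (A B : R) u v : damped_le A u -> damped_le B v ->
  damped_le (A + B) (u + v).
Proof.
by move=> Hu Hv r dr; rewrite hmulD (le_trans (l2normD _ _))// lerD// ?Hu ?Hv.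
Qed.

Lemma damped_leZ (A c : R) u : 0 <= c -> damped_le A u -> damped_le (c * A) (c *: u).
Proof. by move=> c0 Hu r dr; rewrite hmulZ l2normZ ger0_norm// ler_wpM2l ?Hu. Qed.

Lemma kappa_ge0 : 0 <= kappa.
Proof. by rewrite mulr_ge0 ?expR_ge0. Qed.

(** The difference of two magnetizations is the difference of the fields damped
    twice. One factor is spent on the seminorm of the fields, the other one on
    the next application of the noise. *)
Lemma secant_damping x h h' : is_sign x ->
  aligned lambda x (lambda ^+ 3)^-1 h -> aligned lambda x (lambda ^+ 3)^-1 h' ->
  exists2 r, damping r & tanhv h - tanhv h' = hmul r (hmul r (h - h')).
Proof.
move=> xs [S [Sd HS]] [S' [Sd' HS']].
pose sl i := tanh_slope (h i ord0) (h' i ord0).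
have sl0 i : 0 <= sl i <= 1 by exact: tanh_slope_ge0_le1.
exists (\col_i Num.sqrt (sl i)); last first.
  apply/matrixP => i j; rewrite ord1 !mxE mulrA -expr2 sqr_sqrtr.
    by rewrite tanh_slopeE.
  by have /andP[] := sl0 i.
split.
  move=> i; rewrite mxE sqrtr_ge0 -[leRHS]sqrtr1 ler_sqrt ?ltr01//.
  by have /andP[] := sl0 i.
exists (S :|: S')%SET; split.
  apply: (@le_trans _ _ (#|S| + #|S'|)%:R); first by rewrite ler_nat leq_card_setU.
  by rewrite natrD -[2]/(1 + 1) !mulrDl !mul1r lerD.
move=> i; rewrite inE negb_or => /andP[iS iS']; rewrite mxE.
have -> : kappa = Num.sqrt (kappa ^+ 2) by rewrite sqrtr_sqr ger0_norm ?kappa_ge0.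
apply: ler_wsqrtr.
have -> : kappa ^+ 2 = 4 * expR (- (2 * (lambda ^+ 2 / 16))).
  rewrite /kappa exprMn -expRM_natl -natrX; congr (_ * expR _); ring.
have l0 : 0 <= lambda ^+ 2 / 16 by rewrite divr_ge0 ?sqr_ge0.
have := HS i iS; have := HS' i iS'; rewrite /sl.
case: (xs i) => ->; rewrite ?mul1r ?mulN1r => H1 H2; first exact: tanh_slope_far.
by rewrite -tanh_slopeN; exact: tanh_slope_far.
Qed.

Lemma damped_le_tanhv (A : R) x h h' : is_sign x ->
  aligned lambda x (lambda ^+ 3)^-1 h -> aligned lambda x (lambda ^+ 3)^-1 h' ->
  damped_le A (h - h') -> l2norm (tanhv h - tanhv h') <= A.
Proof.
move=> xs ha h'a H; have [r dr ->] := secant_damping xs ha h'a.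
by apply: le_trans (H r dr); apply: l2norm_hmul_le; case: dr.
Qed.

Definition restrict S u : 'cV[R]_n := \col_i (if i \in S then u i ord0 else 0).

Lemma restrict_split S u : u = restrict S u + restrict (~: S)%SET u.
Proof.
apply/matrixP => i j; rewrite ord1 !mxE inE.
by case: ifP => _ /=; rewrite ?addr0 ?add0r.
Qed.

Lemma supported_restrict S u : supported S (restrict S u).
Proof. by move=> i /negPf iS; rewrite mxE iS. Qed.

Definition damped_cube_bound : R := 2 / lambda ^+ 3 + kappa ^+ 2.

(** Damped signs have small norm: this is why the rank one part of Y, although
    of norm lambda, does not spoil the contraction. *)
Lemma damped_cube r v : damping r -> in_cube v ->
  dot (hmul r v) (hmul r v) <= damped_cube_bound * n%:R.
Proof.
move=> [Hr [S [Sd HS]]] vc; rewrite /damped_cube_bound mulrDl.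
apply: (@le_trans _ _ (#|S|%:R + kappa ^+ 2 * n%:R)); last by rewrite lerD2r.
have -> : (n%:R : R) = \sum_(i : 'I_n) 1 by rewrite sumr_const card_ord.
rewrite /dot -sum1_card natr_sum mulr_sumr [X in X + _]big_mkcond/= -big_split.
apply: ler_sum => i _ /=; rewrite mxE -expr2 exprMn.
have v1 : v i ord0 ^+ 2 <= 1 by rewrite -real_normK ?num_real// exprn_ile1.
have /andP[r0 r1] := Hr i; have v0 := sqr_ge0 (v i ord0).
have k0 := sqr_ge0 kappa.
case: ifPn => iS.
  have : r i ord0 ^+ 2 <= 1 by rewrite exprn_ile1.
  by have := sqr_ge0 (r i ord0); nra.
rewrite add0r; apply: ler_pM; rewrite ?sqr_ge0//.
by rewrite lerXn2r ?nnegrE ?kappa_ge0 ?HS.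
Qed.

Section Noise.
Variables (x : 'cV[R]_n) (M : 'M[R]_n).
Hypothesis xs : is_sign x.
Hypothesis n0 : (0 < n)%N.
Hypothesis l0 : 0 < lambda.
Hypothesis HM : regular_noise lambda x M.
Hypothesis k1 : kappa <= 1.

(** Split both sides into the exceptional coordinates, where the small block
    norm applies, and the rest, where the damping itself is at most kappa. The
    constant 108 is 3 times 36, for the three products with a damped factor. *)
Lemma damped_noise r r' u w : damping r -> damping r' ->
  dot (hmul r u) (M *m hmul r' w) <=
  ((16 * lambda)^-1 + 108 * kappa) * (l2norm u * l2norm w).
Proof.
move=> [Hr [S1 [S1d HS1]]] [Hr' [S2 [S2d HS2]]].
have [_ H1 H2 _] := HM.
pose S := (S1 :|: S2)%SET.
have Sd : #|S|%:R <= 4 / lambda ^+ 3 * n%:R.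
  apply: (@le_trans _ _ (#|S1| + #|S2|)%:R); first by rewrite ler_nat leq_card_setU.
  by rewrite natrD; lra.
have k0 := kappa_ge0.
have inS (q a : 'cV[R]_n) : (forall i, 0 <= q i ord0 <= 1) ->
    l2norm (restrict S (hmul q a)) <= l2norm a.
  move=> Hq; rewrite -[leRHS]mul1r; apply: l2norm_mono => // i; rewrite mul1r !mxE.
  case: ifP => _; rewrite ?normr0//.
  by have /andP[q0 q1] := Hq i; rewrite normrM ger0_norm// ler_piMl.
have offS (q a : 'cV[R]_n) : (forall i, 0 <= q i ord0 <= 1) ->
    (forall i, i \notin S -> q i ord0 <= kappa) ->
    l2norm (restrict (~: S)%SET (hmul q a)) <= kappa * l2norm a.
  move=> Hq Hq'; apply: l2norm_mono => // i; rewrite !mxE inE.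
  case: ifPn => iS /=; last by rewrite normr0 mulr_ge0.
  by have /andP[q0 q1] := Hq i; rewrite normrM ger0_norm// ler_wpM2r// Hq'.
rewrite [in X in dot X _](restrict_split S (hmul r u)).
rewrite [in X in _ *m X](restrict_split S (hmul r' w)).
rewrite mulmxDr dotDl !dotDr.
have a1 := inS r u Hr; have b1 := inS r' w Hr'.
have a2 : l2norm (restrict (~: S)%SET (hmul r u)) <= kappa * l2norm u.
  by apply: offS => // i; rewrite inE negb_or => /andP[/HS1].
have b2 : l2norm (restrict (~: S)%SET (hmul r' w)) <= kappa * l2norm w.
  by apply: offS => // i; rewrite inE negb_or => /andP[_ /HS2].
have := H2 S Sd _ _ (@supported_restrict S (hmul r u)) (@supported_restrict S (hmul r' w)).
have := H1 (restrict S (hmul r u)) (restrict (~: S)%SET (hmul r' w)).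
have := H1 (restrict (~: S)%SET (hmul r u)) (restrict S (hmul r' w)).
have := H1 (restrict (~: S)%SET (hmul r u)) (restrict (~: S)%SET (hmul r' w)).
move: a1 b1 a2 b2 (l2norm_ge0 (restrict S (hmul r u))) (l2norm_ge0 (restrict S (hmul r' w)))
  (l2norm_ge0 (restrict (~: S)%SET (hmul r u))) (l2norm_ge0 (restrict (~: S)%SET (hmul r' w)))
  (l2norm_ge0 u) (l2norm_ge0 w).
set a := l2norm (restrict S (hmul r u)); set b := l2norm (restrict S (hmul r' w)).
set a' := l2norm (restrict (~: S)%SET (hmul r u)).
set b' := l2norm (restrict (~: S)%SET (hmul r' w)).
set nu := l2norm u; set nw := l2norm w.
move=> a1 b1 a2 b2 a0 b0 a'0 b'0 u0 w0 F1 F2 F3 F4.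
have p1 : a * b <= nu * nw by exact: ler_pM.
have p2 : a * b' <= nu * (kappa * nw) by exact: ler_pM.
have p3 : a' * b <= kappa * nu * nw by exact: ler_pM.
have p4 : a' * b' <= kappa * nu * nw.
  by apply: ler_pM => //; apply: le_trans b2 _; rewrite ler_piMl.
have t0 : 0 <= (16 * lambda)^-1 by rewrite invr_ge0 mulr_ge0// ltW.
have p5 := ler_wpM2l t0 p1.
by lra.
Qed.

End Noise.
End Damping.

Section Contraction.
Context {R : realType} {n : nat}.
Variables (lambda : R) (x : 'cV[R]_n) (M : 'M[R]_n).
Hypothesis xs : is_sign x.
Hypothesis n0 : (0 < n)%N.
Hypothesis l0 : 0 < lambda.
Hypothesis HM : regular_noise lambda x M.
Hypothesis k1 : kappa lambda <= 1.

Local Notation Y := (spiked lambda x M).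
Local Notation G := (tap_field lambda Y).

Lemma overlapB (m s : 'cV[R]_n) : overlap m - overlap s = dot (m + s) (m - s) / n%:R.
Proof. by rewrite !overlapE dotDl !dotBr (dotC s m) -mulrBl; congr (_ / _); ring. Qed.

Lemma tap_fieldB (m m' s : 'cV[R]_n) : G m m' - G s s =
  lambda *: (M *m (m - s)) + (lambda ^+ 2 * corr x (m - s)) *: x
  - (lambda ^+ 2 * (1 - overlap m)) *: (m' - s)
  + (lambda ^+ 2 * (overlap m - overlap s)) *: s.
Proof.
rewrite /tap_field !spiked_mul mulmxBr /corr dotBr.
move: (M *m m) (M *m s) (overlap m) (overlap s) => u v o o'.
by apply/matrixP => i j; rewrite !mxE; ring.
Qed.

(** One damping comes from the secants of tanh, the other from the seminorm in
    which the conclusion is measured. The noise then contributes through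
    [damped_noise], and the three rank one terms (the spike and the change of
    the overlap) through [damped_cube]. The Onsager term has a small
    coefficient and needs no damping. *)
Lemma field_contraction (A B omega : R) (h s m' : 'cV[R]_n) :
  aligned lambda x (lambda ^+ 3)^-1 h -> aligned lambda x (lambda ^+ 3)^-1 s ->
  0 <= 1 - overlap (tanhv h) <= omega ->
  damped_le lambda A (h - s) -> l2norm (m' - tanhv s) <= B ->
  damped_le lambda
    ((lambda * ((16 * lambda)^-1 + 108 * kappa lambda) +
      3 * lambda ^+ 2 * damped_cube_bound lambda) * A + lambda ^+ 2 * omega * B)
    (G (tanhv h) m' - G (tanhv s) (tanhv s)).
Proof.
move=> ha sa /andP[q0 q1] HA HB r dr.
have l0' := l0; have n0' : 0 < n%:R :> R by rewrite ltr0n.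
have [r' dr' dm] := secant_damping xs ha sa.
set m := tanhv h in dm q0 q1 *; set ms := tanhv s in dm HB *.
have mc : in_cube m by exact: tanhv_in_cube.
have msc : in_cube ms by exact: tanhv_in_cube.
set w := hmul r' (h - s) in dm.
have wA : l2norm w <= A by exact: HA.
have A0 : 0 <= A := le_trans (l2norm_ge0 _) wA.
set be := damped_cube_bound lambda.
have be0 : 0 <= be.
  by rewrite addr_ge0 ?sqr_ge0// divr_ge0// exprn_ge0// ltW.
pose N := Num.sqrt (be * n%:R).
have N0 : 0 <= N := sqrtr_ge0 _.
have NN : N * N = be * n%:R by rewrite -expr2 sqr_sqrtr// mulr_ge0// ltW.
have small (q v : 'cV[R]_n) : damping lambda q -> in_cube v -> l2norm (hmul q v) <= N.
  move=> dq vc; apply: l2norm_le => //; rewrite expr2 NN; exact: (damped_cube dq vc).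
(* One factor sqrt (bound) for a damped sign vector; the other one comes from r
   in the next claim. *)
have form (v : 'cV[R]_n) : in_cube v -> `|dot v (m - ms)| <= N * A.
  move=> vc; rewrite dm -dot_hmul; apply: le_trans (normr_dot_le _ _) _.
  by rewrite ler_pM ?l2norm_ge0 ?small.
have prod (c b : R) (v : 'cV[R]_n) : in_cube v -> `|c| <= b * (N * A) ->
    l2norm (hmul r ((lambda ^+ 2 * (c / n%:R)) *: v)) <= b * (lambda ^+ 2 * be * A).
  move=> vc cb; rewrite hmulZ l2normZ normrM (ger0_norm (sqr_ge0 lambda)) normrM.
  rewrite normfV (ger0_norm (ltW n0')).
  apply: (@le_trans _ _ (lambda ^+ 2 * (b * (N * A) / n%:R) * N)).
    have i0 : 0 <= n%:R^-1 :> R by rewrite invr_ge0 ltW.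
    apply: ler_pM; [|exact: l2norm_ge0| |exact: small].
      by rewrite mulr_ge0 ?sqr_ge0// mulr_ge0.
    by rewrite ler_wpM2l ?sqr_ge0// ler_wpM2r.
  rewrite [leLHS](_ : _ = b * (lambda ^+ 2 * (N * N / n%:R) * A)); last by ring.
  by rewrite NN mulfK ?gt_eqF.
rewrite tap_fieldB !hmulD hmulN.
apply: le_trans (l2normD _ _) _.
have F4 : l2norm (hmul r ((lambda ^+ 2 * (overlap m - overlap ms)) *: ms)) <=
    2 * (lambda ^+ 2 * be * A).
  rewrite overlapB; apply: prod => //; rewrite dotDl.
  apply: le_trans (ler_normD _ _) _; have := form _ mc; have := form _ msc; lra.
have F2 : l2norm (hmul r ((lambda ^+ 2 * corr x (m - ms)) *: x)) <=
    1 * (lambda ^+ 2 * be * A).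
  by apply: prod; [exact: sign_cube|rewrite mul1r; apply: form; exact: sign_cube].
have F3 : l2norm (- hmul r ((lambda ^+ 2 * (1 - overlap m)) *: (m' - ms))) <=
    lambda ^+ 2 * omega * B.
  rewrite l2normN hmulZ l2normZ (ger0_norm (mulr_ge0 (sqr_ge0 _) q0)).
  have B0 : 0 <= B := le_trans (l2norm_ge0 _) HB.
  apply: ler_pM; [by rewrite mulr_ge0 ?sqr_ge0|exact: l2norm_ge0| |].
    by rewrite ler_wpM2l ?sqr_ge0.
  by apply: le_trans HB; apply: l2norm_hmul_le; case: dr.
set tau := (16 * lambda)^-1 + 108 * kappa lambda.
have tau0 : 0 <= tau.
  by rewrite addr_ge0 ?invr_ge0 ?mulr_ge0 ?kappa_ge0 ?(ltW l0).
have F1 : l2norm (hmul r (lambda *: (M *m (m - ms)))) <= lambda * (tau * A).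
  rewrite hmulZ l2normZ (gtr0_norm l0); apply: ler_wpM2l; first exact: ltW.
  apply: l2norm_dual => [|u]; first by rewrite mulr_ge0.
  rewrite -dot_hmul dm; apply: le_trans (damped_noise l0 HM k1 u w dr dr') _.
  by rewrite -/tau [leRHS]mulrAC -[leRHS]mulrA ler_wpM2l// ler_wpM2l ?l2norm_ge0.
have := l2normD (hmul r (lambda *: (M *m (m - ms))) +
  hmul r ((lambda ^+ 2 * corr x (m - ms)) *: x))
  (- hmul r ((lambda ^+ 2 * (1 - overlap m)) *: (m' - ms))).
have := l2normD (hmul r (lambda *: (M *m (m - ms))))
  (hmul r ((lambda ^+ 2 * corr x (m - ms)) *: x)).
by rewrite mulrDl; lra.
Qed.

End Contraction.

(** * Numerical consequences of a large signal *)

Section Constants.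
Context {R : realType}.
Variable lambda : R.
Hypothesis lam : 10 ^+ 80 <= lambda.

Local Notation u := (lambda^-1).

Lemma lambda_gt0 : 0 < lambda.
Proof. by apply: lt_le_trans lam; rewrite exprn_gt0. Qed.

Lemma inv_le : 10 ^+ 80 * u <= 1.
Proof. by rewrite ler_pdivrMr ?lambda_gt0// mul1r. Qed.

Lemma inv_gt0 : 0 < u.
Proof. by rewrite invr_gt0 lambda_gt0. Qed.

(** Terms exponential in lambda^2 are treated as powers of 1 / lambda, from the
    term of degree 4 of the series of exp. *)
Lemma expR_div16_le : expR (- (lambda ^+ 2 / 16)) <= u ^+ 7.
Proof.
have l0 := lambda_gt0.
have x0 : 0 <= lambda ^+ 2 / 16 by rewrite divr_ge0 ?sqr_ge0.
have H := expR_ge1Dxn 3 x0.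
rewrite expRN exprVn lef_pV2 ?posrE ?expR_gt0 ?exprn_gt0//.
have L : 10 ^+ 80 * lambda ^+ 7 <= lambda ^+ 8.
  by rewrite [lambda ^+ 8]exprS ler_wpM2r// exprn_ge0// ltW.
have p := exprn_gt0 7 l0.
have fE : 4`!%:R = 24 :> R by [].
rewrite fE in H; apply: le_trans H.
rewrite (_ : (lambda ^+ 2 / 16) ^+ 4 / 24 = lambda ^+ 8 / (16 ^+ 4 * 24)); last by field.
by lra.
Qed.

Lemma expR_div8_le : expR (- (lambda ^+ 2 / 8)) <= u ^+ 7.
Proof.
apply: le_trans expR_div16_le; rewrite ler_expR.
have := sqr_ge0 lambda; lra.
Qed.

Lemma kappa_le : kappa lambda <= 2 * u ^+ 7.
Proof. by rewrite ler_wpM2l// expR_div16_le. Qed.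

(** With u = 1 / lambda, an inequality between polynomials in u reduces by this
    comparison of successive powers to linear arithmetic. *)
Lemma inv_exp_le k : 10 ^+ 80 * u ^+ k.+1 <= u ^+ k.
Proof.
rewrite (exprS u) mulrA -[leRHS]mul1r ler_wpM2r ?inv_le//.
by rewrite exprn_ge0// ltW ?inv_gt0.
Qed.

Lemma inv_exp_ge0 k : 0 <= u ^+ k.
Proof. by rewrite exprn_ge0// ltW ?inv_gt0. Qed.

Lemma kappa_le1 : kappa lambda <= 1.
Proof.
apply: le_trans kappa_le _.
have := inv_exp_le 6; have := inv_exp_le 5; have := inv_exp_le 4; have := inv_exp_le 3.
have := inv_exp_le 2; have := inv_exp_le 1; have := inv_exp_le 0.
by have := inv_exp_ge0 7; rewrite expr0; lra.
Qed.

Lemma contraction_rate_le : lambda * ((16 * lambda)^-1 + 108 * kappa lambda) +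
  3 * lambda ^+ 2 * damped_cube_bound lambda <= 1 / 8.
Proof.
have l0 := lambda_gt0; have k0 := kappa_ge0 lambda; have k1 := kappa_le.
have k2 : kappa lambda ^+ 2 <= 4 * u ^+ 14.
  rewrite (_ : 4 * u ^+ 14 = (2 * u ^+ 7) ^+ 2); last by ring.
  by rewrite lerXn2r ?nnegrE// (le_trans k0).
have lu : lambda * u = 1 by rewrite divff// gt_eqF.
rewrite /damped_cube_bound.
(* The block norm gives 1/16, and all other terms are O(1 / lambda). *)
apply: (@le_trans _ _ (16^-1 + 216 * u ^+ 6 + 6 * u + 12 * u ^+ 12)).
  have -> : lambda * ((16 * lambda)^-1 + 108 * kappa lambda) = 16^-1 + 108 * (lambda * kappa lambda).
    by field; rewrite gt_eqF.
  have -> : 3 * lambda ^+ 2 * (2 / lambda ^+ 3 + kappa lambda ^+ 2) =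
      6 * u + 3 * (lambda ^+ 2 * kappa lambda ^+ 2).
    by field; rewrite gt_eqF.
  have e1 : lambda * kappa lambda <= 2 * u ^+ 6.
    have -> : 2 * u ^+ 6 = lambda * (2 * u ^+ 7) by field; rewrite gt_eqF.
    by rewrite ler_wpM2l// ltW.
  have e2 : lambda ^+ 2 * kappa lambda ^+ 2 <= 4 * u ^+ 12.
    have -> : 4 * u ^+ 12 = lambda ^+ 2 * (4 * u ^+ 14) by field; rewrite gt_eqF.
    by rewrite ler_wpM2l// sqr_ge0.
  by lra.
have i1 := inv_le; have i0 := inv_gt0.
have i6 : u ^+ 6 <= u by rewrite -[leRHS]expr1 ler_wiXn2l ?ltW//; lra.
have i12 : u ^+ 12 <= u by rewrite -[leRHS]expr1 ler_wiXn2l ?ltW//; lra.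
by lra.
Qed.

End Constants.

(** * One step of the field *)

Section Steps.
Context {R : realType} {n : nat}.
Variables (lambda : R) (x : 'cV[R]_n) (M : 'M[R]_n).
Hypothesis lam : 10 ^+ 80 <= lambda.
Hypothesis xs : is_sign x.
Hypothesis n0 : (0 < n)%N.
Hypothesis HM : regular_noise lambda x M.

Local Notation Y := (spiked lambda x M).
Local Notation G := (tap_field lambda Y).
Local Notation u := (lambda^-1).

Let l0 : 0 < lambda := lambda_gt0 lam.
Let lne : lambda != 0. Proof. by rewrite gt_eqF. Qed.

Lemma aligned_mono (d e : R) h : d <= e -> aligned lambda x d h -> aligned lambda x e h.
Proof.
by move=> de [S [Sd HS]]; exists S; split=> //; apply: le_trans Sd _; rewrite ler_wpM2r.
Qed.

Lemma decomposed_mono (d e : R) h : d <= e ->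
  decomposed lambda x M d h -> decomposed lambda x M e h.
Proof.
move=> de [c [b [f [-> cl bl H]]]]; exists c, b, f; split=> //.
by apply: le_trans H _; rewrite ler_wpM2r.
Qed.

Lemma aligned_corr4 (d : R) h : u ^+ 7 <= d -> aligned lambda x d h ->
  1 - corr x (tanhv h) <= 4 * d.
Proof.
move=> ud ha; apply: le_trans (aligned_corr xs n0 ha) _.
have := expR_div8_le lam; lra.
Qed.

Lemma decomposed_aligned_lt (E : R) h : 0 <= E -> 1 + 1024 * E <= lambda ->
  decomposed lambda x M E h -> aligned lambda x (lambda ^+ 3)^-1 h.
Proof.
move=> E0 El Hd; apply: aligned_mono (decomposed_aligned xs l0 HM E0 Hd).
rewrite ler_pdivrMr ?exprn_gt0//.
by rewrite (_ : (lambda ^+ 3)^-1 * lambda ^+ 4 = lambda)//; field.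
Qed.

Lemma field_decomposed (E B rho : R) m m' : in_cube m -> 1 - corr x m <= rho ->
  rho <= 1 / 2 -> 0 <= B -> dot m' m' <= B * n%:R ->
  4 * 36 ^+ 2 * (lambda ^+ 2 * rho) + 8 * (lambda ^+ 4 * rho ^+ 2 * B) <= E ->
  decomposed lambda x M E (G m m').
Proof.
move=> mc H r2 B0 HB HE.
apply: decomposed_mono (tap_field_decomposed xs n0 l0 HM mc H r2 B0 HB).
by apply: le_trans HE; rewrite le_eqVlt; apply/orP; left; apply/eqP; ring.
Qed.

(** An aligned field h has 1 - <x, tanh h> / n <= 4 / lambda^3, which makes the
    next error bounded, even if the previous magnetization is an arbitrary
    point of the cube. *)
Lemma field_step h m' : aligned lambda x (lambda ^+ 3)^-1 h -> in_cube m' ->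
  decomposed lambda x M 1 (G (tanhv h) m').
Proof.
move=> ha m'c; have i1 := inv_le lam; have i0 := inv_gt0 lam.
have u7 : u ^+ 7 <= (lambda ^+ 3)^-1.
  by rewrite -exprVn ler_wiXn2l ?ltW//; lra.
have := aligned_corr4 u7 ha; rewrite -exprVn => Hr.
have u2 : u ^+ 2 <= u by rewrite -[leRHS]expr1 ler_wiXn2l ?ltW//; lra.
have u3 : u ^+ 3 <= u by rewrite -[leRHS]expr1 ler_wiXn2l ?ltW//; lra.
apply: (@field_decomposed _ 1 (4 * u ^+ 3)) => //.
- exact: tanhv_in_cube.
- by lra.
- by rewrite mul1r; exact: in_cube_dot.
- rewrite (_ : lambda ^+ 2 * _ = 4 * u); last by field.
  by rewrite (_ : lambda ^+ 4 * _ * 1 = 16 * u ^+ 2); [lra|field].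
Qed.

Lemma decomposed_aligned_bounded (E : R) h : 0 <= E <= 10 ^+ 70 -> decomposed lambda x M E h ->
  aligned lambda x (lambda ^+ 3)^-1 h.
Proof.
move=> /andP[E0 E1]; apply: decomposed_aligned_lt => //; have := lam; lra.
Qed.

(** The vector that enters the first Onsager term has norm of order lambda^3
    sqrt n instead of sqrt n. The first field therefore has an error of squared
    norm lambda^2 n; this still gives 1 - <x, m> / n = O(1 / lambda^2), and the
    second field has a bounded error. *)
Lemma second_amp_field h m0 h1 : decomposed lambda x M (10 ^+ 8) h -> dot m0 m0 <= lambda ^+ 6 * n%:R ->
  h1 = G (tanhv h) m0 -> decomposed lambda x M (10 ^+ 70) (G (tanhv h1) (tanhv h)).
Proof.
move=> hd H0 ->; have i1 := inv_le lam; have i0 := inv_gt0 lam.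
have u7 k : (k <= 7)%N -> u ^+ 7 <= u ^+ k.
  by move=> k7; rewrite ler_wiXn2l ?ltW//; lra.
have u2 : u ^+ 2 <= u by rewrite -[leRHS]expr1 ler_wiXn2l ?ltW//; lra.
have u4 : u ^+ 4 <= u by rewrite -[leRHS]expr1 ler_wiXn2l ?ltW//; lra.
have E8 : (0 : R) <= 10 ^+ 8 by rewrite exprn_ge0.
have a0 := decomposed_aligned xs l0 HM E8 hd.
have a0' : aligned lambda x (10 ^+ 12 * u ^+ 4) h.
  apply: aligned_mono a0; rewrite -[_ / lambda ^+ 4]/(_ * (lambda ^+ 4)^-1) -exprVn.
  by rewrite ler_wpM2r ?inv_exp_ge0//; lra.
have := aligned_corr4 _ a0'.
have -> : u ^+ 7 <= 10 ^+ 12 * u ^+ 4 by have := u7 4%N isT; have := inv_exp_ge0 lam 4; lra.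
move=> /(_ isT) r0.
(* The error of the first field, dominated by its Onsager term. *)
have d1 : decomposed lambda x M (10 ^+ 28 * lambda ^+ 2) (G (tanhv h) m0).
  apply: (@field_decomposed _ (lambda ^+ 6) (4 * (10 ^+ 12 * u ^+ 4))) => //.
  - exact: tanhv_in_cube.
  - by lra.
  - by rewrite exprn_ge0// ltW.
  - rewrite (_ : lambda ^+ 2 * _ = 4 * (10 ^+ 12 * u ^+ 2)); last by field.
    rewrite (_ : lambda ^+ 4 * _ * _ = 16 * 10 ^+ 24 * lambda ^+ 2); last by field.
    have l2 : 1 <= lambda ^+ 2 by apply: exprn_ege1; have := lam; lra.
    by lra.
have a1 := decomposed_aligned xs l0 HM (mulr_ge0 (exprn_ge0 28 (ler0n _ 10)) (sqr_ge0 lambda)) d1.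
have a1' : aligned lambda x (10 ^+ 32 * u ^+ 2) (G (tanhv h) m0).
  apply: aligned_mono a1.
  have -> : (1 + 1024 * (10 ^+ 28 * lambda ^+ 2)) / lambda ^+ 4 =
     u ^+ 4 + 1024 * 10 ^+ 28 * u ^+ 2 by field.
  have u42 : u ^+ 4 <= u ^+ 2 by rewrite ler_wiXn2l ?ltW//; lra.
  have := inv_exp_ge0 lam 2; lra.
have := aligned_corr4 _ a1'.
have -> : u ^+ 7 <= 10 ^+ 32 * u ^+ 2 by have := u7 2%N isT; have := inv_exp_ge0 lam 2; lra.
move=> /(_ isT) r1.
apply: (@field_decomposed _ 1 (4 * (10 ^+ 32 * u ^+ 2))) => //.
- exact: tanhv_in_cube.
- by lra.
- by rewrite mul1r; apply: in_cube_dot; exact: tanhv_in_cube.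
- rewrite (_ : lambda ^+ 2 * _ = 4 * 10 ^+ 32); last by field.
  by rewrite (_ : lambda ^+ 4 * _ * 1 = 16 * 10 ^+ 64); [lra|field].
Qed.

(** With rho = 1 - <x, m> / n, the equation shows that the error of h is of
    order lambda^2 rho + lambda^4 rho^2, and then that rho is at most a small
    multiple of rho plus 1 / lambda^4. Since rho is at most of order 1 /
    lambda, this forces rho = O(1 / lambda^4). *)
Lemma fixed_point_aligned h : h = G (tanhv h) (tanhv h) ->
  1 - corr x (tanhv h) <= 152 * u -> decomposed lambda x M 1 h.
Proof.
move=> hE; set rho := 1 - corr x (tanhv h) => Hr.
have i1 := inv_le lam; have i0 := inv_gt0 lam.
have mc : in_cube (tanhv h) by exact: tanhv_in_cube.
have r0 : 0 <= rho.
  by have /andP[] := overlap_le_corr xs n0 mc (lexx rho); lra.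
pose E := 4 * 36 ^+ 2 * (lambda ^+ 2 * rho) + 8 * (lambda ^+ 4 * rho ^+ 2).
have dE : decomposed lambda x M E h.
  rewrite hE; apply: (@field_decomposed _ 1 rho) => //.
  - by lra.
  - by rewrite mul1r; exact: in_cube_dot.
  - by rewrite mulr1.
have E0 : 0 <= E by rewrite addr_ge0// !mulr_ge0// ?exprn_ge0// ltW.
have := aligned_corr xs n0 (decomposed_aligned xs l0 HM E0 dE).
rewrite -/rho => H; have e := expR_div8_le lam.
have u74 : u ^+ 7 <= u ^+ 4 by rewrite ler_wiXn2l ?ltW//; lra.
have u2 : u ^+ 2 <= u by rewrite -[leRHS]expr1 ler_wiXn2l ?ltW//; lra.
have EE : (1 + 1024 * E) / lambda ^+ 4 =
    u ^+ 4 + 1024 * (4 * 36 ^+ 2 * (u ^+ 2 * rho) + 8 * rho ^+ 2).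
  by rewrite /E; field.
rewrite EE in H.
(* Here one factor rho is bounded a priori, and the other absorbed. *)
have rr : rho ^+ 2 <= 152 * (u * rho) by rewrite expr2; have := ler_wpM2r r0 Hr; lra.
have ur : u ^+ 2 * rho <= u * rho by rewrite ler_wpM2r.
have ur2 : 10 ^+ 80 * (u * rho) <= rho by have := ler_wpM2r r0 i1; lra.
have r6 : rho <= 10 * u ^+ 4.
  have p4 := inv_exp_ge0 lam 4; lra.
apply: decomposed_mono dE; rewrite /E.
have q1 : lambda ^+ 2 * rho <= 10 * u ^+ 2.
  have -> : 10 * u ^+ 2 = lambda ^+ 2 * (10 * u ^+ 4) by field.
  by rewrite ler_wpM2l ?sqr_ge0.
have q2 : lambda ^+ 4 * rho ^+ 2 <= (10 * u ^+ 2) ^+ 2.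
  have -> : lambda ^+ 4 * rho ^+ 2 = (lambda ^+ 2 * rho) ^+ 2 by ring.
  have p2 := inv_exp_ge0 lam 2.
  by rewrite lerXn2r// nnegrE mulr_ge0// sqr_ge0.
have q3 : (10 * u ^+ 2) ^+ 2 <= 100 * u.
  rewrite (_ : (10 * u ^+ 2) ^+ 2 = 100 * u ^+ 4); last by ring.
  by rewrite ler_wpM2l// -[leRHS]expr1 ler_wiXn2l ?ltW//; lra.
lra.
Qed.

End Steps.

(** * Fixed points and trajectories *)

Section Trajectories.
Context {R : realType} {n : nat}.
Variables (lambda : R) (x : 'cV[R]_n) (M : 'M[R]_n).
Hypothesis lam : 10 ^+ 80 <= lambda.
Hypothesis xs : is_sign x.
Hypothesis n0 : (0 < n)%N.
Hypothesis HM : regular_noise lambda x M.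

Local Notation Y := (spiked lambda x M).
Local Notation G := (tap_field lambda Y).
Local Notation u := (lambda^-1).
Local Notation nn := (Num.sqrt (n%:R : R)).

Let l0 : 0 < lambda := lambda_gt0 lam.
Let lne : lambda != 0. Proof. by rewrite gt_eqF. Qed.

Lemma spiked_sym : Y^T = Y.
Proof.
have [MT _ _ _] := HM.
by rewrite /spiked linearD linearZ/= trmx_mul trmxK MT.
Qed.

Lemma sqrtn_sqr : nn ^+ 2 = n%:R.
Proof. by rewrite sqr_sqrtr. Qed.

Lemma in_cube_norm (m : 'cV[R]_n) : in_cube m -> l2norm m <= nn.
Proof. by move=> mc; apply: l2norm_le; rewrite ?sqrtr_ge0// sqrtn_sqr; exact: in_cube_dot. Qed.

Lemma noise_norm (v : 'cV[R]_n) : l2norm (M *m v) <= 36 * l2norm v.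
Proof.
apply: l2norm_le; first by rewrite mulr_ge0 ?l2norm_ge0.
by rewrite exprMn sqr_l2norm; exact: noise_sqr HM v.
Qed.

Lemma corr_norm (v : 'cV[R]_n) : `|corr x v| * nn <= l2norm v.
Proof.
have n0' : 0 < n%:R :> R by rewrite ltr0n.
have s0 : 0 < nn by rewrite sqrtr_gt0.
rewrite -(ler_pM2r s0) -mulrA -expr2 sqrtn_sqr.
rewrite -[X in _ * X](gtr0_norm n0') -normrM corrE//.
by apply: le_trans (normr_dot_le _ _) _; rewrite mulrC ler_wpM2l ?l2norm_ge0//
  in_cube_norm//; exact: sign_cube.
Qed.

Lemma spiked_norm (v : 'cV[R]_n) : l2norm (Y *m v) <= (lambda + 36) * l2norm v.
Proof.
rewrite spiked_mul; apply: le_trans (l2normD _ _) _; rewrite mulrDl.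
apply: lerD; last exact: noise_norm.
rewrite l2normZ normrM (gtr0_norm l0) -mulrA ler_wpM2l ?(ltW l0)//.
apply: le_trans (corr_norm v); rewrite ler_wpM2l// in_cube_norm//; exact: sign_cube.
Qed.

Lemma overlap01 (m : 'cV[R]_n) : in_cube m -> 0 <= overlap m <= 1.
Proof.
move=> mc; have n0' : 0 < n%:R :> R by rewrite ltr0n.
rewrite overlapE divr_ge0 ?dot_ge0//= ler_pdivrMr// mul1r; exact: in_cube_dot.
Qed.

Lemma field_norm (b : R) (m m' : 'cV[R]_n) : in_cube m -> 0 <= b -> l2norm m' <= b * nn ->
  l2norm (G m m') <= (lambda * (lambda + 36) + lambda ^+ 2 * b) * nn.
Proof.
move=> mc b0 Hb; apply: le_trans (l2normB _ _) _; rewrite mulrDl.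
have /andP[q0 q1] := overlap01 mc.
have s0 : 0 <= nn := sqrtr_ge0 _.
apply: lerD.
  rewrite l2normZ (gtr0_norm l0) -mulrA ler_wpM2l ?(ltW l0)//.
  apply: le_trans (spiked_norm _) _.
  by rewrite ler_wpM2l ?in_cube_norm// addr_ge0// ltW.
rewrite l2normZ normrM (ger0_norm (sqr_ge0 _)) -[leLHS]mulrA -[leRHS]mulrA.
apply: ler_wpM2l; first exact: sqr_ge0.
apply: le_trans Hb; rewrite ler_piMl ?l2norm_ge0// ger0_norm; lra.
Qed.

Lemma field_norm_cube (m m' : 'cV[R]_n) : in_cube m -> in_cube m' ->
  l2norm (G m m') <= 5 / 2 * lambda ^+ 2 * nn.
Proof.
move=> mc m'c; have := @field_norm 1 m m' mc ler01; rewrite mul1r in_cube_norm//.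
move=> /(_ isT) H; apply: le_trans H _; rewrite ler_wpM2r ?sqrtr_ge0//.
have := ler_wpM2r (ltW l0) lam; have := l0; lra.
Qed.

Lemma cube_dist (m s : 'cV[R]_n) : in_cube m -> in_cube s -> l2norm (m - s) <= 2 * nn.
Proof.
move=> mc sc; apply: le_trans (l2normB _ _) _.
by have := in_cube_norm mc; have := in_cube_norm sc; lra.
Qed.

(** Under the standing bound on lambda, each of the two coefficients in
    [field_contraction] is at most 1/8. *)
Lemma field_contraction_eighth (A B : R) (h s m' : 'cV[R]_n) :
  aligned lambda x (lambda ^+ 3)^-1 h -> aligned lambda x (lambda ^+ 3)^-1 s ->
  damped_le lambda A (h - s) -> l2norm (m' - tanhv s) <= B ->
  damped_le lambda ((A + B) / 8) (G (tanhv h) m' - G (tanhv s) (tanhv s)).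
Proof.
move=> ha sa HA HB; have i1 := inv_le lam; have i0 := inv_gt0 lam.
have u73 : u ^+ 7 <= (lambda ^+ 3)^-1 by rewrite -exprVn ler_wiXn2l ?ltW//; lra.
have u3 : u ^+ 3 <= u by rewrite -[leRHS]expr1 ler_wiXn2l ?ltW//; lra.
have u2 : u ^+ 2 <= u by rewrite -[leRHS]expr1 ler_wiXn2l ?ltW//; lra.
have Hr := aligned_corr4 lam xs n0 u73 ha.
have Ho := overlap_le_corr xs n0 (tanhv_in_cube h) Hr.
have H := field_contraction xs n0 l0 HM (kappa_le1 lam) ha sa Ho HA HB.
move=> r dr; apply: le_trans (H r dr) _.
have A0 : 0 <= A := le_trans (l2norm_ge0 _) (HA r dr).
have B0 : 0 <= B := le_trans (l2norm_ge0 _) HB.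
have c1 := contraction_rate_le lam.
rewrite [(A + B) / 8]mulrDl; apply: lerD.
  by rewrite mulrC ler_wpM2l//; lra.
rewrite mulrC ler_wpM2l// (_ : lambda ^+ 2 * _ = 8 * u); last by field.
by lra.
Qed.

Variable s : 'cV[R]_n.
Hypothesis sE : s = G (tanhv s) (tanhv s).
Hypothesis sd : decomposed lambda x M 1 s.

Let sa : aligned lambda x (lambda ^+ 3)^-1 s.
Proof.
apply: (decomposed_aligned_bounded lam xs HM) sd.
by rewrite ler01 exprn_ege1// ler1n.
Qed.

Lemma fixed_point_norm : l2norm s <= 5 / 2 * lambda ^+ 2 * nn.
Proof. by rewrite sE; apply: field_norm_cube; exact: tanhv_in_cube. Qed.

(** The bound on the difference of the fields improves by a factor 4
    indefinitely. *)
Lemma fixed_point_unique (t : 'cV[R]_n) : t = G (tanhv t) (tanhv t) ->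
  decomposed lambda x M 1 t -> t = s.
Proof.
move=> tE td.
have ta : aligned lambda x (lambda ^+ 3)^-1 t.
  apply: (decomposed_aligned_bounded lam xs HM) td.
  by rewrite ler01 exprn_ege1// ler1n.
have [r dr dm] := secant_damping xs ta sa.
have H k : damped_le lambda (l2norm (t - s) / 4 ^+ k) (t - s).
  elim: k => [|k IH]; first by rewrite divr1; exact: damped_le_l2norm.
  have Hd := damped_le_tanhv xs ta sa IH.
  have := field_contraction_eighth ta sa IH Hd; rewrite -tE -sE.
  congr damped_le; rewrite exprS; field.
  by rewrite expf_neq0.
have D k : l2norm (tanhv t - tanhv s) * 4 ^+ k <= l2norm (t - s).
  by rewrite -ler_pdivlMr ?exprn_gt0//; exact: damped_le_tanhv (H k).
have Z : tanhv t = tanhv s.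
  apply/eqP; rewrite -subr_eq0 -l2norm_eq0 eq_le l2norm_ge0 andbT leNgt.
  apply/negP => p.
  pose N := Num.bound (l2norm (t - s) / l2norm (tanhv t - tanhv s)).
  have := D N; apply/negP; rewrite -ltNge mulrC -ltr_pdivrMr//.
  have B : l2norm (t - s) / l2norm (tanhv t - tanhv s) < N%:R.
    by apply: archi_boundP; rewrite divr_ge0 ?l2norm_ge0.
  apply: lt_trans B _; rewrite -natrX ltr_nat; exact: ltn_expl.
by rewrite tE sE Z.
Qed.

Variable h0 : 'cV[R]_n.
Hypothesis h0d : decomposed lambda x M (10 ^+ 8) h0.
Hypothesis h0n : l2norm h0 <= lambda ^+ 2 * nn.

Section Ngd.
Variable eta : R.
Hypothesis eta01 : 0 < eta < 1.

Local Notation h := (ngd_state lambda Y eta h0).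

Lemma ngd_stateE k : h k.+1 = (1 - eta) *: h k + eta *: G (tanhv (h k)) (tanhv (h k)).
Proof. by rewrite (ngd_stateS _ _ _ _ spiked_sym). Qed.

(** The target of each step is decomposed, so that its average with the current
    field is. *)
Lemma ngd_decomposed k : decomposed lambda x M (10 ^+ 8) (h k).
Proof.
have /andP[t0 t1] := eta01.
elim: k => [//|k IH]; rewrite ngd_stateE; apply: decomposed_convex => //.
  by rewrite !ltW.
have ka : aligned lambda x (lambda ^+ 3)^-1 (h k).
  apply: (decomposed_aligned_bounded lam xs HM) IH.
  by rewrite exprn_ge0//=; lra.
apply: decomposed_mono (field_step lam xs n0 HM ka (tanhv_in_cube _)).
by rewrite exprn_ege1// ler1n.
Qed.

Lemma ngd_aligned k : aligned lambda x (lambda ^+ 3)^-1 (h k).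
Proof.
apply: (decomposed_aligned_bounded lam xs HM) (ngd_decomposed k).
by rewrite exprn_ge0//=; lra.
Qed.

Lemma ngd_norm k : l2norm (h k) <= 5 / 2 * lambda ^+ 2 * nn.
Proof.
have /andP[t0 t1] := eta01; have s0 : 0 <= nn := sqrtr_ge0 _.
elim: k => [|k IH].
  apply: le_trans h0n _; rewrite ler_wpM2r//; have := sqr_ge0 lambda; lra.
rewrite ngd_stateE; apply: le_trans (l2normD _ _) _; rewrite !l2normZ.
have v0 : 0 <= 1 - eta by lra.
rewrite (ger0_norm v0) (gtr0_norm t0).
have F := field_norm_cube (tanhv_in_cube (h k)) (tanhv_in_cube (h k)).
by have := ler_wpM2l v0 IH; have := ler_wpM2l (ltW t0) F; lra.
Qed.

(** One step contracts by 1 - eta + eta / 4. *)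
Lemma ngd_rate k : l2norm (ngd lambda Y eta h0 k - tanhv s) <=
  40 * lambda ^+ 2 * (1 - eta / 2) ^+ k * nn.
Proof.
have /andP[t0 t1] := eta01; have s0 : 0 <= nn := sqrtr_ge0 _.
have v0 : 0 <= 1 - eta by lra.
pose A := 5 * lambda ^+ 2 * nn.
have A0 : 0 <= A by apply: mulr_ge0 => //; apply: mulr_ge0; rewrite ?sqr_ge0.
have H : damped_le lambda (A * (1 - eta / 2) ^+ k) (h k - s).
  elim: k => [|k IH].
    rewrite expr0 mulr1 => r dr; apply: le_trans (damped_le_l2norm _ dr) _.
    apply: le_trans (l2normB _ _) _; have := fixed_point_norm; have := ngd_norm 0.
    by rewrite /A /=; lra.
  have Hd := damped_le_tanhv xs (ngd_aligned k) sa IH.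
  have := field_contraction_eighth (ngd_aligned k) sa IH Hd; rewrite -sE => F.
  have -> : h k.+1 - s = (1 - eta) *: (h k - s) +
      eta *: (G (tanhv (h k)) (tanhv (h k)) - s).
    by rewrite ngd_stateE; move: (G _ _) => g; apply/matrixP => i j; rewrite !mxE; ring.
  have F' := damped_leD (damped_leZ v0 IH) (damped_leZ (ltW t0) F).
  move=> r dr; apply: le_trans (F' r dr) _.
  rewrite exprS; set X := (1 - eta / 2) ^+ k.
  have X0 : 0 <= A * X.
    by apply: mulr_ge0 => //; apply: exprn_ge0; lra.
  by have := mulr_ge0 (ltW t0) X0; lra.
apply: le_trans (damped_le_tanhv xs (ngd_aligned k) sa H) _.
have p0 : 0 <= (1 - eta / 2) ^+ k by apply: exprn_ge0; lra.
rewrite /A mulrAC; apply: ler_wpM2r => //; apply: ler_wpM2r => //.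
by have := sqr_ge0 lambda; lra.
Qed.

End Ngd.

Section Amp.

Local Notation st := (amp_state lambda Y h0 (lambda *: h0)).
Local Notation h k := (st k).1.

Lemma amp_stateE k : st k.+1 = (G (tanhv (h k)) (st k).2, tanhv (h k)).
Proof. by rewrite /=; case: (st k) => a b. Qed.

Lemma amp_fieldS k : h k.+1 = G (tanhv (h k)) (st k).2.
Proof. by rewrite amp_stateE. Qed.

Lemma amp_prevS k : (st k.+1).2 = tanhv (h k).
Proof. by rewrite amp_stateE. Qed.

(** The statement starts at h^2 because h^1 still carries the large initial
    Onsager term. *)
Lemma amp_aligned k : aligned lambda x (lambda ^+ 3)^-1 (h k.+2).
Proof.
elim: k => [|k IH].
  rewrite amp_fieldS amp_prevS.
  apply: (decomposed_aligned_bounded lam xs HM) (second_amp_field lam xs n0 HM h0d _ (amp_fieldS 0)).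
    by rewrite exprn_ge0//= lexx.
  rewrite /= dotZl dotZr -sqr_l2norm mulrA -expr2.
  rewrite (_ : lambda ^+ 6 * n%:R = lambda ^+ 2 * (lambda ^+ 2 * nn) ^+ 2); last first.
    by rewrite exprMn sqrtn_sqr; ring.
  rewrite ler_wpM2l ?sqr_ge0// lerXn2r// nnegrE ?l2norm_ge0//.
  by rewrite mulr_ge0 ?sqr_ge0 ?sqrtr_ge0.
rewrite amp_fieldS.
apply: (decomposed_aligned_bounded lam xs HM) (field_step lam xs n0 HM IH _).
  by rewrite ler01 exprn_ege1// ler1n.
by rewrite amp_prevS; exact: tanhv_in_cube.
Qed.

Lemma amp_norm k : l2norm (h k.+1) <= lambda ^+ 6 * nn.
Proof.
have L := lam; have s0 : 0 <= nn := sqrtr_ge0 _; have L0 := l0.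
have l3 : 0 <= lambda ^+ 3 by rewrite exprn_ge0// ltW.
have H0 : l2norm (st 0).2 <= lambda ^+ 3 * nn.
  rewrite /= l2normZ (gtr0_norm l0) (exprS _ 2) -mulrA ler_wpM2l ?(ltW l0)//.
have H : l2norm (st k).2 <= lambda ^+ 3 * nn.
  case: k => [//|k]; rewrite amp_prevS.
  apply: le_trans (in_cube_norm (tanhv_in_cube _)) _.
  by rewrite ler_peMl// exprn_ege1//; lra.
rewrite amp_fieldS; apply: le_trans (field_norm (tanhv_in_cube _) l3 H) _.
rewrite ler_wpM2r//.
have a2 : lambda * (lambda + 36) <= lambda ^+ 5.
  apply: (@le_trans _ _ (lambda ^+ 3)).
    by rewrite exprS ler_wpM2l ?(ltW l0)// expr2; have := ler_wpM2r (ltW l0) lam; lra.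
  by rewrite ler_weXn2l//; lra.
have -> : lambda ^+ 2 * lambda ^+ 3 = lambda ^+ 5 by ring.
have a5 : 0 <= lambda ^+ 5 by rewrite exprn_ge0// ltW.
have -> : lambda ^+ 6 = lambda * lambda ^+ 5 by ring.
by have := ler_wpM2r a5 lam; lra.
Qed.

(** The errors satisfy a_(k+2) <= (a_(k+1) + a_k) / 8, hence decay at least
    like 2^-k. *)
Lemma amp_rate k : (1 <= k)%N ->
  l2norm (amp lambda Y h0 (lambda *: h0) k - tanhv s) <=
  40 * lambda ^+ 2 * 2^-1 ^+ k * nn.
Proof.
have s0 : 0 <= nn := sqrtr_ge0 _.
have l2 : 10 ^+ 80 * 10 ^+ 80 <= lambda ^+ 2.
  by rewrite expr2 ler_pM ?exprn_ge0.
pose A := 5 * lambda ^+ 2 * nn.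
have A0 : 0 <= A by apply: mulr_ge0 => //; apply: mulr_ge0; rewrite ?sqr_ge0.
have start j : damped_le lambda A (h j.+2 - s).
  move=> r dr; apply: le_trans (damped_le_l2norm _ dr) _.
  apply: le_trans (l2normB _ _) _; have := fixed_point_norm.
  have : l2norm (h j.+2) <= 5 / 2 * lambda ^+ 2 * nn.
    rewrite amp_fieldS amp_prevS; apply: field_norm_cube; exact: tanhv_in_cube.
  by rewrite /A; lra.
have H j : damped_le lambda (2 * A * 2^-1 ^+ j) (h j.+2 - s) /\
    damped_le lambda (2 * A * 2^-1 ^+ j.+1) (h j.+3 - s).
  elim: j => [|j [IH1 IH2]].
    split=> r dr; apply: le_trans (start _ r dr) _; rewrite ?expr0 ?expr1; lra.
  split=> //; have Hd := damped_le_tanhv xs (amp_aligned j) sa IH1.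
  have := field_contraction_eighth (amp_aligned j.+1) sa IH2 Hd; rewrite -sE => F.
  have -> : h j.+4 = G (tanhv (h j.+3)) (tanhv (h j.+2)) by rewrite amp_fieldS amp_prevS.
  move=> r dr; apply: le_trans (F r dr) _; rewrite !(exprS _ j.+1) !exprS.
  have X0 : 0 <= A * 2^-1 ^+ j by rewrite mulr_ge0 ?exprn_ge0.
  by lra.
case: k => [//|[|j]] _.
  apply: le_trans (cube_dist (tanhv_in_cube _) (tanhv_in_cube _)) _.
  by rewrite ler_wpM2r// expr1; lra.
apply: le_trans (damped_le_tanhv xs (amp_aligned j) sa (H j).1) _.
by rewrite /A !exprS le_eqVlt; apply/orP; left; apply/eqP; field.
Qed.

End Amp.
End Trajectories.

(** * Energy of the minimizers *)

Section Entropy.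
Context {R : realType}.
Implicit Types u v p q : R.

Definition atanh u : R := (ln ((1 + u) / 2) - ln ((1 - u) / 2)) / 2.

Lemma ln_le_sub1 p : 0 < p -> ln p <= p - 1.
Proof. by move=> p0; have := expR_ge1Dx (ln p); rewrite lnK ?posrE//; lra. Qed.

(** Nonnegativity of the relative entropy, up to the total masses. *)
Lemma gibbs p q : 0 < p -> 0 < q -> q * ln p - q * ln q <= p - q.
Proof.
move=> p0 q0; rewrite -mulrBr -ln_div ?posrE//.
have := ler_wpM2l (ltW q0) (ln_le_sub1 (divr_gt0 p0 q0)).
by rewrite mulrBr mulrCA divff ?mulr1 ?gt_eqF.
Qed.

(** The tangent inequality of the concave entropy, whose derivative is -
    atanh. *)
Lemma entropy_tangent u v : -1 < u < 1 -> -1 < v < 1 ->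
  binary_entropy v - binary_entropy u <= atanh u * (u - v).
Proof.
move=> /andP[u1 u2] /andP[v1 v2]; rewrite /binary_entropy /atanh.
have p1 : 0 < (1 + u) / 2 by lra.
have p2 : 0 < (1 - u) / 2 by lra.
have q1 : 0 < (1 + v) / 2 by lra.
have q2 : 0 < (1 - v) / 2 by lra.
have := gibbs p1 q1; have := gibbs p2 q2.
set a := ln _; set b := ln _; set c := ln _; set d := ln _.
lra.
Qed.

Lemma entropy_ge0 u : -1 < u < 1 -> 0 <= binary_entropy u.
Proof.
move=> /andP[u1 u2]; rewrite /binary_entropy.
have H p : 0 < p < 1 -> p * ln p <= 0.
  move=> /andP[p0 p1]; rewrite pmulr_rle0// -ln1 ler_ln ?posrE//; exact: ltW.
have := H ((1 + u) / 2); have := H ((1 - u) / 2).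
by move=> /(_ ltac:(lra)) a /(_ ltac:(lra)) b; lra.
Qed.

Lemma entropy_le1 u : -1 < u < 1 -> binary_entropy u <= 1.
Proof.
move=> u1; have z : -1 < (0 : R) < 1 by lra.
have := entropy_tangent z u1; rewrite /atanh !addr0 subr0 subrr mul0r mul0r.
suff : binary_entropy 0 <= (1 : R) by lra.
rewrite /binary_entropy addr0 subr0.
have := @ln_le_sub1 2 ltac:(lra).
by rewrite div1r lnV ?posrE//; lra.
Qed.

Lemma binary_entropyN u : binary_entropy (- u) = binary_entropy u.
Proof. by rewrite /binary_entropy opprK; ring. Qed.

End Entropy.

Section Energy.
Context {R : realType} {n : nat}.
Variables (lambda : R) (x : 'cV[R]_n) (M : 'M[R]_n).
Hypothesis lam : 10 ^+ 80 <= lambda.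
Hypothesis xs : is_sign x.
Hypothesis n0 : (0 < n)%N.
Hypothesis HM : regular_noise lambda x M.

Local Notation Y := (spiked lambda x M).
Local Notation G := (tap_field lambda Y).
Local Notation u := (lambda^-1).
Local Notation nn := (Num.sqrt (n%:R : R)).
Local Notation F := (F_TAP lambda Y).

Let l0 : 0 < lambda := lambda_gt0 lam.
Let lne : lambda != 0. Proof. by rewrite gt_eqF. Qed.
Let n0' : 0 < n%:R :> R. Proof. by rewrite ltr0n. Qed.

Lemma open_cube_in_cube (m : 'cV[R]_n) : open_cube m -> in_cube m.
Proof.
by move=> mc i; have /andP[a b] := mc i; rewrite ler_norml (ltW a) ltW.
Qed.

Lemma tanhv_open_cube (h : 'cV[R]_n) : open_cube (tanhv h).
Proof. by move=> i; rewrite mxE; exact: tanh_in. Qed.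

(** The quadratic and quartic part of the energy, Lipschitz up to the boundary
    of the cube, unlike the entropy. *)
Definition interaction (m : 'cV[R]_n) : R :=
  - (lambda / (2 * n%:R)) * dot m (Y *m m) - lambda ^+ 2 / 4 * (1 - overlap m) ^+ 2.

Lemma F_TAPE m : F m = interaction m - n%:R^-1 * \sum_i binary_entropy (m i ord0).
Proof. by rewrite /F_TAP /interaction; ring. Qed.

Lemma interaction_lipschitz (m s : 'cV[R]_n) : in_cube m -> in_cube s ->
  `|interaction m - interaction s| <= 3 * lambda ^+ 2 / nn * l2norm (m - s).
Proof.
move=> mc sc; have s0 : 0 < nn by rewrite sqrtr_gt0.
set D := l2norm (m - s).
have D0 : 0 <= D := l2norm_ge0 _.
have sum2 : l2norm (m + s) <= 2 * nn.
  apply: le_trans (l2normD _ _) _.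
  by have := in_cube_norm mc; have := in_cube_norm sc; lra.
have E1 : dot m (Y *m m) - dot s (Y *m s) = dot (m + s) (Y *m (m - s)).
  rewrite mulmxBr dotDl !dotBr (dot_sym s m (spiked_sym HM)).
  by ring.
have B1 : `|dot m (Y *m m) - dot s (Y *m s)| <= (2 * nn) * ((lambda + 36) * D).
  rewrite E1; apply: le_trans (normr_dot_le _ _) _.
  apply: ler_pM; rewrite ?l2norm_ge0//; exact: spiked_norm.
have B2 : `|overlap m - overlap s| <= 2 * nn * D / n%:R.
  rewrite overlapB normrM normfV (gtr0_norm n0') ler_wpM2r ?invr_ge0 ?(ltW n0')//.
  by apply: le_trans (normr_dot_le _ _) _; rewrite ler_wpM2r.
have [r [rE nE]] : exists r, nn = r /\ n%:R = r ^+ 2.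
  by exists nn; rewrite sqrtn_sqr.
rewrite rE in s0 B1 B2 *; rewrite /interaction.
have -> : - (lambda / (2 * n%:R)) * dot m (Y *m m) - lambda ^+ 2 / 4 * (1 - overlap m) ^+ 2 -
   (- (lambda / (2 * n%:R)) * dot s (Y *m s) - lambda ^+ 2 / 4 * (1 - overlap s) ^+ 2) =
   - (lambda / (2 * n%:R)) * (dot m (Y *m m) - dot s (Y *m s)) +
   lambda ^+ 2 / 4 * (2 - overlap m - overlap s) * (overlap m - overlap s) by ring.
apply: le_trans (ler_normD _ _) _.
have T1 : `|- (lambda / (2 * n%:R)) * (dot m (Y *m m) - dot s (Y *m s))| <=
    lambda * (lambda + 36) / r * D.
  rewrite normrM normrN (@gtr0_norm _ (lambda / _)) ?divr_gt0 ?mulr_gt0//.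
  apply: le_trans (ler_wpM2l _ B1) _; first by rewrite divr_ge0 ?mulr_ge0 ?ltW.
  by rewrite nE le_eqVlt; apply/orP; left; apply/eqP; field; rewrite gt_eqF.
have T2 : `|lambda ^+ 2 / 4 * (2 - overlap m - overlap s) * (overlap m - overlap s)| <=
    lambda ^+ 2 / r * D.
  have /andP[a1 a2] := overlap01 n0 mc; have /andP[b1 b2] := overlap01 n0 sc.
  rewrite normrM (@ger0_norm _ (_ * _ * _)); last first.
    by rewrite mulr_ge0 ?divr_ge0 ?sqr_ge0//; lra.
  apply: le_trans (ler_wpM2l _ B2) _.
    by rewrite mulr_ge0 ?divr_ge0 ?sqr_ge0//; lra.
  have -> : lambda ^+ 2 / r * D = lambda ^+ 2 / 4 * 2 * (2 * r * D / n%:R).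
    by rewrite nE; field; rewrite gt_eqF.
  rewrite ler_wpM2r ?divr_ge0 ?mulr_ge0 ?(ltW s0) ?(ltW n0')//.
  by rewrite ler_wpM2l ?divr_ge0 ?sqr_ge0//; lra.
apply: le_trans (lerD T1 T2) _.
rewrite -mulrDl -mulrDl ler_wpM2r// ler_wpM2r ?invr_ge0 ?(ltW s0)//.
have := ler_wpM2r (ltW l0) lam; have L0 := l0; rewrite mulrDr -expr2; lra.
Qed.

Lemma entropy_sum_le (m s : 'cV[R]_n) : open_cube m -> open_cube s ->
  \sum_i binary_entropy (s i ord0) - \sum_i binary_entropy (m i ord0) <=
  dot (\col_i atanh (m i ord0)) (m - s).
Proof.
move=> mc sc; rewrite -sumrB; apply: ler_sum => i _; rewrite !mxE.
exact: entropy_tangent.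
Qed.

(** The entropy is not Lipschitz up to the boundary of the cube, but by
    concavity its variation is bounded by the field h at one of the two
    points. *)
Lemma F_gap (h s : 'cV[R]_n) (b : R) : open_cube s -> 0 <= b -> l2norm h <= b * nn ->
  F (tanhv h) - F s <= (3 * lambda ^+ 2 + b) / nn * l2norm (tanhv h - s).
Proof.
move=> sc b0 hb; set m := tanhv h; set D := l2norm (m - s).
have s0 : 0 < nn by rewrite sqrtr_gt0.
have mc : open_cube m := tanhv_open_cube h.
have := interaction_lipschitz (open_cube_in_cube mc) (open_cube_in_cube sc).
rewrite -/D => /(le_trans (ler_norm _)) I1.
have E := entropy_sum_le mc sc.
have hE : \col_i atanh (m i ord0) = h.
  apply/matrixP => i j; rewrite (ord1 j) mxE (_ : m i ord0 = tanh (h i ord0)).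
    exact: atanh_tanh.
  by rewrite mxE.
rewrite hE in E.
have B : dot h (m - s) <= b * nn * D.
  by apply: le_trans (dot_le_l2norm _ _) _; rewrite ler_wpM2r ?l2norm_ge0.
rewrite !F_TAPE.
have {}E : n%:R^-1 * (\sum_i binary_entropy (s i ord0) - \sum_i binary_entropy (m i ord0)) <=
    b / nn * D.
  have -> : b / nn * D = n%:R^-1 * (b * nn * D).
    have [r [rE nE]] : exists r, nn = r /\ n%:R = r ^+ 2.
      by exists nn; rewrite sqrtn_sqr.
    by rewrite rE nE; field; rewrite -rE gt_eqF.
  by rewrite ler_wpM2l ?invr_ge0 ?(ltW n0')//; exact: le_trans E B.
by rewrite !mulrDl; rewrite mulrBr in E; lra.
Qed.

(** Compare with the point (1 - u / 2) x. Up to O(lambda), the energy is -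
    lambda^2 (q^2 / 2 + (1 - Q)^2 / 4) with q = <x, m> / n, hence at least -
    lambda^2 (1 + q^4) / 4 because q^2 <= Q, and this is smallest for q = 1. *)
Lemma minimizer_correlated (m : 'cV[R]_n) : global_minimizer F (@open_cube R n) m ->
  0 <= corr x m -> 1 - corr x m <= 152 * u.
Proof.
move=> [mc mmin] q0; have i1 := inv_le lam; have i0 := inv_gt0 lam; have L := lam.
have mc' := open_cube_in_cube mc.
pose t : R := 1 - u / 2.
have t1 : -1 < t < 1 by rewrite /t; lra.
have tc : open_cube (t *: x).
  by move=> i; rewrite mxE; case: (xs i) => ->; rewrite ?mulr1 ?mulrN1; lra.
have H := mmin _ tc.
have /andP[v1 v2] := overlap01 n0 mc'.
set q := corr x m in q0 *.
have qE : dot m x = q * n%:R by rewrite dotC -corrE.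
have qQ : q ^+ 2 <= overlap m.
  rewrite -(@ler_pM2r _ (n%:R ^+ 2)) ?exprn_gt0// -exprMn -qE.
  rewrite (_ : overlap m * n%:R ^+ 2 = dot m m * dot x x); last first.
    by rewrite overlapE (sign_dot xs); field; rewrite gt_eqF.
  exact: dot_sqr_le.
have U : F (t *: x) <= - (lambda ^+ 2 / 2) * t ^+ 2 + 18 * lambda.
  rewrite /F_TAP.
  have S0 : 0 <= \sum_i binary_entropy ((t *: x) i ord0).
    by apply: sumr_ge0 => i _; apply: entropy_ge0; exact: tc.
  have e1 : 0 <= n%:R^-1 * \sum_i binary_entropy ((t *: x) i ord0).
    by rewrite mulr_ge0// invr_ge0 ltW.
  have e2 : 0 <= lambda ^+ 2 / 4 * (1 - overlap (t *: x)) ^+ 2.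
    by rewrite mulr_ge0 ?divr_ge0 ?sqr_ge0.
  have Nx := normr_dot_le x (M *m x).
  have Nx2 : l2norm x * l2norm (M *m x) <= 36 * n%:R.
    rewrite -(sign_dot xs) -sqr_l2norm expr2 mulrCA ler_wpM2l ?l2norm_ge0//.
    exact: noise_norm HM x.
  have e3 : - (36 * n%:R) <= dot x (M *m x).
    by have := le_trans Nx Nx2; rewrite ler_norml => /andP[].
  have -> : dot (t *: x) (Y *m (t *: x)) = t ^+ 2 * (lambda * n%:R + dot x (M *m x)).
    rewrite -scalemxAr dotZl dotZr spiked_mul dotDr dotZr (sign_dot xs).
    by rewrite /corr (sign_dot xs) divff ?gt_eqF//; ring.
  have t2 : 0 <= t ^+ 2 <= 1 by rewrite sqr_ge0 /=; rewrite exprn_ile1// /t; lra.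
  have e4 : - (lambda / (2 * n%:R)) * (t ^+ 2 * (lambda * n%:R + dot x (M *m x))) =
     - (lambda ^+ 2 / 2) * t ^+ 2 - lambda / 2 * (t ^+ 2 * (dot x (M *m x) / n%:R)).
    by field; rewrite gt_eqF.
  have e5 : - 36 <= t ^+ 2 * (dot x (M *m x) / n%:R).
    have e6 : - 36 <= dot x (M *m x) / n%:R by rewrite ler_pdivlMr// mulNr.
    by move/andP: t2 => [t2 t3]; nra.
  rewrite e4; have := ler_wpM2l (ltW l0) e5; lra.
have Lb : - (lambda ^+ 2 / 2) * q ^+ 2 - 18 * lambda - 1 - lambda ^+ 2 / 4 * (1 - overlap m) ^+ 2 <= F m.
  rewrite /F_TAP.
  have S1 : n%:R^-1 * \sum_i binary_entropy (m i ord0) <= 1.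
    rewrite mulrC ler_pdivrMr// mul1r -[n in n%:R]card_ord -sum1_card natr_sum.
    by apply: ler_sum => i _; apply: entropy_le1; exact: mc.
  have Nm : dot m (M *m m) <= 36 * n%:R.
    apply: le_trans (dot_le_l2norm _ _) _.
    apply: le_trans (ler_wpM2l (l2norm_ge0 _) (noise_norm HM m)) _.
    rewrite mulrCA -expr2 sqr_l2norm ler_wpM2l//; exact: in_cube_dot.
  have e1 : - (lambda / (2 * n%:R)) * dot m (Y *m m) =
     - (lambda ^+ 2 / 2) * q ^+ 2 - lambda / 2 * (dot m (M *m m) / n%:R).
    rewrite spiked_mul dotDr dotZr qE -/q; field; rewrite gt_eqF//.
  have e2 : dot m (M *m m) / n%:R <= 36 by rewrite ler_pdivrMr.
  rewrite e1; have := ler_wpM2l (ltW l0) e2; lra.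
have tt : 1 - u <= t ^+ 2 by rewrite /t; have := sqr_ge0 (u / 2); lra.
have C : - (lambda ^+ 2 / 2) * q ^+ 2 - 18 * lambda - 1 - lambda ^+ 2 / 4 * (1 - overlap m) ^+ 2
    <= - (lambda ^+ 2 / 2) * (1 - u) + 18 * lambda.
  apply: le_trans Lb (le_trans H (le_trans U _)).
  by have := ler_wpM2l (sqr_ge0 lambda) tt; lra.
have q1 : q <= 1.
  have q2 : q ^+ 2 <= 1 by lra.
  by rewrite -(@ler_pXn2r _ 2) ?nnegrE// expr1n.
have w1 : (1 - overlap m) ^+ 2 <= 1 - q ^+ 2.
  have : 1 - overlap m <= 1 - q ^+ 2 by lra.
  have : 0 <= 1 - overlap m by lra.
  have : 1 - overlap m <= 1 by lra.
  by nra.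
have l2 := sqr_ge0 lambda.
have C2 : lambda ^+ 2 / 4 * (1 - q ^+ 2) <= 37 * lambda.
  have := ler_wpM2l l2 w1.
  have lu : lambda ^+ 2 * u = lambda by field.
  lra.
have C3 : 1 - q ^+ 2 <= 148 * u.
  have -> : 1 - q ^+ 2 = (lambda ^+ 2 / 4 * (1 - q ^+ 2)) * (4 * u ^+ 2) by field.
  have -> : 148 * u = 37 * lambda * (4 * u ^+ 2) by field.
  by rewrite ler_wpM2r// mulr_ge0// sqr_ge0.
have : q ^+ 2 <= q by rewrite expr2 ler_piMl.
lra.
Qed.

End Energy.

Section Continuity.
Context {R : realType} {n : nat}.

Lemma cvg_finite_sum (T : Type) (Fl : set_system T) {FF : Filter Fl} (I : finType)
    (f : I -> T -> R) (l : I -> R) :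
  (forall i, f i @ Fl --> l i) -> (fun y => \sum_i f i y) @ Fl --> \sum_i l i.
Proof.
move=> H; elim: (index_enum I) => [|i s IH].
  rewrite big_nil (_ : (fun y => _) = fun=> 0); first exact: cvg_cst.
  by apply/funext => y; rewrite big_nil.
rewrite big_cons (_ : (fun y => _) = fun y => f i y + \sum_(j <- s) f j y).
  exact: cvgD.
by apply/funext => y; rewrite big_cons.
Qed.

(** Stated for row vectors because compactness of a product of intervals is a
    fact about rows ([rV_compact]). *)
Lemma quadratic_continuous (A : 'M[R]_n) :
  continuous (fun v : 'rV[R]_n => dot v^T (A *m v^T)).
Proof.
move=> v.
have -> : (fun v : 'rV[R]_n => dot v^T (A *m v^T)) =
    (fun v => \sum_i v ord0 i * \sum_j A i j * v ord0 j).
  apply/funext => w; apply: eq_bigr => i _; rewrite !mxE; congr (_ * _).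
  by apply: eq_bigr => j _; rewrite mxE.
apply: (@cvg_finite_sum _ (nbhs v)) => i; apply: cvgM; first exact: coord_continuous.
apply: (@cvg_finite_sum _ (nbhs v)) => j; apply: cvgM; [exact: cvg_cst|exact: coord_continuous].
Qed.

Lemma entropy_continuous (u : R) : -1 < u < 1 ->
  binary_entropy @ u --> binary_entropy u.
Proof.
move=> u1; apply/differentiable_continuous/derivable1_diffP.
exact: (@ex_derive _ _ _ _ _ _ _ (is_derive_entropy u1)).
Qed.

Lemma l2norm_le_sum (v : 'cV[R]_n) : l2norm v <= \sum_i `|v i ord0|.
Proof.
apply: l2norm_le; first by apply: sumr_ge0.
rewrite expr2 mulr_suml; apply: ler_sum => i _.
rewrite -expr2 -(real_normK (num_real (v i ord0))) expr2 ler_wpM2l//.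
by rewrite (bigD1 i)//= lerDl sumr_ge0.
Qed.

End Continuity.

Section Minimizer.
Context {R : realType} {n : nat}.
Variables (lambda : R) (x : 'cV[R]_n) (M : 'M[R]_n).
Hypothesis lam : 10 ^+ 80 <= lambda.
Hypothesis xs : is_sign x.
Hypothesis n0 : (0 < n)%N.
Hypothesis HM : regular_noise lambda x M.

Local Notation Y := (spiked lambda x M).
Local Notation G := (tap_field lambda Y).
Local Notation nn := (Num.sqrt (n%:R : R)).
Local Notation F := (F_TAP lambda Y).

Let l0 : 0 < lambda := lambda_gt0 lam.
Let n0' : 0 < n%:R :> R. Proof. by rewrite ltr0n. Qed.

Lemma F_TAP_continuous (v : 'rV[R]_n) : (forall i, -1 < v ord0 i < 1) ->
  (fun v : 'rV[R]_n => F v^T) @ v --> F v^T.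
Proof.
move=> v1; rewrite /F_TAP.
have qc (A : 'M[R]_n) : (fun v : 'rV[R]_n => dot v^T (A *m v^T)) @ v -->
    dot v^T (A *m v^T) by exact: quadratic_continuous.
have cM (k l : R) (g : 'rV[R]_n -> R) : g @ v --> l -> (fun v => k * g v) @ v --> k * l.
  move=> gl; exact: (@cvgM R _ (nbhs v) _ _ _ _ _ (@cvg_cst _ k _ (nbhs v) _) gl).
have c2 : (fun v : 'rV[R]_n => \sum_i binary_entropy (v^T i ord0)) @ v -->
    \sum_i binary_entropy (v^T i ord0).
  apply: (@cvg_finite_sum _ _ (nbhs v)) => i; rewrite mxE.
  rewrite (_ : (fun v : 'rV[R]_n => binary_entropy (v^T i ord0)) =
    binary_entropy \o (fun v : 'rV[R]_n => v ord0 i)); last first.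
    by apply/funext => w /=; rewrite mxE.
  by apply: cvg_comp; [exact: coord_continuous|exact: entropy_continuous].
have oc : (fun v : 'rV[R]_n => overlap v^T) @ v --> overlap v^T.
  rewrite (_ : (fun v : 'rV[R]_n => overlap v^T) =
     fun v => n%:R^-1 * dot v^T (1%:M *m v^T)); last first.
    by apply/funext => w; rewrite overlapE mul1mx mulrC.
  by rewrite overlapE mulrC -[X in dot _ X]mul1mx; exact: cM.
have o1 : (fun v : 'rV[R]_n => 1 - overlap v^T) @ v --> 1 - overlap v^T.
  exact: (@cvgB _ _ _ (nbhs v) _ _ _ _ _ (@cvg_cst _ (1 : R) _ (nbhs v) _) oc).
have c3 : (fun v : 'rV[R]_n => (1 - overlap v^T) ^+ 2) @ v --> (1 - overlap v^T) ^+ 2.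
  rewrite (_ : (fun v : 'rV[R]_n => (1 - overlap v^T) ^+ 2) =
    fun v => (1 - overlap v^T) * (1 - overlap v^T)); last first.
    by apply/funext => w; rewrite expr2.
  by rewrite expr2; exact: (@cvgM R _ (nbhs v) _ _ _ _ _ o1 o1).
exact: cvgB (cvgB (cM _ _ _ (qc _)) (cM _ _ _ c2)) (cM _ _ _ c3).
Qed.

(** Clipping to [- t, t] changes the interaction by at most 3 lambda^2 / sqrt n
    times the distance, and increases the sum of the entropies by at least
    atanh t = 3 lambda^2 sqrt n times the sum of the changes, which after
    division by n is at least as large. So the minimum over the open cube is a
    minimum over a compact cube. *)
Lemma clip_le (t : R) (m : 'cV[R]_n) : 0 <= t < 1 -> atanh t = 3 * lambda ^+ 2 * nn ->
  open_cube m -> exists c : 'cV[R]_n, (forall i, -t <= c i ord0 <= t) /\ F c <= F m.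
Proof.
move=> /andP[t0 t1] tE mc; set b := 3 * _ * _ in tE.
pose c : 'cV[R]_n := \col_i (if t < m i ord0 then t else
  if m i ord0 < - t then - t else m i ord0).
have cb i : -t <= c i ord0 <= t.
  rewrite mxE; case: ltP => [_|h1]; first by apply/andP; split; lra.
  by case: ltP => h2; apply/andP; split; lra.
exists c; split=> //.
have cc : open_cube c by move=> i; have /andP[a1 a2] := cb i; apply/andP; split; lra.
have I := interaction_lipschitz lam xs n0 HM (open_cube_in_cube cc) (open_cube_in_cube mc).
have {I} := le_trans (ler_norm _) I => I.
have E := entropy_sum_le cc mc.
have atN : atanh (- t) = - b.
  by rewrite -tE /atanh opprK; ring.
have E2 : dot (\col_i atanh (c i ord0)) (c - m) = - (b * \sum_i `|(c - m) i ord0|).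
  rewrite mulr_sumr -sumrN; apply: eq_bigr => i _; rewrite !mxE.
  case: ltP => [h1|h1]; first by rewrite tE ler0_norm; [ring|lra].
  case: ltP => h2; first by rewrite atN ger0_norm; [ring|lra].
  by rewrite subrr normr0 !mulr0 oppr0.
have s0 : 0 < nn by rewrite sqrtr_gt0.
have L := l2norm_le_sum (c - m).
rewrite !F_TAPE; rewrite E2 in E.
have E3 : n%:R^-1 * (\sum_i binary_entropy (m i ord0) - \sum_i binary_entropy (c i ord0)) <=
    - (3 * lambda ^+ 2 / nn * \sum_i `|(c - m) i ord0|).
  have -> : 3 * lambda ^+ 2 / nn * \sum_i `|(c - m) i ord0| =
      n%:R^-1 * (b * \sum_i `|(c - m) i ord0|).
    rewrite /b; have [r [rE nE]] : exists r, nn = r /\ n%:R = r ^+ 2.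
      by exists nn; rewrite sqrtn_sqr.
    by rewrite rE nE; field; rewrite -rE gt_eqF.
  by rewrite -mulrN ler_wpM2l ?invr_ge0 ?(ltW n0').
have L3 : 3 * lambda ^+ 2 / nn * l2norm (c - m) <= 3 * lambda ^+ 2 / nn * \sum_i `|(c - m) i ord0|.
  by rewrite ler_wpM2l// divr_ge0 ?(ltW s0)// mulr_ge0 ?sqr_ge0.
by rewrite mulrBr in E3; lra.
Qed.

Lemma minimizer_exists : exists m : 'cV[R]_n, global_minimizer F (@open_cube R n) m.
Proof.
pose t := tanh (3 * lambda ^+ 2 * nn).
have tE : atanh t = 3 * lambda ^+ 2 * nn by exact: atanh_tanh.
have /andP[_ t1] := tanh_in (3 * lambda ^+ 2 * nn); rewrite -/t in t1.
have t0 : 0 <= t.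
  have b0 : 0 <= 3 * lambda ^+ 2 * nn.
    by apply: mulr_ge0; rewrite ?sqrtr_ge0//; apply: mulr_ge0; rewrite ?sqr_ge0.
  have /andP[+ _] := tanh_lipschitz b0.
  by rewrite /t {2}/tanh oppr0 subrr mul0r subr0.
pose A : set 'rV[R]_n := [set v | forall i, `[- t, t]%classic (v ord0 i)].
have cA : compact A.
  by apply: (@rV_compact _ _ (fun=> `[- t, t]%classic)) => i; exact: segment_compact.
have A0 : A !=set0.
  by exists 0 => i /=; rewrite mxE in_itv/=; apply/andP; split; lra.
have Ac v : A v -> forall i, -1 < v ord0 i < 1.
  move=> Av i; have := Av i; rewrite /= in_itv/= => /andP[a b].
  by apply/andP; split; lra.
have [|c cAm cmin] := @compact_EVT_min _ R (fun v : 'rV[R]_n => F v^T) A A0 cA.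
  apply: continuous_in_subspaceT => v; rewrite inE => /Ac; exact: F_TAP_continuous.
rewrite inE in cAm; exists c^T; split.
  by move=> i; rewrite mxE; exact: Ac.
move=> m mc; have tt : 0 <= t < 1 by rewrite t0.
have [p [pb pF]] := clip_le tt tE mc.
apply: le_trans pF; have := cmin p^T; rewrite trmxK; apply.
rewrite inE => i; rewrite /= mxE in_itv; exact: pb.
Qed.

(** Let h = atanh m and D = h - G(m, m). Moving the field from h to h - ep D
    lowers the energy by at least a multiple of ep times the sum of (slope of
    tanh) D_i^2, because the tangent inequality of the entropy is taken at the
    new point and the interaction is quadratic. At a minimizer this sum
    vanishes, so that the new magnetization is m and D = 0. *)
Lemma minimizer_stationary (m : 'cV[R]_n) : global_minimizer F (@open_cube R n) m ->
  exists2 h, m = tanhv h & h = G (tanhv h) (tanhv h).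
Proof.
move=> [mc mmin].
pose h : 'cV[R]_n := \col_i atanh (m i ord0).
have atanhK (v : R) : -1 < v < 1 -> tanh (atanh v) = v.
  move=> /andP[v1 v2]; rewrite /tanh.
  have p1 : 0 < (1 + v) / 2 by lra.
  have p2 : 0 < (1 - v) / 2 by lra.
  set a := expR _; set b := expR _.
  have a0 : 0 < a by exact: expR_gt0.
  have b0 : 0 < b by exact: expR_gt0.
  have ab : a * b = 1 by rewrite /a /b -expRD subrr expR0.
  have aa : a * a * ((1 - v) / 2) = (1 + v) / 2.
    have E1 : (1 + v) / 2 = expR (ln ((1 + v) / 2)) by rewrite lnK ?posrE.
    have E2 : (1 - v) / 2 = expR (ln ((1 - v) / 2)) by rewrite lnK ?posrE.
    by rewrite [X in _ * X = _]E2 [RHS]E1 /a -!expRD; congr expR; rewrite /atanh; lra.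
  have bE : b = a^-1 by rewrite -[a^-1]mul1r -ab mulrC mulKf// gt_eqF.
  rewrite bE; have nz : a != 0 by rewrite gt_eqF.
  have nz2 : a * a + 1 != 0 by rewrite gt_eqF// addr_gt0// mulr_gt0.
  have -> : (a - a^-1) / (a + a^-1) = (a * a - 1) / (a * a + 1).
    by field; rewrite nz nz2.
  by apply: (mulIf nz2); rewrite divfK//; lra.
have mE : m = tanhv h.
  by apply/matrixP => i j; rewrite (ord1 j) !mxE atanhK//; exact: mc.
exists h => //; apply/eqP; rewrite -subr_eq0; apply/eqP.
rewrite -mE; set g := G m m; set D : 'cV[R]_n := h - g.
(* K bounds the curvature of the interaction, and the step length ep is
   comparable to 1 / K. *)
pose K : R := lambda * (lambda + 36) + lambda ^+ 2.
have L0 := l0; have K0 : 0 <= K by rewrite addr_ge0 ?sqr_ge0// mulr_ge0//; lra.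
pose ep : R := (2 * (1 + K))^-1.
have ep0 : 0 < ep by rewrite invr_gt0; lra.
have K1 : 0 < 1 + K by rewrite ltr_pwDl.
have epK : ep * (1 + K) = 1 / 2 by rewrite /ep; field; rewrite gt_eqF.
pose h' : 'cV[R]_n := h - ep *: D; pose t : 'cV[R]_n := tanhv h' - m.
have mc' := open_cube_in_cube mc.
have m'c : open_cube (tanhv h') := tanhv_open_cube h'.
have E := entropy_sum_le m'c mc.
have h'E : \col_i atanh (tanhv h' i ord0) = h'.
  apply/matrixP => i j; rewrite (ord1 j) mxE (_ : tanhv h' i ord0 = tanh (h' i ord0)).
    exact: atanh_tanh.
  by rewrite mxE.
rewrite h'E -/t in E.
have /andP[v1 v2] := overlap01 n0 mc'.
have m't : tanhv h' = m + t by rewrite /t addrC subrK.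
(* Second order expansion of the interaction. The square of the change of
   overlap has a favourable sign. *)
have Q : n%:R * (interaction lambda x M (tanhv h') - interaction lambda x M m) <=
    - dot g t + K / 2 * dot t t.
  rewrite /interaction m't.
  have q1 : dot (m + t) (Y *m (m + t)) = dot m (Y *m m) + 2 * dot t (Y *m m) + dot t (Y *m t).
    rewrite mulmxDr dotDl !dotDr (dot_sym m t (spiked_sym HM)); ring.
  have q2 : overlap (m + t) = overlap m + (2 * dot m t + dot t t) / n%:R.
    by rewrite !overlapE dot_sqrD -mulrDl; congr (_ / _); ring.
  have q3 : - ((lambda + 36) * dot t t) <= dot t (Y *m t).
    have : `|dot t (Y *m t)| <= (lambda + 36) * dot t t.
      apply: le_trans (normr_dot_le _ _) _.
      apply: le_trans (ler_wpM2l (l2norm_ge0 _) (spiked_norm lam xs n0 HM t)) _.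
      by rewrite mulrCA -expr2 sqr_l2norm.
    by rewrite ler_norml => /andP[].
  have gE : dot g t = lambda * dot t (Y *m m) - lambda ^+ 2 * (1 - overlap m) * dot m t.
    by rewrite /g /tap_field dotBl !dotZl (dotC _ t).
  rewrite q1 q2 gE /K.
  set A := dot m (Y *m m); set B := dot t (Y *m m); set C := dot t (Y *m t) in q3 *.
  set s := 2 * dot m t + dot t t; set o := overlap m in v1 v2 *.
  have -> : n%:R * (- (lambda / (2 * n%:R)) * (A + 2 * B + C) -
     lambda ^+ 2 / 4 * (1 - (o + s / n%:R)) ^+ 2 -
     (- (lambda / (2 * n%:R)) * A - lambda ^+ 2 / 4 * (1 - o) ^+ 2)) =
     - lambda * B - lambda / 2 * C + lambda ^+ 2 / 2 * (1 - o) * s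
     - lambda ^+ 2 / 4 * (s ^+ 2 / n%:R).
    by field; rewrite gt_eqF.
  have p1 : 0 <= lambda ^+ 2 / 4 * (s ^+ 2 / n%:R).
    by rewrite mulr_ge0 ?divr_ge0 ?sqr_ge0 ?(ltW n0').
  have p2 := ler_wpM2l (ltW l0) q3.
  have p3 : lambda ^+ 2 * (1 - o) * dot t t <= lambda ^+ 2 * dot t t.
    rewrite ler_wpM2r ?dot_ge0// ler_piMr ?sqr_ge0//; lra.
  rewrite /s in p1 *; lra.
have H := mmin _ m'c; rewrite !F_TAPE in H.
have T : 0 <= (1 - ep) * dot D t + K / 2 * dot t t.
  have e1 : 0 <= n%:R * (interaction lambda x M (tanhv h') - interaction lambda x M m) +
     (\sum_i binary_entropy (m i ord0) - \sum_i binary_entropy (tanhv h' i ord0)).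
    have := ler_wpM2l (ltW n0') H; rewrite !mulrBr !mulrA divff ?gt_eqF// !mul1r.
    by lra.
  have e2 : dot h' t = dot g t + (1 - ep) * dot D t.
    rewrite /h' dotBl dotZl (_ : h = g + D); last by rewrite /D addrC subrK.
    by rewrite dotDl; ring.
  by lra.
pose sl i := tanh_slope (h' i ord0) (h i ord0).
(* The change of magnetization is the change of field times a slope. *)
have tE i : t i ord0 = - (ep * (sl i * D i ord0)).
  have mi : m i ord0 = tanh (h i ord0) by rewrite {1}mE mxE.
  have hd : h' i ord0 - h i ord0 = - (ep * D i ord0).
    have aux (a b : 'cV[R]_n) : (a - ep *: b) i ord0 - a i ord0 = - (ep * b i ord0).
      by rewrite !mxE; ring.
    exact: aux.
  have aux (a b : 'cV[R]_n) : (tanhv a - b) i ord0 = tanh (a i ord0) - b i ord0.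
    by rewrite !mxE.
  by rewrite /t aux mi -tanh_slopeE -/(sl i) hd; ring.
have sl01 i : 0 <= sl i <= 1 := tanh_slope_ge0_le1 _ _.
pose S := \sum_i sl i * D i ord0 ^+ 2.
have DtE : dot D t = - (ep * S).
  by rewrite /S mulr_sumr -sumrN; apply: eq_bigr => i _; rewrite tE; ring.
have ttS : dot t t <= ep ^+ 2 * S.
  rewrite /S mulr_sumr; apply: ler_sum => i _; rewrite tE.
  have /andP[a1 a2] := sl01 i.
  have -> : - (ep * (sl i * D i ord0)) * - (ep * (sl i * D i ord0)) =
    ep ^+ 2 * (sl i * (sl i * D i ord0 ^+ 2)) by ring.
  rewrite ler_wpM2l ?sqr_ge0// ler_piMl// mulr_ge0 ?sqr_ge0//.
have S0 : 0 <= S.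
  by apply: sumr_ge0 => i _; have /andP[a1 _] := sl01 i; rewrite mulr_ge0 ?sqr_ge0.
have SZ : S = 0.
  apply/eqP; rewrite eq_le S0 andbT leNgt; apply/negP => Sp.
  have ep1 : ep <= 1 / 2 by have := mulr_ge0 (ltW ep0) K0; lra.
  have f1 : K / 2 * dot t t <= K / 2 * (ep ^+ 2 * S) by rewrite ler_wpM2l// divr_ge0.
  have f2 : ep * K <= 1 / 2 by lra.
  have eS : 0 < ep * S by rewrite mulr_gt0.
  have f3 : K / 2 * (ep ^+ 2 * S) = (ep * K) / 2 * (ep * S) by ring.
  have f4 : (ep * K) / 2 * (ep * S) <= 1 / 4 * (ep * S) by rewrite ler_wpM2r ?(ltW eS)//; lra.
  have f5 : 1 / 2 * (ep * S) <= (1 - ep) * (ep * S) by rewrite ler_wpM2r ?(ltW eS)//; lra.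
  rewrite DtE in T; clear -T f1 f3 f4 f5 eS; lra.
(* Whether the slope or D_i vanishes, the coordinate does not move. *)
have tz i : t i ord0 = 0.
  have /eqP := SZ; rewrite /S psumr_eq0; last first.
    by move=> k _; have /andP[a1 _] := sl01 k; rewrite mulr_ge0 ?sqr_ge0.
  move=> /allP /(_ i); rewrite mem_index_enum => /(_ isT) /=.
  rewrite mulf_eq0 sqrf_eq0 tE => /orP[] /eqP ->; ring.
have hh : h' = h.
  apply/matrixP => i j; rewrite (ord1 j) -(atanh_tanh (h' i ord0)) -(atanh_tanh (h i ord0)).
  have e (a : 'cV[R]_n) : tanh (a i ord0) = tanhv a i ord0 by rewrite mxE.
  rewrite !e -mE; suff -> : tanhv h' i ord0 = m i ord0 by [].
  by rewrite m't mxE tz addr0.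
have : ep *: D = 0 by apply/eqP; rewrite -oppr_eq0 -(inj_eq (addrI h)) addr0; apply/eqP.
by move/eqP; rewrite scaler_eq0 (gt_eqF ep0) /= => /eqP.
Qed.

End Minimizer.

(** * The spectral initialization *)

Section TopEigenvalue.
Context {R : realType} {n : nat}.

(** Otherwise the quadratic form would take a negative value close to c, in the
    direction - B c. *)
Lemma psd_kernel (B : 'M[R]_n) (c : 'cV[R]_n) : B^T = B ->
  (forall w, 0 <= dot w (B *m w)) -> dot c (B *m c) = 0 -> B *m c = 0.
Proof.
move=> BT B0 Bc; set p := B *m c; apply/eqP; rewrite -dot_eq0; apply/eqP.
set P := dot p p; set q := dot p (B *m p).
have P0 : 0 <= P := dot_ge0 p.
have q0 : 0 <= q := B0 p.
apply/eqP; rewrite eq_le P0 andbT leNgt; apply/negP => Pp.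
(* The quadratic polynomial in s is minimal at - P / q; adding 1 keeps the
   denominator positive. *)
pose s : R := - (P / (q + 1)).
have := B0 (c + s *: p).
rewrite mulmxDr dotDl !dotDr -scalemxAr !dotZl !dotZr Bc (dot_sym c p BT) -/p -/P -/q.
have q1 : 0 < q + 1 by rewrite ltr_wpDl.
have sq : s * (q + 1) = - P by rewrite /s mulNr divfK// gt_eqF.
have s0 : s < 0 by rewrite /s oppr_lt0 divr_gt0.
have -> : 0 + s * P + (s * P + s * (s * q)) = s * (P + (P + s * q)) by ring.
have sE : s * q = - P - s by lra.
rewrite sE nmulr_rge0//; lra.
Qed.

(** The maximum of the Rayleigh quotient on a sphere is attained, and a
    maximizer is in the kernel of b - Y. *)
Lemma top_eigenvalue (Y : 'M[R]_n) (x : 'cV[R]_n) : Y^T = Y -> x != 0 ->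
  exists2 b, eigenvalue Y b & dot x (Y *m x) <= b * dot x x.
Proof.
move=> YT x0; set N := dot x x.
have N0 : 0 < N by rewrite lt0r dot_eq0 x0 dot_ge0.
pose A : set 'rV[R]_n := [set v | dot v^T (1%:M *m v^T) = N].
have clA : closed A.
  have -> : A = (fun v : 'rV[R]_n => dot v^T (1%:M *m v^T)) @^-1` [set N] by [].
  by apply: closed_comp => [v _|]; [exact: quadratic_continuous|exact: closed_eq].
have cA : compact A.
  apply: (subclosed_compact clA (@rV_compact R n (fun=> `[- (1 + N), 1 + N]%classic) _)).
    by move=> i; exact: segment_compact.
  move=> v Av i; rewrite /= in_itv/= -ler_norml.
  have : `|v ord0 i| ^+ 2 <= N.
    rewrite -Av mul1mx real_normK ?num_real// /dot (bigD1 i)//= !mxE expr2 lerDl.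
    by apply: sumr_ge0 => j _; rewrite -expr2 sqr_ge0.
  by have := normr_ge0 (v ord0 i); set z := `|_|; nra.
have A0 : A !=set0 by exists x^T; rewrite /A /= trmxK mul1mx.
have [c cAm cmax] := @compact_EVT_max _ R (fun v : 'rV[R]_n => dot v^T (Y *m v^T)) A A0 cA
  (continuous_subspaceT (@quadratic_continuous R n Y)).
rewrite inE /A /= mul1mx in cAm.
set C := c^T in cAm cmax.
pose b := dot C (Y *m C) / N.
have rayleigh w : dot w (Y *m w) <= b * dot w w.
  have [->|w0] := eqVneq w 0; first by rewrite dot0l dot0l mulr0.
  have W0 : 0 < dot w w by rewrite lt0r dot_eq0 w0 dot_ge0.
  pose k := Num.sqrt (N / dot w w).
  have k2 : k ^+ 2 = N / dot w w by rewrite sqr_sqrtr// divr_ge0 ?ltW.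
  have := cmax (k *: w)^T; rewrite trmxK inE /A /= trmxK mul1mx.
  rewrite -scalemxAr !dotZl !dotZr !mulrA -expr2 k2 divfK ?gt_eqF// => /(_ erefl) H.
  rewrite /b mulrAC ler_pdivlMr// -ler_pdivrMr//.
  by rewrite -mulrA mulrC.
exists b; last exact: rayleigh.
have BC : (b%:M - Y) *m C = 0.
  apply: psd_kernel.
  - by rewrite linearB/= tr_scalar_mx YT.
  - by move=> w; rewrite mulmxBl mul_scalar_mx dotBr dotZr subr_ge0; exact: rayleigh.
  - by rewrite mulmxBl mul_scalar_mx dotBr dotZr cAm /b divfK ?subrr// gt_eqF.
apply/eigenvalueP; exists c.
  move/eqP: BC; rewrite mulmxBl mul_scalar_mx subr_eq0 => /eqP /(congr1 trmx).
  by rewrite trmx_mul YT /C trmxK linearZ/= trmxK => <-.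
apply/eqP => c0; move: cAm; rewrite /C c0 trmx0 dot0l => /eqP.
by rewrite eq_sym gt_eqF.
Qed.

End TopEigenvalue.

Section Spectral.
Context {R : realType} {n : nat}.
Variables (lambda : R) (x : 'cV[R]_n) (M : 'M[R]_n).
Hypothesis lam : 10 ^+ 80 <= lambda.
Hypothesis xs : is_sign x.
Hypothesis n0 : (0 < n)%N.
Hypothesis HM : regular_noise lambda x M.

Local Notation Y := (spiked lambda x M).
Local Notation nn := (Num.sqrt (n%:R : R)).

Let l0 : 0 < lambda := lambda_gt0 lam.
Let n0' : 0 < n%:R :> R. Proof. by rewrite ltr0n. Qed.

Lemma noise_form v : `|dot v (M *m v)| <= 36 * dot v v.
Proof.
apply: le_trans (normr_dot_le _ _) _.
apply: le_trans (ler_wpM2l (l2norm_ge0 _) (noise_norm HM v)) _.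
by rewrite mulrCA -expr2 sqr_l2norm.
Qed.

(** The eigenvalue a is within 36 of lambda. Substituting a h = lambda q x + M
    h in itself expresses h as a combination of x, M x and M (M h) / a^2, and
    the Rayleigh quotient of h gives q >= lambda^2 / 4. *)
Lemma spectral_decomposed h0 : spectral_init lambda Y h0 -> 0 <= dot x h0 ->
  decomposed lambda x M (10 ^+ 8) h0 /\ l2norm h0 <= lambda ^+ 2 * nn.
Proof.
move=> [[h00 [a [aE amax]]] hn] xh.
have L := lam; have L0 := l0.
have l2 : 10 ^+ 80 * lambda <= lambda ^+ 2 by rewrite expr2 ler_wpM2r// ltW.
have x0 : x != 0 by rewrite -dot_eq0 (sign_dot xs) gt_eqF.
have [b bY bx] := top_eigenvalue (spiked_sym HM) x0.
have ab := amax b bY.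
have xYx : (lambda - 36) * n%:R <= dot x (Y *m x).
  rewrite spiked_mul dotDr dotZr /corr (sign_dot xs) divff ?gt_eqF// mulr1.
  by have := noise_form x; rewrite (sign_dot xs) ler_norml => /andP[H _]; lra.
have a1 : lambda - 36 <= a.
  apply: le_trans ab; rewrite (sign_dot xs) in bx.
  by have := le_trans xYx bx; rewrite ler_pM2r.
have a0 : 0 < a by lra.
set g := corr x h0; set H := dot h0 h0.
have g0 : 0 <= g by apply: divr_ge0 => //; exact: ltW.
have HE : H = n%:R * (lambda ^+ 2 * (lambda ^+ 2 - 1)).
  have P : 0 <= n%:R * lambda ^+ 2 * (lambda ^+ 2 - 1).
    by apply: mulr_ge0; [rewrite mulr_ge0 ?sqr_ge0|rewrite subr_ge0; lra].
  by rewrite /H -sqr_l2norm hn sqr_sqrtr// -mulrA.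
have H0 : 0 <= H := dot_ge0 h0.
have l4 : lambda ^+ 4 = lambda ^+ 2 * lambda ^+ 2 by ring.
have lsq := sqr_ge0 lambda.
have Hub : H <= n%:R * lambda ^+ 4.
  by rewrite HE l4 ler_wpM2l ?(ltW n0')// ler_wpM2l//; lra.
have hxE : dot x h0 = g * n%:R by rewrite corrE.
have ray : a * H = lambda * g ^+ 2 * n%:R + dot h0 (M *m h0).
  by rewrite /H -dotZr -aE spiked_mul dotDr dotZr (dotC h0 x) hxE -/g; ring.
have := noise_form h0; rewrite -/H ler_norml => /andP[m1 m2].
have CS : g ^+ 2 * n%:R <= H.
  have := dot_sqr_le x h0; rewrite hxE (sign_dot xs) -/H => C.
  by rewrite -(ler_pM2l n0') (_ : _ * (g ^+ 2 * n%:R) = (g * n%:R) ^+ 2)//; ring.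
have a2 : a <= lambda + 36.
  have Hp : 0 < H by rewrite lt0r dot_eq0 h00.
  rewrite -(ler_pM2r Hp); have := ler_wpM2l (ltW L0) CS; lra.
have g2lb : lambda ^+ 4 / 16 <= g ^+ 2.
  have e1 : (lambda - 72) * H <= lambda * (g ^+ 2 * n%:R).
    have := ler_wpM2r H0 a1; lra.
  have e2 : lambda / 2 * H <= (lambda - 72) * H by rewrite ler_wpM2r//; lra.
  have e3 : H / 2 <= g ^+ 2 * n%:R.
    by rewrite -(ler_pM2l L0); lra.
  rewrite -(ler_pM2r n0'); apply: le_trans e3; rewrite HE.
  have e4 : lambda ^+ 4 / 8 <= lambda ^+ 2 * (lambda ^+ 2 - 1).
    have : 1 <= lambda ^+ 2 / 2 by lra.
    rewrite l4 => e5; have := ler_wpM2l lsq e5; lra.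
  by have := ler_wpM2l (ltW n0') e4; have := mulr_ge0 (ltW n0') (sqr_ge0 (lambda ^+ 2)); lra.
have glb : lambda ^+ 2 / 4 <= g.
  rewrite -(@ler_pXn2r _ 2) ?nnegrE ?divr_ge0//.
  by rewrite (_ : (lambda ^+ 2 / 4) ^+ 2 = lambda ^+ 4 / 16)//; field.
have gub : g <= lambda ^+ 2.
  rewrite -(@ler_pXn2r _ 2) ?nnegrE// -exprM.
  by rewrite -(ler_pM2r n0'); apply: le_trans CS _; rewrite mulrC.
have ane : a != 0 by rewrite gt_eqF.
split; last first.
  apply: l2norm_le; first by rewrite mulr_ge0 ?sqrtr_ge0.
  by rewrite exprMn sqrtn_sqr -exprM mulrC.
exists (lambda * g / a), (lambda * g / a ^+ 2), ((a ^+ 2)^-1 *: (M *m (M *m h0))); split.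
(* The eigenvalue equation, used twice. *)
- have e1 : h0 = (lambda * g / a) *: x + a^-1 *: (M *m h0).
    transitivity (a^-1 *: (Y *m h0)); first by rewrite aE scalerA mulVf// scale1r.
    by rewrite spiked_mul scalerDr scalerA -/g [a^-1 * _]mulrC.
  have e2 : M *m h0 = (lambda * g / a) *: (M *m x) + a^-1 *: (M *m (M *m h0)).
    by rewrite {1}e1 mulmxDr -!scalemxAr.
  rewrite {1}e1 {1}e2 scalerDr !scalerA addrA.
  by congr (_ + _ *: _ + _ *: _); field.
- rewrite ler_pdivlMr//.
  have : lambda ^+ 2 / 8 * a <= lambda ^+ 2 / 8 * (2 * lambda).
    by rewrite ler_wpM2l ?divr_ge0//; lra.
  by have := ler_wpM2l (ltW L0) glb; lra.
- rewrite ger0_norm; last by rewrite divr_ge0 ?exprn_ge0 ?mulr_ge0 ?(ltW a0) ?(ltW L0).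
  rewrite ler_pdivrMr ?exprn_gt0//.
  have a3 : lambda ^+ 2 / 4 <= a ^+ 2.
    by rewrite (_ : lambda ^+ 2 / 4 = (lambda / 2) ^+ 2);
      [rewrite lerXn2r ?nnegrE ?divr_ge0 ?ltW//; lra|field].
  by have := ler_wpM2l (ltW L0) gub; have := ler_wpM2l (ltW L0) a3; lra.
- rewrite dotZl dotZr.
  have e1 : dot (M *m (M *m h0)) (M *m (M *m h0)) <= 36 ^+ 2 * (36 ^+ 2 * H).
    apply: le_trans (noise_sqr HM _) _; rewrite ler_wpM2l ?sqr_ge0//; exact: noise_sqr HM h0.
  have a3 : lambda ^+ 4 / 16 <= a ^+ 4.
    rewrite (_ : lambda ^+ 4 / 16 = (lambda / 2) ^+ 4); last by field.
    by rewrite lerXn2r ?nnegrE ?divr_ge0 ?ltW//; lra.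
  rewrite mulrA -invfM -exprD /= mulrC ler_pdivrMr ?exprn_gt0//.
  apply: le_trans e1 _; apply: (@le_trans _ _ (10 ^+ 8 * n%:R * (lambda ^+ 4 / 16))).
    by lra.
  by rewrite ler_wpM2l// mulr_ge0 ?exprn_ge0 ?(ltW n0').
Qed.

End Spectral.

(** * Convergence for regular noise *)

Section Symmetry.
Context {R : realType} {n : nat}.
Implicit Types (x m h : 'cV[R]_n) (Y M : 'M[R]_n) (lambda : R).

Lemma spikedN lambda x M : spiked lambda (- x) M = spiked lambda x M.
Proof. by rewrite /spiked linearN/= mulNmx mulmxN opprK. Qed.

Lemma is_signN x : is_sign x -> is_sign (- x).
Proof. by move=> xs i; rewrite mxE; case: (xs i) => ->; rewrite ?opprK; [right|left]. Qed.

Lemma regular_noiseN lambda x M : regular_noise lambda x M -> regular_noise lambda (- x) M.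
Proof.
move=> [H1 H2 H3 H4]; split=> //; apply: le_trans H4.
rewrite le_eqVlt; apply/orP; left; apply/eqP; congr (_%:R); apply: eq_card => i.
by rewrite !inE mulmxN mxE normrN.
Qed.

Lemma tanhvN h : tanhv (- h) = - tanhv h.
Proof. by apply/matrixP => i j; rewrite !mxE tanhN. Qed.

Lemma overlapN m : overlap (- m) = overlap m.
Proof. by rewrite !overlapE dotNl dotNr opprK. Qed.

Lemma tap_fieldN lambda Y m m' :
  tap_field lambda Y (- m) (- m') = - tap_field lambda Y m m'.
Proof. by rewrite /tap_field overlapN mulmxN !scalerN opprB opprK addrC. Qed.

Lemma decomposedN lambda x M E h : decomposed lambda x M E h ->
  decomposed lambda (- x) M E (- h).
Proof.
move=> [c [b [e [-> cl bl H]]]]; exists c, b, (- e); split=> //.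
  by rewrite mulmxN !scalerN -!opprD.
by rewrite dotNl dotNr opprK.
Qed.

Lemma F_TAPN lambda Y m : F_TAP lambda Y (- m) = F_TAP lambda Y m.
Proof.
rewrite /F_TAP overlapN mulmxN dotNl dotNr opprK; congr (_ - _ * _ - _).
by apply: eq_bigr => i _; rewrite mxE binary_entropyN.
Qed.

Lemma global_minimizerN lambda Y m :
  global_minimizer (F_TAP lambda Y) (@open_cube R n) m ->
  global_minimizer (F_TAP lambda Y) (@open_cube R n) (- m).
Proof.
move=> [mc mmin]; split; last by move=> m' /mmin; rewrite F_TAPN.
by move=> i; have /andP[a b] := mc i; rewrite mxE; apply/andP; split; lra.
Qed.

End Symmetry.

Section Convergence.
Context {R : realType} {n : nat}.

(** The topology of column vectors is that of the sup norm. *)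
Lemma cvg_l2norm (m : nat -> 'cV[R]_n) (s : 'cV[R]_n) (A r : R) : 0 <= r < 1 ->
  (forall k, (1 <= k)%N -> l2norm (m k - s) <= A * r ^+ k) -> m @ \oo --> s.
Proof.
move=> /andP[r0 r1] H.
have g0 : (fun k => A * r ^+ k) @ \oo --> (0 : R).
  rewrite -[X in _ --> X](mulr0 A); apply: cvgM; first exact: cvg_cst.
  by apply: cvg_expr; rewrite ger0_norm.
apply/cvg_ballP => e e0.
have /cvgrPdist_lt /(_ e e0) := g0.
move=> [N _ HN]; exists N.+1 => // k Nk.
split=> // i j; rewrite (ord1 j) /ball /= distrC.
have k1 : (1 <= k)%N by apply: leq_trans Nk.
have := HN k (ltnW Nk); rewrite /= sub0r normrN => /(le_lt_trans (ler_norm _)).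
apply: le_lt_trans; apply: le_trans (H k k1).
have -> : m k i ord0 - s i ord0 = (m k - s) i ord0 by rewrite !mxE.
set v := m k - s.
rewrite -(@ler_pXn2r _ 2) ?nnegrE ?l2norm_ge0// sqr_l2norm real_normK ?num_real//.
rewrite /dot (bigD1 i)//= expr2 lerDl.
by apply: sumr_ge0 => l _; rewrite -expr2 sqr_ge0.
Qed.

End Convergence.

Section Deterministic.
Context {R : realType} {n : nat}.
Variable lambda : R.
Hypothesis lam : 10 ^+ 80 <= lambda.
Hypothesis n0 : (0 < n)%N.

Local Notation nn := (Num.sqrt (n%:R : R)).
Local Notation C := (81 * lambda ^+ 8).

Let l0 : 0 < lambda := lambda_gt0 lam.
Let s0 : 0 < nn. Proof. by rewrite sqrtr_gt0 ltr0n. Qed.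

Definition algorithm_converges (Y : 'M[R]_n) (mstar : 'cV[R]_n) (r : R)
    (m : nat -> 'cV[R]_n) : Prop :=
  converges_at_rate lambda Y mstar C r m /\ (m @ \oo --> mstar \/ m @ \oo --> - mstar).

(** The constant 81 lambda^8 comes from the distance 40 lambda^2 r^k sqrt n and
    a Lipschitz constant 2 lambda^6 / sqrt n of the energy along the
    trajectory, with one unit to spare for strictness. *)
Lemma rate_converges (x mstar s : 'cV[R]_n) (M : 'M[R]_n) (r : R)
    (h : nat -> 'cV[R]_n) : regular_noise lambda x M -> is_sign x ->
  0 < r < 1 -> open_cube s -> (s = mstar \/ s = - mstar) ->
  (forall k, l2norm (h k.+1) <= lambda ^+ 6 * nn) ->
  (forall k, (1 <= k)%N -> l2norm (tanhv (h k) - s) <= 40 * lambda ^+ 2 * r ^+ k * nn) ->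
  algorithm_converges (spiked lambda x M) mstar r (fun k => tanhv (h k)).
Proof.
move=> HM xs /andP[r0 r1] sc sE hn hr.
have L := lam; have L0 := l0.
split.
  exists s => // k k1; have rk : 0 < r ^+ k by rewrite exprn_gt0.
  have l2 : 1 <= lambda ^+ 2 by rewrite exprn_ege1//; lra.
  have l68 : lambda ^+ 8 = lambda ^+ 6 * lambda ^+ 2 by ring.
  have l6 : 0 <= lambda ^+ 6 by rewrite exprn_ge0// ltW.
  have l28 : lambda ^+ 2 <= lambda ^+ 6 by rewrite ler_weXn2l//; lra.
  have l8 : 0 < lambda ^+ 8 by rewrite exprn_gt0.
  have d := hr k k1; split; last first.
    apply: le_lt_trans d _; rewrite ltr_pM2r// ltr_pM2r//.
    have : lambda ^+ 2 <= lambda ^+ 8 by rewrite ler_weXn2l//; lra.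
    by lra.
  have hk : l2norm (h k) <= lambda ^+ 6 * nn by case: k k1 {rk d} => [//|k _].
  apply: le_lt_trans (F_gap lam xs n0 HM sc l6 hk) _.
  apply: (@le_lt_trans _ _ ((2 * lambda ^+ 6) / nn * (40 * lambda ^+ 2 * r ^+ k * nn))).
    have c0 : 3 * lambda ^+ 2 + lambda ^+ 6 <= 2 * lambda ^+ 6.
      have : 3 * lambda ^+ 2 <= lambda ^+ 3.
        by rewrite [lambda ^+ 3]exprS ler_wpM2r ?sqr_ge0//; lra.
      have : lambda ^+ 3 <= lambda ^+ 6 by rewrite ler_weXn2l//; lra.
      by lra.
    have i0 : 0 <= nn^-1 by rewrite invr_ge0 ltW.
    apply: ler_pM => //; rewrite ?l2norm_ge0//.
      by rewrite mulr_ge0// addr_ge0// mulr_ge0// sqr_ge0.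
    by rewrite ler_wpM2r.
  have -> : 2 * lambda ^+ 6 / nn * (40 * lambda ^+ 2 * r ^+ k * nn) =
      80 * lambda ^+ 8 * r ^+ k by field; rewrite gt_eqF.
  by rewrite ltr_pM2r//; lra.
have cv : (fun k => tanhv (h k)) @ \oo --> s.
  apply: (@cvg_l2norm _ _ _ _ (40 * lambda ^+ 2 * nn) r).
    by rewrite (ltW r0).
  by move=> k k1; apply: le_trans (hr k k1) _; rewrite mulrAC.
by case: sE => <-; [left|right].
Qed.

(** The sign of mstar is left open because the spike may have to be replaced by
    its opposite, to be positively correlated with the eigenvector. *)
Lemma fixed_point_attracts (x s mstar h0 : 'cV[R]_n) (M : 'M[R]_n) :
  is_sign x -> regular_noise lambda x M ->
  let Y := spiked lambda x M in
  s = tap_field lambda Y (tanhv s) (tanhv s) -> decomposed lambda x M 1 s ->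
  (tanhv s = mstar \/ tanhv s = - mstar) ->
  spectral_init lambda Y h0 -> 0 <= dot x h0 ->
  algorithm_converges Y mstar 2^-1 (amp lambda Y h0 (lambda *: h0)) /\
  forall eta, 0 < eta < 1 ->
    algorithm_converges Y mstar (1 - 2^-1 * eta) (ngd lambda Y eta h0).
Proof.
move=> xs HM Y sE sd sm Hh0 xh; have L := lam.
have [h0d h0n] := spectral_decomposed lam xs n0 HM Hh0 xh.
have sc : open_cube (tanhv s) := tanhv_open_cube s.
split.
  apply: (@rate_converges x mstar (tanhv s) M) => //; first by lra.
    exact: (amp_norm lam xs n0 HM h0n).
  exact: (amp_rate lam xs n0 HM sE sd h0d).
move=> eta eta01; have /andP[t0 t1] := eta01.
apply: (@rate_converges x mstar (tanhv s) M) => //; first by lra.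
  move=> k; apply: le_trans (ngd_norm lam xs n0 HM h0n eta01 k.+1) _.
  rewrite ler_wpM2r ?(ltW s0)//.
  have l26 : 10 ^+ 80 * lambda ^+ 2 <= lambda ^+ 6.
    apply: (@le_trans _ _ (lambda ^+ 3)).
      by rewrite [lambda ^+ 3]exprS ler_wpM2r ?sqr_ge0.
    by rewrite ler_weXn2l//; lra.
  by have := sqr_ge0 lambda; lra.
move=> k _; rewrite [2^-1 * eta]mulrC.
exact: (ngd_rate lam xs n0 HM sE sd h0d h0n eta01 k).
Qed.

(** The observation determines the spike only up to sign. The minimizer is
    chosen positively correlated with x; the eigenvector may not be, and then
    everything is read with - x in place of x. *)
Lemma regular_noise_convergence (x : 'cV[R]_n) (M : 'M[R]_n) :
  is_sign x -> regular_noise lambda x M ->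
  let Y := spiked lambda x M in
  exists mstar : 'cV[R]_n,
    (forall m, global_minimizer (F_TAP lambda Y) (@open_cube R n) m <->
               m = mstar \/ m = - mstar) /\
    forall h0, spectral_init lambda Y h0 ->
      algorithm_converges Y mstar 2^-1 (amp lambda Y h0 (lambda *: h0)) /\
      forall eta, 0 < eta < 1 ->
        algorithm_converges Y mstar (1 - 2^-1 * eta) (ngd lambda Y eta h0).
Proof.
move=> xs HM Y; have L := lam.
have i1 := inv_le lam; have i0 := inv_gt0 lam.
have near m : global_minimizer (F_TAP lambda Y) (@open_cube R n) m -> 0 <= corr x m ->
    exists h, [/\ m = tanhv h, h = tap_field lambda Y (tanhv h) (tanhv h) &
      decomposed lambda x M 1 h].
  move=> mm q0; have H := minimizer_correlated lam xs n0 HM mm q0.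
  have [h mE hE] := minimizer_stationary lam xs n0 HM mm.
  exists h; split=> //; rewrite mE in H; exact: fixed_point_aligned.
have [m1 m1m] := minimizer_exists lam xs n0 HM.
have corrN m : corr x (- m) = - corr x m by rewrite /corr dotNr mulNr.
have [ms [msm ms0]] : exists ms, global_minimizer (F_TAP lambda Y) (@open_cube R n) ms /\
    0 <= corr x ms.
  have [q|q] := leP 0 (corr x m1); first by exists m1.
  by exists (- m1); split; [exact: global_minimizerN|rewrite corrN; lra].
have [s [msE sE sd]] := near ms msm ms0.
exists ms; split.
  move=> m; split=> [mm|[->//|->]]; last exact: global_minimizerN.
  wlog q0 : m mm / 0 <= corr x m => [W|].
    have [q|q] := leP 0 (corr x m); first exact: W.
    have := W (- m) (global_minimizerN mm); rewrite corrN => /(_ ltac:(lra)).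
    by case=> [<-|/oppr_inj ->]; [right; rewrite opprK|left].
  left; have [t [mE tE td]] := near m mm q0.
  by rewrite mE msE (fixed_point_unique lam xs n0 HM sE sd tE td).
move=> h0 Hh0.
have [xh|xh] := leP 0 (dot x h0).
  by apply: (fixed_point_attracts xs HM sE sd _ Hh0 xh); left.
rewrite /Y -spikedN; apply: (@fixed_point_attracts (- x) (- s)) => //.
- exact: is_signN.
- exact: regular_noiseN.
- by rewrite spikedN tanhvN tap_fieldN -sE.
- exact: decomposedN.
- by right; rewrite tanhvN msE.
- by rewrite spikedN.
- by rewrite dotNl oppr_ge0 ltW.
Qed.

End Deterministic.

(** * The probability that the noise is regular *)

Section Rates.
Context {R : realType}.
Variable lambda : R.
Hypothesis lam : 10 ^+ 80 <= lambda.

Local Notation u := (lambda^-1).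

Let l0 : 0 < lambda := lambda_gt0 lam.
Let lne : lambda != 0. Proof. by rewrite gt_eqF. Qed.

(** Any power is beaten by the exponential, from one term of its series. *)
Lemma expRN_le_inv (y : R) k : 0 < y -> expR (- y) <= k.+1`!%:R / y ^+ k.+1.
Proof.
move=> y0; have H := expR_ge1Dxn k (ltW y0).
rewrite expRN -[leRHS]invrK invf_div lef_pV2 ?posrE ?expR_gt0//; last first.
  by rewrite divr_gt0 ?exprn_gt0// ltr0n fact_gt0.
by apply: le_trans H; rewrite lerDr.
Qed.

(** Exponent of [block_norm_event] for the full matrix: delta = 1, s = 2 and
    norm 36, the least multiple of 4 that makes it negative with this s. *)
Definition norm_exponent : R := 8 * 2 * 1 + 8 * expR (- 2) - 36 ^+ 2 / 64.

Lemma expRN2 : expR (- 2) <= 2^-1 :> R.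
Proof.
rewrite expRN lef_pV2 ?posrE ?expR_gt0//.
by apply: le_trans (expR_ge1Dx 2); lra.
Qed.

Lemma norm_exponent_lt0 : norm_exponent < 0.
Proof. by rewrite /norm_exponent; have := expRN2; lra. Qed.

(** Exponent of [block_norm_event] for the blocks of size 4 n / lambda^3. The
    parameter s = lambda / 10^6 is small enough for the entropy 8 s delta to be
    below tau^2 / 64, both being of order lambda^-2, and large enough for exp
    (- s) to be negligible. *)
Definition block_exponent : R :=
  8 * (lambda / 10 ^+ 6) * (4 / lambda ^+ 3) + 8 * expR (- (lambda / 10 ^+ 6))
  - (16 * lambda)^-1 ^+ 2 / 64.

Lemma block_rate_le : expR (- (lambda / 10 ^+ 6)) <= 6 * 10 ^+ 18 * u ^+ 3.
Proof.
apply: le_trans (@expRN_le_inv _ 2 _) _; first by rewrite divr_gt0 ?exprn_gt0.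
rewrite (_ : 3`!%:R = 6 :> R)// le_eqVlt; apply/orP; left; apply/eqP.
by field.
Qed.

Lemma block_exponent_lt0 : block_exponent < 0.
Proof.
have L := lam; have i1 := inv_le lam; have i0 := inv_gt0 lam.
have u2 : 0 < u ^+ 2 by rewrite exprn_gt0.
have u3 := inv_exp_le lam 2.
have := block_rate_le; rewrite /block_exponent.
have -> : 8 * (lambda / 10 ^+ 6) * (4 / lambda ^+ 3) = 32 / 10 ^+ 6 * u ^+ 2 by field.
have -> : (16 * lambda)^-1 ^+ 2 / 64 = (16 ^+ 2 * 64)^-1 * u ^+ 2 by field.
lra.
Qed.

(** Exponent of [rare_large_coordinates_event] for the coordinates of M x above
    lambda / 128 in absolute value, on a proportion lambda^-4. *)
Definition coordinate_exponent : R :=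
  let b := (lambda / 128) ^+ 2 / 8 in 4 * expR (- b) - b * (lambda ^+ 4)^-1.

Lemma coordinate_rate_le :
  expR (- ((lambda / 128) ^+ 2 / 8)) <= 24 * (128 ^+ 2 * 8) ^+ 4 * u ^+ 8.
Proof.
apply: le_trans (@expRN_le_inv _ 3 _) _.
  by rewrite divr_gt0 ?exprn_gt0 ?divr_gt0.
rewrite (_ : 4`!%:R = 24 :> R)// le_eqVlt; apply/orP; left; apply/eqP.
by field.
Qed.

Lemma coordinate_exponent_lt0 : coordinate_exponent < 0.
Proof.
have L := lam; have i1 := inv_le lam; have i0 := inv_gt0 lam.
have u2 : 0 < u ^+ 2 by rewrite exprn_gt0.
have u3 := inv_exp_le lam 2.
have u83 : u ^+ 8 <= u ^+ 3 by rewrite ler_wiXn2l ?ltW//; lra.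
have := coordinate_rate_le; rewrite /coordinate_exponent.
have -> : (lambda / 128) ^+ 2 / 8 * (lambda ^+ 4)^-1 = (128 ^+ 2 * 8)^-1 * u ^+ 2 by field.
lra.
Qed.

Lemma block_small : expR (- (lambda / 10 ^+ 6)) <= 2^-1.
Proof.
have i1 := inv_le lam; have i0 := inv_gt0 lam.
have u31 : u ^+ 3 <= u by rewrite -[leRHS]expr1 ler_wiXn2l ?ltW//; lra.
have := block_rate_le; lra.
Qed.

Lemma coordinate_small : expR (- ((lambda / 128) ^+ 2 / 8)) <= 2^-1.
Proof.
have i1 := inv_le lam; have i0 := inv_gt0 lam.
have u81 : u ^+ 8 <= u by rewrite -[leRHS]expr1 ler_wiXn2l ?ltW//; lra.
have := coordinate_rate_le; lra.
Qed.

Definition failure_bound (n : nat) : R :=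
  expR (n%:R * norm_exponent) + expR (n%:R * block_exponent) +
  expR (n%:R * coordinate_exponent).

Lemma failure_bound_cvg : failure_bound @ \oo --> 0.
Proof.
have H (e : R) : e < 0 -> (fun n : nat => expR (n%:R * e)) @ \oo --> 0.
  move=> e0; under eq_fun do rewrite expRM_natl.
  by apply: cvg_expr; rewrite ger0_norm ?expR_ge0// -expR0 ltr_expR.
rewrite -[X in _ --> X](addr0 0) -[X in _ --> X + _](addr0 0).
by apply: cvgD; [apply: cvgD|]; apply: H;
  [exact: norm_exponent_lt0|exact: block_exponent_lt0|exact: coordinate_exponent_lt0].
Qed.

Lemma regular_noise_event (d : measure_display) (T : measurableType d)
    (P : probability T R) (n : nat) (x : 'I_n -> {RV P >-> R})
    (W : 'I_n -> 'I_n -> {RV P >-> R}) :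
  Z2_synchronization x W -> (0 < n)%N ->
  exists B : set T, [/\ measurable B, (P B <= (failure_bound n)%:E)%E &
    forall w, ~ B w ->
      is_sign (\col_i x i w) /\
      regular_noise lambda (\col_i x i w) (matrix_at W w)].
Proof.
move=> HZ n0; have [Hx _ HW _] := HZ; have L := lam; have L0 := l0.
have i1 := inv_le lam; have i0 := inv_gt0 lam.
have [B0 [mB0 PB0 H0]] := spike_is_sign Hx.
have one1 : 0 < (1 : R) <= 1 by rewrite ltr01 lexx.
have [B1 [mB1 PB1 H1]] := block_norm_event HW n0 one1
  (ltr0n _ 36 : 0 < 36 :> R) (ler0n _ 2 : 0 <= 2 :> R) expRN2.
have d2 : 0 < 4 / lambda ^+ 3 <= 1.
  rewrite divr_gt0 ?exprn_gt0//= -exprVn.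
  have : u ^+ 3 <= u by rewrite -[leRHS]expr1 ler_wiXn2l ?ltW//; lra.
  lra.
have t2 : 0 < (16 * lambda)^-1 by rewrite invr_gt0 mulr_gt0.
have s2 : 0 <= lambda / 10 ^+ 6 by rewrite divr_ge0 ?exprn_ge0 ?(ltW L0).
have [B2 [mB2 PB2 H2]] := block_norm_event HW n0 d2 t2 s2 block_small.
have d3 : 0 < (lambda ^+ 4)^-1 by rewrite invr_gt0 exprn_gt0.
have t3 : 0 < lambda / 128 by rewrite divr_gt0.
have [B3 [mB3 PB3 H3]] := rare_large_coordinates_event HZ n0 d3 t3 coordinate_small.
exists (((B0 `|` B1) `|` B2) `|` B3); split.
- by repeat apply: measurableU.
- apply: le_trans (measureU2 _ _ _) _ => //; first by repeat apply: measurableU.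
  rewrite /failure_bound EFinD leeD//.
  apply: le_trans (measureU2 _ _ _) _ => //; first exact: measurableU.
  rewrite EFinD leeD//.
  apply: le_trans (measureU2 _ _ _) _ => //.
  by rewrite -[leRHS]add0e leeD.
move=> w Bw.
have w0 : ~ B0 w by move=> H; apply: Bw; left; left; left.
have w1 : ~ B1 w by move=> H; apply: Bw; left; left; right.
have w2 : ~ B2 w by move=> H; apply: Bw; left; right.
have w3 : ~ B3 w by move=> H; apply: Bw; right.
have [xi Hxi] := H0 w w0.
have xE : \col_i x i w = sign_vec xi.
  by apply/matrixP => i j; rewrite !mxE; exact: Hxi.
rewrite xE; split.
  by move=> i; rewrite mxE; case: (xi i); [right|left]; rewrite ?expr1.
split.
- by have [Ws _ _ _] := HW; apply/matrixP => i j; rewrite !mxE.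
- move=> v v'; apply: (H1 w w1 [set: 'I_n]%SET) => [|i|i]; rewrite ?finset.in_setT//.
  by rewrite cardsT card_ord mul1r.
- exact: H2 w w2.
- exact: H3 w w3 xi Hxi.
Qed.

End Rates.

Theorem theorem2p4 (R : realType) :
  exists lambda0 : R, 0 < lambda0 /\
  forall lambda : R, lambda0 < lambda ->
  exists C mu eta0 alpha : R,
    [/\ 0 < C, 0 < mu, 0 < eta0 & 0 < alpha < 1] /\
  forall (d : nat -> measure_display) (T : forall n, measurableType (d n))
    (P : forall n, probability (T n) R)
    (x : forall n, 'I_n -> {RV (P n) >-> R})
    (W : forall n, 'I_n -> 'I_n -> {RV (P n) >-> R}),
    (forall n, Z2_synchronization (x n) (W n)) ->
    with_probability_to_1 P (fun n => [set w |
      let Y := observation lambda (x n) (W n) w in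
      exists mstar : 'cV[R]_n,
        (forall m, global_minimizer (F_TAP lambda Y) (@open_cube R n) m <->
                   m = mstar \/ m = - mstar) /\
        forall h0 : 'cV[R]_n, spectral_init lambda Y h0 ->
          (let m := amp lambda Y h0 (lambda *: h0) in
           converges_at_rate lambda Y mstar C alpha m /\
           (m @ \oo --> mstar \/ m @ \oo --> - mstar)) /\
          (forall eta : R, 0 < eta < eta0 ->
           let m := ngd lambda Y eta h0 in
           converges_at_rate lambda Y mstar C (1 - mu * eta) m /\
           (m @ \oo --> mstar \/ m @ \oo --> - mstar))]).
Proof.
exists (10 ^+ 80); split; first by rewrite exprn_gt0.
move=> lambda /ltW lam; have l0 := lambda_gt0 lam.
exists (81 * lambda ^+ 8), 2^-1, 1, 2^-1; split.
  by split; rewrite ?mulr_gt0 ?exprn_gt0 ?invr_gt0//; lra.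
move=> d T P x W HZ.
set E := fun n => [set w | _].
have H n : exists A : set (T n), [/\ measurable A, A `<=` E n &
    (0 < n)%N -> ((1 - failure_bound lambda n)%:E <= P n A)%E].
  (* The index n = 0 does not affect the limit; the empty event is chosen
     there. *)
  case: n => [|n]; first by exists set0; split.
  have [B [mB PB HB]] := regular_noise_event lam (HZ n.+1) (ltn0Sn n).
  exists (~` B); split; first exact: measurableC.
    move=> w Bw; have [xs HM] := HB w Bw.
    exact: (regular_noise_convergence lam (ltn0Sn n) xs HM).
  by move=> _; rewrite probability_setC// EFinB leeB.
pose A n := sval (cid (H n)).
have AP n := svalP (cid (H n)).
exists A; split.
- by move=> n; have [] := AP n.
- by move=> n; have [] := AP n.
have lo : (fun n => (1 - failure_bound lambda n)%:E) @ \oo --> 1%E.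
  apply: cvg_EFin; first by near=> n.
  rewrite -[X in _ --> X](subr0 (1 : R)).
  apply: cvgB; first exact: cvg_cst.
  exact: failure_bound_cvg.
apply: (squeeze_cvge _ lo); last exact: cvg_cst.
near=> n; have [mA _ loA] := AP n; apply/andP; split; last exact: probability_le1.
apply: loA.
by near: n; exact: nbhs_infty_gt.
Unshelve. all: by end_near. Qed.
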